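(* Let $T=(T,<)$ be an infinite complete rooted tree, with a fixed total ordering $<_t$ of the set of immediate successors of each $t\in T$ and associated partial ordering $<_a$. The following are equivalent. (a) There is a basis of families on $T$. (b) If there is an infinite $<$-chain, then there is a basis of families on chains of $(T,<)$; and if there is an infinite $<_a$-chain, then there is a basis of families on chains of $(T,<_a)$.
   Context: TREES. A tree is a partially ordered set $(T,<)$ in which $\{u:u<t\}$ is well ordered for every $t$; it is rooted if it has a least element $0$; it is complete in the sense that for all $t,u\in T$ the meet $t\wedge u=\max\{v: v\le t,\ v\le u\}$ exists. For $t<u$, $\mathrm{Is}_t(u)$ is the least $v$ with $t<v\le u$; $\mathrm{Is}_t$ denotes the set of all immediate successors of $t$. For each $t$ a total ordering $<_t$ of $\mathrm{Is}_t$ is fixed, and $t<_au$ iff there is $v$ with $t,u\in\mathrm{Is}_v$ and $t<_vu$. Thus a $<_a$-chain is a set of immediate successors of one node (or has at most one element). FAMILIES. A family on a set $I$ is a set of finite subsets of $I$, identified with a subset of $\{0,1\}^I$. It is compact if it is closed in $\{0,1\}^I$, and hereditary if it is closed under subsets. $\mathcal F\restriction A=\{s\in\mathcal F: s\subseteq A\}$. For a nonempty compact family $\mathcal F$ (a scattered compact space), $\mathrm{rk}(\mathcal F)$ is the largest ordinal $\alpha$ such that the Cantor–Bendixson derivative $\mathcal F^{(\alpha)}$ is nonempty, where $X^{(0)}=X$, $X^{(\alpha)}=\bigcap_{\beta<\alpha}(X^{(\beta)})'$ and $Y'$ is the set of accumulation points of $Y$ belonging to $Y$. A countable ordinal $\lambda\ge\omega$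 is exp-indecomposable if $\beta^\gamma<\lambda$ (ordinal exponentiation) for all $\beta,\gamma<\lambda$. For $\alpha<\omega_1$, $\iota(\alpha)$ is the least exp-indecomposable ordinal $>\alpha$. Let $\mathcal P=(P,<)$ be a partial ordering with an infinite chain. A family on chains of $\mathcal P$ is a family on $P$ whose elements are chains. $[P]^{\le n}_<$ is the family of all chains of cardinality at most $n$. $\mathcal F\sqcup_{\mathcal P}\mathcal G=\{s\cup t: s\in\mathcal F,\ t\in\mathcal G,\ s\cup t\text{ is a chain}\}$. The small rank is $\mathrm{srk}_{\mathcal P}(\mathcal F)=\min\{\mathrm{rk}(\mathcal F\restriction C): C\text{ an infinite chain of }\mathcal P\}$. A compact hereditary family $\mathcal F$ on chains of $\mathcal P$ is $(\alpha,\mathcal P)$-homogeneous if either $\alpha=0$ and $\mathcal F=\{\emptyset\}$, or $1\le\alpha<\omega_1$, $[P]^{\le 1}\subseteq\mathcal F$ and $\alpha=\mathrm{srk}_{\mathcal P}(\mathcal F)\le\mathrm{rk}(\mathcal F)<\iota(\alpha)$; it is homogeneous if this holds for some $\alpha<\omega_1$. For a total ordering these notions do not depend on the ordering, and $\mathcal P$ is omitted from the notation. UNIFORM FAMILIES. For a family $\mathcal F$ on $\omega$ let $\mathcal F_{\{n\}}=\{s: n<\min s\text{ (or }s=\emptyset),\ \{n\}\cup s\in\mathcal F\}$, and let $M/n=\{m\in M:m>n\}$. A family $\mathcal F$ on an infinite $M\subseteq\omega$ with $\emptyset\in\mathcal F$ is $\alpha$-uniform on $M$ ($\alpha<\omega_1$)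 if: $\mathcal F=\{\emptyset\}$ when $\alpha=0$; every $\mathcal F_{\{n\}}$, $n\in M$, is $\beta$-uniform on $M/n$ when $\alpha=\beta+1$; and every $\mathcal F_{\{n\}}$, $n\in M$, is $\alpha_n$-uniform on $M/n$ with $(\alpha_n)_{n\in M}$ an increasing sequence of ordinals below $\alpha$ with supremum $\alpha$ when $\alpha$ is limit. $\mathcal F$ is spreading if $\{m_0<\dots<m_k\}\in\mathcal F$ and $n_0<\dots<n_k$ with $m_i\le n_i$ for all $i$ imply $\{n_0,\dots,n_k\}\in\mathcal F$. $\mathfrak S$ is the collection of all hereditary, spreading, uniform families on $\omega$. BASES. Let $\mathcal F$ be a homogeneous family on chains of $\mathcal P$ and $\mathcal H$ a homogeneous family on $\omega$. A family $\mathcal G$ on chains of $\mathcal P$ is a multiplication of $\mathcal F$ by $\mathcal H$ if (M.1) $\mathcal G$ is homogeneous and $\iota(\mathrm{srk}_{\mathcal P}(\mathcal G))=\iota(\mathrm{srk}_{\mathcal P}(\mathcal F)\cdot\mathrm{srk}(\mathcal H))$; and (M.2) every sequence $(s_n)_{n<\omega}$ in $\mathcal F$ such that $\bigcup_n s_n$ is a chain has an infinite subsequence $(t_n)_n$ with $\bigcup_{n\in x}t_n\in\mathcal G$ for every $x\in\mathcal H$. A basis (of homogeneous families) on chains of $\mathcal P$ is a pair $(\mathfrak B,\times)$ such that: (B.1) $\mathfrak B$ consists of homogeneous families on chains of $\mathcal P$, contains all $[P]^{\le n}_<$, and for every $\omega\le\alpha<\omega_1$ contains some $\mathcal F$ with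 $\mathrm{srk}_{\mathcal P}(\mathcal F)=\alpha$; (B.2) $\mathfrak B$ is closed under $\cup$ and $\sqcup_{\mathcal P}$, and if $\mathcal F\subseteq\mathcal G\in\mathfrak B$, $\mathcal F$ is homogeneous on chains of $\mathcal P$ and $\iota(\mathrm{srk}_{\mathcal P}(\mathcal F))=\iota(\mathrm{srk}_{\mathcal P}(\mathcal G))$, then $\mathcal F\in\mathfrak B$; (B.3) $\times:\mathfrak B\times\mathfrak S\to\mathfrak B$ and $\mathcal F\times\mathcal H$ is a multiplication of $\mathcal F$ by $\mathcal H$ for all $\mathcal F\in\mathfrak B$, $\mathcal H\in\mathfrak S$. A basis of families on a set (here, on $T$) is a basis on chains of that set endowed with any total ordering. *)

(* Defs.v *)
From HB Require Import structures.
From mathcomp Require Import all_boot all_order.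
From mathcomp Require Import all_classical.
From mathcomp Require Import wochoice topology.

Set Implicit Arguments.
Unset Strict Implicit.
Unset Printing Implicit Defensive.

Import Order.TTheory.

Local Open Scope classical_set_scope.
Local Open Scope card_scope.

(* Ordinals are represented by well-founded trees: [osup J g] stands for the   *)
(* least ordinal strictly above all the [g j], so that one ordinal has many    *)
(* representations. Equality of ordinals is [oeq], not Leibniz equality.       *)
Inductive Ord : Type := osup (J : Type) (g : J -> Ord).

Definition oidx (a : Ord) : Type := let: osup J _ := a in J.
Definition osub (a : Ord) : oidx a -> Ord :=
  match a with osup _ g => g end.

Fixpoint ole (a b : Ord) : Prop :=
  match a with osup _ f => forall i, exists j : oidx b, ole (f i) (osub j) end.
Definition olt (a b : Ord) : Prop := exists j : oidx b, ole a (osub j).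
Definition oeq (a b : Ord) : Prop := ole a b /\ ole b a.

Definition ozero : Ord := osup (fun x : False => match x with end).
Definition osucc (a : Ord) : Ord := osup (fun _ : unit => a).
Definition oone : Ord := osucc ozero.
Definition oomega : Ord := osup (fun n : nat => iter n osucc ozero).

(* The (non-strict) supremum of a family of ordinals. *)
Definition ojoin (J : Type) (f : J -> Ord) : Ord :=
  osup (fun p : {j : J & oidx (f j)} => osub (projT2 p)).

(* a + b = sup of a and of the (a + b') + 1 for b' < b. *)
Fixpoint oadd (a b : Ord) : Ord :=
  match b with
  | osup J g => osup (fun x : oidx a + J =>
      match x with inl i => osub i | inr j => oadd a (g j) end)
  end.

(* a * b = sup of the a * b' + a for b' < b. *)
Fixpoint omul (a b : Ord) : Ord :=
  match b with osup J g => ojoin (fun j : J => oadd (omul a (g j)) a) end.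

(* a ^ b = sup of 1 and of the a ^ b' * a for b' < b. This gives 0 ^ b = 1 for *)
(* all b, including b > 0; [exp_indecomposable] below is insensitive to it.    *)
Fixpoint oexp (a b : Ord) : Ord :=
  match b with
  | osup J g => ojoin (fun x : option J =>
      match x with None => oone | Some j => omul (oexp a (g j)) a end)
  end.

(* Membership in omega_1. *)
Definition ocountable (a : Ord) : Prop :=
  exists e : nat -> Ord, forall b, olt b a -> exists n, oeq b (e n).

Definition olimit (a : Ord) : Prop :=
  olt ozero a /\ forall b, olt b a -> olt (osucc b) a.

Definition exp_indecomposable (l : Ord) : Prop :=
  [/\ ocountable l, ole oomega l &
      forall b c, olt b l -> olt c l -> olt (oexp b c) l].

(* iota(a) = l *)
Definition is_iota (a l : Ord) : Prop :=
  [/\ exp_indecomposable l, olt a l &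
      forall m, exp_indecomposable m -> olt a m -> ole l m].

Definition same_iota (a b : Ord) : Prop :=
  exists l, is_iota a l /\ is_iota b l.

Definition set_family (I : Type) := set (set I).

Definition family_on (I : Type) (A : set I) (F : set_family I) : Prop :=
  forall s, F s -> finite_set s /\ s `<=` A.

Definition hereditary (I : Type) (F : set_family I) : Prop :=
  forall s t, F s -> t `<=` s -> F t.

Definition fam_restrict (I : Type) (F : set_family I) (A : set I) : set_family I :=
  [set s | F s /\ s `<=` A].

Definition char_fun (I : Type) (s : set I) : prod_topology (fun _ : I => bool) :=
  fun i => i \in s.

Definition compact_family (I : Type) (F : set_family I) : Prop :=
  closed (@char_fun I @` F).

Definition CB_deriv (I : Type) (Y : set_family I) : set_family I :=
  [set s | Y s /\ limit_point (@char_fun I @` Y) (char_fun s)].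

(* It is enough to intersect over the [g j], as these are cofinal among the    *)
(* ordinals below [osup J g]. The clause [F s] only matters for the stage 0.   *)
Fixpoint CB (I : Type) (F : set_family I) (a : Ord) : set_family I :=
  match a with
  | osup J g => [set s | F s /\ forall j : J, CB_deriv (CB F (g j)) s]
  end.

(* rk(F) = a *)
Definition is_rk (I : Type) (F : set_family I) (a : Ord) : Prop :=
  CB F a !=set0 /\ forall b, CB F b !=set0 -> ole b a.

(* Partial orderings are given by their strict relation. *)
Definition strict_total_order_on (P : Type) (A : set P) (R : P -> P -> Prop) :=
  [/\ forall x, A x -> ~ R x x,
      forall x y z, A x -> A y -> A z -> R x y -> R y z -> R x z &
      forall x y, A x -> A y -> [\/ x = y, R x y | R y x]].

Section OnChains.
Variables (P : Type) (R : P -> P -> Prop).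

Definition is_chain (C : set P) : Prop :=
  forall x y, C x -> C y -> [\/ x = y, R x y | R y x].

Definition infinite_chain (C : set P) : Prop := infinite_set C /\ is_chain C.

Definition family_on_chains (F : set_family P) : Prop :=
  forall s, F s -> finite_set s /\ is_chain s.

Definition chains_le (n : nat) : set_family P :=
  [set s | s #<= `I_n /\ is_chain s].

Definition sqcup (F G : set_family P) : set_family P :=
  [set u | exists s t, [/\ F s, G t, u = s `|` t & is_chain u]].

(* srk(F) = a *)
Definition is_srk (F : set_family P) (a : Ord) : Prop :=
  (exists C, infinite_chain C /\ is_rk (fam_restrict F C) a) /\
  (forall C b, infinite_chain C -> is_rk (fam_restrict F C) b -> ole a b).

Definition homogeneous_at (a : Ord) (F : set_family P) : Prop :=
  [/\ family_on_chains F, compact_family F, hereditary F &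
      (oeq a ozero /\ F = [set set0]) \/
      [/\ ole oone a, ocountable a, chains_le 1 `<=` F, is_srk F a &
          exists r l, [/\ is_rk F r, ole a r, is_iota a l & olt r l]]].

Definition homogeneous (F : set_family P) : Prop :=
  exists a, ocountable a /\ homogeneous_at a F.

End OnChains.

Definition nat_lt (m n : nat) : Prop := (m < n)%N.

(* The set M / n. *)
Definition nat_above (M : set nat) (n : nat) : set nat :=
  [set m | M m /\ (n < m)%N].

Definition fam_section (F : set_family nat) (n : nat) : set_family nat :=
  [set s | (forall m, s m -> (n < m)%N) /\ F (n |` s)].

Inductive uniform_at : Ord -> set nat -> set_family nat -> Prop :=
| uniform_zero a M F :
    oeq a ozero -> infinite_set M -> F = [set set0] -> uniform_at a M F
| uniform_succ a b M F :
    oeq a (osucc b) -> infinite_set M -> family_on M F -> F set0 ->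
    (forall n, M n -> uniform_at b (nat_above M n) (fam_section F n)) ->
    uniform_at a M F
| uniform_limit a (c : nat -> Ord) M F :
    olimit a -> infinite_set M -> family_on M F -> F set0 ->
    (forall m n, M m -> M n -> (m < n)%N -> olt (c m) (c n)) ->
    (forall n, M n -> olt (c n) a) ->
    (forall b, (forall n, M n -> ole (c n) b) -> ole a b) ->
    (forall n, M n -> uniform_at (c n) (nat_above M n) (fam_section F n)) ->
    uniform_at a M F.

Definition spreading (F : set_family nat) : Prop :=
  forall s t : seq nat, sorted ltn s -> sorted ltn t -> all2 leq s t ->
    F [set` s] -> F [set` t].

(* The collection denoted by a Fraktur S. *)
Definition uniform_families : set (set_family nat) :=
  [set H | [/\ hereditary H, spreading H &
     exists a, ocountable a /\ uniform_at a [set: nat] H]].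

Section Bases.
Variables (P : Type) (R : P -> P -> Prop).

Definition is_multiplication
    (F : set_family P) (H : set_family nat) (G : set_family P) : Prop :=
  [/\ homogeneous R G,
      exists a b c, [/\ is_srk R G a, is_srk R F b, is_srk nat_lt H c &
                        same_iota a (omul b c)] &
      forall s : nat -> set P,
        (forall n, F (s n)) -> is_chain R (\bigcup_n s n) ->
        exists phi : nat -> nat, {homo phi : m n / (m < n)%N} /\
          forall x, H x -> G (\bigcup_(n in x) s (phi n))].

(* Only the values of [times] on B x S, with S = [uniform_families], matter. *)
Definition is_basis
    (B : set (set_family P))
    (times : set_family P -> set_family nat -> set_family P) : Prop :=
  [/\ [/\ forall F, B F -> homogeneous R F,
          forall n, B (chains_le R n) &
          forall a, ole oomega a -> ocountable a ->
            exists2 F, B F & is_srk R F a],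
      [/\ forall F G, B F -> B G -> B (F `|` G),
          forall F G, B F -> B G -> B (sqcup R F G) &
          forall F G, F `<=` G -> B G -> homogeneous R F ->
            (exists a b, [/\ is_srk R F a, is_srk R G b & same_iota a b]) ->
            B F] &
      forall F H, B F -> uniform_families H ->
        B (times F H) /\ is_multiplication F H (times F H)].

Definition has_basis_on_chains : Prop := exists B times, is_basis B times.

End Bases.

(* [is_basis R] depends on R only through [is_chain R], so that all total      *)
(* orders R give the same notion; there is one by the well-ordering principle. *)
Definition has_basis_on_set (P : Type) : Prop :=
  exists (B : set (set_family P))
         (times : set_family P -> set_family nat -> set_family P),
    forall R : P -> P -> Prop,
      strict_total_order_on [set: P] R -> is_basis R B times.

(* A complete rooted tree is a meet-semilattice with a least element (the      *)
(* meet of t and u being the maximum of their common lower bounds) which       *)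
(* satisfies the following condition.                                          *)
Definition is_tree (d : Order.disp_t) (T : porderType d) : Prop :=
  forall t : T, wo_chain <=%O [pred u : T | (u < t)%O].

Definition imm_succ (d : Order.disp_t) (T : porderType d) (t : T) : set T :=
  [set v | (t < v)%O /\ forall w, ~ ((t < w)%O /\ (w < v)%O)].

Definition lt_a (d : Order.disp_t) (T : porderType d)
    (lts : T -> T -> T -> Prop) (t u : T) : Prop :=
  exists v, [/\ imm_succ v t, imm_succ v u & lts v t u].

(* Main.v *)
(** The rank of a hereditary family of finite sets is combinatorial: [s] has rank
    above [b] iff [s U {x}] has rank at least [b] for infinitely many [x]. A bound on the
    rank implies compactness, and a bound follows from any ordinal potential that
    drops at all but finitely many one-point extensions.

    From a basis on [T], intersecting with chains gives a basis on the chains of any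
    partial order. Conversely, every sequence in a complete tree has a subsequence that
    is constant, a fan (distinct immediate successors of one node [t]) or a comb
    (branching off an increasing chain [r]). One therefore takes on [T] the families
    obtained from the points by [U], by spreading pieces over immediate successors
    of a node indexed by a member of the [<_a]-family, and by attaching pieces to
    nodes of a branch indexed by a member of the [<]-family. Multiplications
    exist by induction on the construction, splitting sequences into fans and combs.
    All these families lie in some [tree_family A C] (all the sets of immediate
    successors in [A], all the meet sets on branches in [C]). Its rank
    is bounded by induction on the rank of the meets already present: after fixing
    one node, everything else hangs off a fixed branch, and each new piece has either
    a smaller rank or fewer meets that do not decrease the rank. Small ranks are
    finally made exact by cutting down along one infinite chain. *)

Require Import Defs.
From HB Require Import structures.
From mathcomp Require Import all_boot all_order.
From mathcomp Require Import all_classical.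
From mathcomp Require Import wochoice topology.

Set Implicit Arguments.
Unset Strict Implicit.
Unset Printing Implicit Defensive.

Import Order.TTheory.

Local Open Scope classical_set_scope.
Local Open Scope card_scope.

(** * Ordinals *)

(** Conditions (M.1) and (B.2) see a small rank only through its [iota], so most of the time a
    family needs no exact rank, only an exp-indecomposable bound [l]. The work is therefore done
    with [chain_system], where everything holds up to inclusion, and a basis is recovered by
    admitting every suitable homogeneous subfamily. Exp-indecomposability is what closes the rank
    bound for [tree_family]: each level of its recursion raises the previous bound to the power
    omega and multiplies it by a fixed ordinal, so the result is a tower of exponentials in the
    ranks of [A] and [C]. The exponent omega must itself lie below [l], which is why level omega is
    handled apart, with sets of bounded size. Neither the existence of [iota(a)] nor that of the
    small ranks of uniform families is established from scratch: both are read off a given basis. In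
    the converse direction such a basis is at hand because an infinite tree has an infinite chain
    for at least one of its two orders. *)

Section OrdinalArithmetic.

Lemma ole_osup J (f : J -> Ord) b : (forall i, olt (f i) b) <-> ole (osup f) b.
Proof. by []. Qed.

Lemma ole_osub a b : (forall i : oidx a, olt (osub i) b) <-> ole a b.
Proof. by case: a. Qed.

Lemma ole_refl a : ole a a.
Proof. by elim: a => J f IH i; exists i; exact: IH. Qed.
#[global] Arguments ole_refl : clear implicits.
#[local] Hint Resolve ole_refl : core.

Lemma ole_trans b a c : ole a b -> ole b c -> ole a c.
Proof.
elim: a b c => J f IH [K g] [L h] ab bc i.
have [j ij] := ab i; have [k jk] := bc j.
by exists k; exact: IH ij jk.
Qed.

Lemma ole_olt_trans b a c : ole a b -> olt b c -> olt a c.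
Proof. by move=> ab [j bj]; exists j; exact: ole_trans bj. Qed.

Lemma olt_osub b (j : oidx b) : olt (osub j) b.
Proof. by exists j. Qed.

Lemma olt_ole_trans b a c : olt a b -> ole b c -> olt a c.
Proof.
case: b => J g [j aj] bc; have [k jk] := bc j.
by exists k; exact: ole_trans aj jk.
Qed.

Lemma oltW a b : olt a b -> ole a b.
Proof.
elim: a b => J f IH [K g] [k ak] i; exists k.
exact: IH (ak i).
Qed.

Lemma olt_trans b a c : olt a b -> olt b c -> olt a c.
Proof. by move=> /oltW; exact: ole_olt_trans. Qed.

Lemma olt_irr a : ~ olt a a.
Proof.
elim: a => J f IH [i /= fi]; exact: IH (fi i).
Qed.

Lemma oltNge a b : olt a b -> ~ ole b a.
Proof. by move=> ab ba; apply: (@olt_irr a); exact: olt_ole_trans ba. Qed.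

Lemma olt_total b a : olt b a \/ ole a b.
Proof.
elim: a b => J f IH b; have [|nab] := pselect (ole (osup f) b); first by right.
left; have [i ni] : exists i, ~ olt (f i) b by apply/existsNP.
exists i => /=; case: b nab ni => K g nab ni k.
by have [//|fg] := IH i (g k); case: ni; exists k.
Qed.

Lemma oltNgeP a b : ~ olt a b -> ole b a.
Proof. by have [|] := olt_total a b. Qed.

Lemma oleNgtP a b : ~ ole a b -> olt b a.
Proof. by have [|] := olt_total b a. Qed.

Lemma olt_ind (Q : Ord -> Prop) :
  (forall a, (forall b, olt b a -> Q b) -> Q a) -> forall a, Q a.
Proof.
move=> IH a; suff: forall b, ole b a -> Q b by apply.
elim: a => J f IHf b ba; apply: IH => c cb.
by have [i ci] := olt_ole_trans cb ba; exact: IHf ci.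
Qed.

Lemma exists_olt_min (Q : Ord -> Prop) a :
  Q a -> exists m, Q m /\ forall b, olt b m -> ~ Q b.
Proof.
elim/olt_ind: a => a IH Qa.
have [[b [ba Qb]]|nb] := pselect (exists b, olt b a /\ Q b); first exact: IH Qb.
by exists a; split=> // b ba Qb; apply: nb; exists b.
Qed.

Lemma ozero_ole a : ole ozero a. Proof. by case. Qed.
#[global] Arguments ozero_ole : clear implicits.
#[local] Hint Resolve ozero_ole : core.

Lemma nolt0 a : ~ olt a ozero. Proof. by case=> -[]. Qed.

Lemma olt_succ a b : olt a (osucc b) <-> ole a b.
Proof. by split=> [[]//|ab]; exists tt. Qed.

Lemma ole_succ a b : ole (osucc a) b <-> olt a b.
Proof. by split=> [/(_ tt)|ab []]. Qed.

Lemma osucc_gt a : olt a (osucc a). Proof. by apply/olt_succ. Qed.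
#[local] Hint Resolve osucc_gt : core.

Lemma osucc_ole a b : ole a b -> ole (osucc a) (osucc b).
Proof. by move=> ab; apply/ole_succ/olt_succ. Qed.

Definition onat (n : nat) : Ord := iter n osucc ozero.

Lemma onat_ole m n : m <= n -> ole (onat m) (onat n).
Proof.
elim: n m => [|n IH] [|m] //= mn; exact/osucc_ole/IH.
Qed.

Lemma onat_omega n : olt (onat n) oomega.
Proof. by exists n; exact: ole_refl. Qed.

Lemma ole_ojoin J (f : J -> Ord) b : (forall j, ole (f j) b) <-> ole (ojoin f) b.
Proof.
split=> [fb [j i]|fb j] /=; first exact: olt_ole_trans (olt_osub i) (fb j).
by apply/ole_osub => i; exact: (fb (existT _ j i)).
Qed.

Lemma ojoin_ge J (f : J -> Ord) j : ole (f j) (ojoin f).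
Proof. by move: j; apply/ole_ojoin. Qed.

Lemma oadd_ole a b : ole a (oadd a b).
Proof.
case: b => J g; case: a => K f k.
by exists (inl k); exact: ole_refl.
Qed.

Lemma oadd_ltr a b c : olt b c -> olt (oadd a b) (oadd a c).
Proof.
elim: c b => J g IH b [j bj]; exists (inr j) => /=.
case: b bj => K h bj [i|k] /=; first exact: olt_ole_trans (olt_osub i) (oadd_ole _ _).
exact/IH/bj.
Qed.

Lemma oadd_ler a b c : ole b c -> ole (oadd a b) (oadd a c).
Proof.
case: b => J g bc; apply/ole_osub => -[i|j] /=; first exact: olt_ole_trans (olt_osub i) (oadd_ole _ _).
exact/oadd_ltr/bc.
Qed.

Lemma oadd_lel a a' b : ole a a' -> ole (oadd a b) (oadd a' b).
Proof.
move=> aa'; elim: b => J g IH; apply/ole_osub => -[i|j] /=.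
  apply: olt_ole_trans (olt_osub i) _; apply: ole_trans aa' _.
  exact: (oadd_ole a' (osup g)).
by exists (inr j); exact: IH.
Qed.

Lemma oadd0 a : ole (oadd a ozero) a.
Proof. by apply/ole_osub=> -[i|[]]; exact: olt_osub. Qed.
#[global] Arguments oadd0 : clear implicits.

Lemma oaddS a b : ole (oadd a (osucc b)) (osucc (oadd a b)).
Proof.
apply/ole_osub=> -[i|[]]; apply/olt_succ => //=; apply: ole_trans (oadd_ole _ _).
exact/oltW/olt_osub.
Qed.
#[global] Arguments oaddS : clear implicits.

Lemma oadd_ger a b : ole b (oadd a b).
Proof. by elim: b => J g IH; apply/ole_osup => j; exists (inr j); exact: IH. Qed.

Lemma omul_osup_ole a J (g : J -> Ord) b :
  ole (omul a (osup g)) b <-> forall j, ole (oadd (omul a (g j)) a) b.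
Proof. exact: iff_sym (ole_ojoin _ _). Qed.

(** In effect [a * (b + 1) <= a * c], written without the successor: a product with [osup g] is a
    join of exactly such terms, so monotonicity in the second factor follows from this form. *)
Lemma omul_olt a b c : olt b c -> ole (oadd (omul a b) a) (omul a c).
Proof.
elim: c b => J g IH [K h] [j bj].
apply: ole_trans (ojoin_ge _ j) => /=; apply: oadd_lel.
apply/omul_osup_ole => k; exact/IH/bj.
Qed.

Lemma omul_ler a b c : ole b c -> ole (omul a b) (omul a c).
Proof.
by case: b => J g bc; apply/omul_osup_ole => j; exact/omul_olt/bc.
Qed.

Lemma omul_ltr a b c : olt ozero a -> olt b c -> olt (omul a b) (omul a c).
Proof.
move=> a0 bc; apply: olt_ole_trans (omul_olt a bc).
by apply: ole_olt_trans (oadd_ole _ ozero) _; exact: oadd_ltr.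
Qed.

Lemma omul_lel a a' b : ole a a' -> ole (omul a b) (omul a' b).
Proof.
move=> aa'; elim: b => J g IH; apply/omul_osup_ole => j.
apply: ole_trans (omul_olt a' (@olt_osub (osup g) j)) => /=.
exact: ole_trans (oadd_lel _ (IH j)) (oadd_ler _ aa').
Qed.

Lemma omulS a b : ole (omul a (osucc b)) (oadd (omul a b) a).
Proof. exact/omul_osup_ole. Qed.
#[global] Arguments omulS : clear implicits.

Lemma omul0 a : ole (omul a ozero) ozero.
Proof. exact/omul_osup_ole. Qed.
#[global] Arguments omul0 : clear implicits.

Lemma zero_oadd a : ole (oadd ozero a) a.
Proof. by elim: a => J g IH; apply/ole_osub => -[[]|j] /=; exists j; exact: IH. Qed.

Lemma omul1 a : ole (omul a oone) a.
Proof.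
apply: ole_trans (omulS a ozero) _.
exact: ole_trans (oadd_lel _ (omul0 a)) (zero_oadd a).
Qed.
#[global] Arguments omul1 : clear implicits.

Lemma omul1_ge a : ole a (omul a oone).
Proof. exact: ole_trans (oadd_ger (omul a ozero) _) (omul_olt a (osucc_gt ozero)). Qed.

Lemma omul_ge a b : olt ozero a -> ole b (omul a b).
Proof.
move=> a0; elim: b => J g IH; apply/ole_osup => j.
apply: ole_olt_trans (IH j) _; apply: omul_ltr => //; exact: (@olt_osub (osup g) j).
Qed.

Lemma omul_gel a b : olt ozero b -> ole a (omul a b).
Proof. by move=> b0; apply: ole_trans (omul_olt a b0); exact: oadd_ger. Qed.

Lemma omul_ojoin_ole a J (f : J -> Ord) b :
  (forall j, ole (omul a (f j)) b) -> ole (omul a (ojoin f)) b.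
Proof.
move=> fb; apply/omul_osup_ole => -[j i] /=.
exact: ole_trans (omul_olt a (olt_osub i)) (fb j).
Qed.

Lemma oadd_osup_ole a J (g : J -> Ord) c :
  ole (oadd a (osup g)) c <-> ole a c /\ forall j, olt (oadd a (g j)) c.
Proof.
split=> [h|[ac gc]].
  split; first exact: ole_trans (oadd_ole _ _) h.
  by move=> j; apply: olt_ole_trans h; apply/oadd_ltr/(@olt_osub (osup g) j).
by apply/ole_osub => -[i|j]; [exact: olt_ole_trans (olt_osub i) ac|exact: gc].
Qed.

Lemma oaddA a b c : ole (oadd (oadd a b) c) (oadd a (oadd b c)).
Proof.
elim: c => J g IH; apply/oadd_osup_ole; split=> [|j].
  exact/oadd_ler/oadd_ole.
apply: ole_olt_trans (IH j) _; apply: oadd_ltr; exact: oadd_ltr (@olt_osub (osup g) j).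
Qed.

Lemma omulDr a b c : ole (omul a (oadd b c)) (oadd (omul a b) (omul a c)).
Proof.
elim: c => J g IH; apply/omul_osup_ole => -[i|j].
  apply: ole_trans (omul_olt a (olt_osub i)) _; exact: oadd_ole.
apply: ole_trans (oadd_lel a (IH j)) _; apply: ole_trans (oaddA _ _ _) _.
apply: oadd_ler; exact: omul_olt (@olt_osub (osup g) j).
Qed.

Lemma omulA a b c : ole (omul a (omul b c)) (omul (omul a b) c).
Proof.
elim: c => J g IH; apply: omul_ojoin_ole => j.
apply: ole_trans (omulDr _ _ _) _; apply: ole_trans (oadd_lel _ (IH j)) _.
exact: omul_olt (@olt_osub (osup g) j).
Qed.

Lemma oexp_osup_ole a J (g : J -> Ord) b :
  ole (oexp a (osup g)) b <-> ole oone b /\ forall j, ole (omul (oexp a (g j)) a) b.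
Proof.
split=> [/ole_ojoin h|[h1 h2]]; last by apply/ole_ojoin => -[j|] //=.
by split=> [|j]; [exact: (h None)|exact: (h (Some j))].
Qed.

Lemma oexp_ge1 a b : ole oone (oexp a b).
Proof. by case: b => J g; exact: (ojoin_ge _ None). Qed.

Lemma oexp_gt0 a b : olt ozero (oexp a b).
Proof. exact/ole_succ/oexp_ge1. Qed.
#[local] Hint Resolve oexp_ge1 oexp_gt0 : core.

Lemma oexp_olt a b c : olt b c -> ole (omul (oexp a b) a) (oexp a c).
Proof.
elim: c b => J g IH [K h] [j bj].
apply: ole_trans (ojoin_ge _ (Some j)) => /=; apply: omul_lel.
by apply/oexp_osup_ole; split=> // k; exact/IH/bj.
Qed.

Lemma oexp_ler a b c : ole b c -> ole (oexp a b) (oexp a c).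
Proof.
case: b => J g bc; apply/oexp_osup_ole; split=> // j; exact/oexp_olt/bc.
Qed.

Lemma oexp_lel a a' b : ole a a' -> ole (oexp a b) (oexp a' b).
Proof.
move=> aa'; elim: b => J g IH; apply/oexp_osup_ole; split=> // j.
apply: ole_trans (oexp_olt a' (@olt_osub (osup g) j)) => /=.
exact: ole_trans (omul_lel _ (IH j)) (omul_ler _ aa').
Qed.

Lemma oexp1_ge a : ole a (oexp a oone).
Proof.
apply: ole_trans (oexp_olt a (osucc_gt ozero)); exact: omul_ge.
Qed.

Lemma oexpD a b c : olt ozero a ->
  ole (omul (oexp a b) (oexp a c)) (oexp a (oadd b c)).
Proof.
move=> a0; elim: c => J g IH; apply: omul_ojoin_ole => -[j|].
  apply: ole_trans (omulA _ _ _) _; apply: ole_trans (omul_lel _ (IH j)) _.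
  apply/oexp_olt/oadd_ltr; exact: (@olt_osub (osup g) j).
apply: ole_trans (omul1 _) _; exact/oexp_ler/oadd_ole.
Qed.

Lemma onat_omul m n : ole (omul (onat m) (onat n)) (onat (m * n)).
Proof.
elim: n => [|n IH]; first by rewrite muln0; exact: omul0.
rewrite mulnS addnC; apply: ole_trans (omulS _ _) _.
apply: ole_trans (oadd_lel _ IH) _.
elim: {IH} m (m * n) => [|m IH] k; first by rewrite addn0; exact: oadd0.
by rewrite addnS; apply: ole_trans (oaddS _ _) _; exact/osucc_ole/IH.
Qed.

Lemma omul_iter_oexp a n : ole (iter n (fun x => omul x a) oone) (oexp a (onat n)).
Proof.
elim: n => [//|n IH]; apply: ole_trans (omul_lel _ IH) _.
exact/oexp_olt/osucc_gt.
Qed.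

End OrdinalArithmetic.

(** * Cantor-Bendixson ranks of hereditary families of finite sets *)

Lemma finite_set_rect (T : Type) (Q : set T -> Prop) : Q set0 ->
  (forall x A, finite_set A -> Q A -> Q (x |` A)) ->
  forall A, finite_set A -> Q A.
Proof.
move=> Q0 QU A /(@finite_seqP {classic T})[s ->].
elim: s => [|x s IH]; first by rewrite set_nil.
suff -> : [set` x :: s] = x |` [set` s] by apply: QU => //; exact: (@finite_seq {classic T}).
apply/seteqP; split=> y /=; rewrite inE; first by case/orP => [/eqP ->|]; [left|right].
by case=> [->|->]; rewrite ?eqxx ?orbT.
Qed.

Lemma infinite_sub (T : Type) (A B : set T) :
  A `<=` B -> infinite_set A -> infinite_set B.
Proof. by move=> AB iA fB; apply: iA; exact: sub_finite_set fB. Qed.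

Lemma infinite_diff (T : Type) (A B : set T) :
  infinite_set A -> finite_set B -> infinite_set (A `\` B).
Proof. by move=> iA fB; exact: infinite_setD. Qed.

Lemma infinite_pick (T : Type) (A B : set T) :
  infinite_set A -> finite_set B -> exists x, A x /\ ~ B x.
Proof. by move=> iA /(infinite_diff iA)/infinite_setN0[x []]; exists x. Qed.

Lemma finite_set_U1 (T : Type) (A : set T) x : finite_set A -> finite_set (x |` A).
Proof. by move=> fA; rewrite finite_setU; split=> //; exact: finite_set1. Qed.

Section Cylinders.
Variable I : Type.
Implicit Types s t : set I.

Lemma char_funE s i : char_fun s i = `[< s i >].
Proof. by rewrite /char_fun unfold_in. Qed.

Lemma char_fun_inj : injective (@char_fun I).
Proof.
move=> s t st; apply/funext => i; apply/propext.
have := congr1 (fun f => f i) st; rewrite !char_funE => e.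
by split=> /asboolP; [rewrite e|rewrite -e] => /asboolP.
Qed.

Lemma nbhs_cylinder (g : prod_topology (fun _ : I => bool)) t :
  finite_set t -> nbhs g [set f | forall i, t i -> f i = g i].
Proof.
have FF : Filter (nbhs g) by exact: nbhs_filter.
move: t; apply: (@finite_set_rect I (fun t => nbhs g [set f | forall i, t i -> f i = g i])).
  by apply: (@filterS _ _ FF setT _ _ (@filterT _ _ FF)) => f _ i [].
move=> i t _ IH.
have H : nbhs g [set f | f i = g i].
  by have /(_ (discrete_set1 (g i))) := @proj_continuous {classic I} (fun _ => bool) i g [set g i].
apply: (@filterS _ _ FF _ _ _ (@filterI _ _ FF _ _ H IH)) => f [fi ft] j [->//|]; exact: ft.
Qed.

(** Adding [x] changes the characteristic function at [x] only. So the filter of sets that contain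
    almost all one-point extensions of [s] converges to [char_fun s] in each coordinate, hence in
    the product. *)
Lemma finite_cofilter s (U : set (prod_topology (fun _ : I => bool))) :
  nbhs (char_fun s) U -> finite_set [set x | ~ s x /\ ~ U (char_fun (x |` s))].
Proof.
set F : set_system (prod_topology (fun _ : {classic I} => bool)) :=
  [set A | finite_set [set x | ~ s x /\ ~ A (char_fun (x |` s))]].
have FF : Filter F.
  split; rewrite /F /=.
  - by apply: sub_finite_set (finite_set0 _) => x [_] /(_ Logic.I).
  - move=> A B fA fB; have := conj fA fB; rewrite /= -finite_setU.
    by apply: sub_finite_set => x [sx] /not_andP[]; [left|right].
  - move=> A B AB; apply: sub_finite_set => x [sx nB]; split=> // /AB //.
suff : F --> (char_fun s : prod_topology (fun _ : {classic I} => bool)) by exact.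
apply/cvg_sup => i; apply/cvg_image.
  rewrite eqEsubset; split => y // _; exists (fun=> y) => //.
move=> B nB; exists (fun f => B (f i)).
  rewrite /F /=; apply: sub_finite_set (finite_set1 (i : I)) => x [sx] nBx.
  apply: contrapT => xi; apply: nBx; have := nbhs_singleton nB.
  rewrite !char_funE; suff -> : (x |` s) i = s i by [].
  by apply/propext; split=> [[ix|]//|]; [case: xi|right].
by apply/seteqP; split=> [_ [f Bf <-]//|y By]; exists (fun=> y).
Qed.

End Cylinders.

Section Ranks.
Variable P : Type.
Implicit Types (s t : set P) (F G : set_family P) (a b : Ord).

Definition finitary F := forall s, F s -> finite_set s.

Definition ext F s : set P := [set x | ~ s x /\ F (x |` s)].

Lemma ext_sub F G s : F `<=` G -> ext F s `<=` ext G s.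
Proof. by move=> FG x [sx /FG]. Qed.

(** If [s] has finitely many one-point extensions, the cylinder fixing [s] and these points isolates
    it: another member in that cylinder would contain [s] and a further point, which heredity makes
    an extension. Conversely, every neighbourhood of [s] contains almost all of its one-point
    extensions. *)
Lemma CB_derivP F s : hereditary F -> finitary F ->
  CB_deriv F s <-> F s /\ infinite_set (ext F s).
Proof.
move=> hF fF; split=> [[Fs lim]|[Fs inf]]; split=> //.
  move=> fin; have /lim[y [/eqP ne [s' Fs' ys'] eqs]] :
    nbhs (char_fun s) [set f | forall i, (s `|` ext F s) i -> f i = char_fun s i].
    by apply: nbhs_cylinder; rewrite finite_setU; split=> //; exact: fF.
  subst y; have s's x : (s `|` ext F s) x -> s' x <-> s x.
    by move=> /eqs; rewrite !char_funE => e; split=> /asboolP; [rewrite e|rewrite -e] => /asboolP.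
  have ss' : s `<=` s' by move=> x sx; apply/s's => //; left.
  have [x s'x sx] : exists2 x, s' x & ~ s x.
    apply: contrapT => h; apply: ne; congr char_fun; apply/seteqP; split=> // x s'x.
    by apply: contrapT => sx; apply: h; exists x.
  have : ext F s x by split=> //; apply: hF Fs' _ => y [->//|/ss'].
  by move=> ex; apply: sx; apply/(s's x); first right.
move=> U /finite_cofilter /(infinite_pick inf)[x [[sx Fx] nU]].
exists (char_fun (x |` s)); split.
- by apply/eqP => /char_fun_inj e; apply: sx; rewrite -e; left.
- by exists (x |` s).
- by apply: contrapT => nUx; apply: nU.
Qed.

Lemma CB_deriv_hereditary F : hereditary F -> finitary F -> hereditary (CB_deriv F).
Proof.
move=> hF fF s t /(CB_derivP _ hF fF)[Fs inf] ts.
apply/(CB_derivP _ hF fF); split; first exact: hF Fs ts.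
apply: infinite_sub inf => x [sx Fx]; split=> [/ts//|].
by apply: hF Fx _ => y [->|/ts]; [left|right].
Qed.

Lemma CB_sub F a : CB F a `<=` F.
Proof. by case: a => J g s []. Qed.

Lemma CB_finitary F a : finitary F -> finitary (CB F a).
Proof. by move=> fF s /CB_sub/fF. Qed.

Lemma CB_hereditary F a : hereditary F -> finitary F -> hereditary (CB F a).
Proof.
move=> hF fF; elim: a => J g IH s t [Fs Ds] ts; split; first exact: hF Fs ts.
by move=> j; apply: CB_deriv_hereditary (Ds j) ts => //; exact: CB_finitary.
Qed.

Lemma CB_osupP F J (g : J -> Ord) s : hereditary F -> finitary F ->
  CB F (osup g) s <-> F s /\ forall j, infinite_set (ext (CB F (g j)) s).
Proof.
move=> hF fF; split=> [[Fs Ds]|[Fs inf]]; split=> // j.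
  have := Ds j; rewrite CB_derivP; first by case.
    exact: CB_hereditary.
  exact: CB_finitary.
apply/CB_derivP; [exact: CB_hereditary|exact: CB_finitary|split=> //].
have [x [_ /(CB_hereditary hF fF)]] := infinite_setN0 (inf j); apply.
by right.
Qed.

Lemma CB_succP F a s : hereditary F -> finitary F ->
  CB F (osucc a) s <-> F s /\ infinite_set (ext (CB F a) s).
Proof.
move=> hF fF; rewrite CB_osupP//.
by split=> -[Fs inf]; split=> //; [exact: inf tt].
Qed.

Lemma CB_anti F a b : hereditary F -> finitary F -> ole a b -> CB F b `<=` CB F a.
Proof.
move=> hF fF; elim: a b => J g IH b ab s Fbs; apply/CB_osupP => //.
split=> [|j]; first exact: CB_sub Fbs.
have [k jk] := ab j; case: b k jk Fbs {ab} => K h k jk /= Fs.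
have /(CB_osupP _ _ hF fF)[_ /(_ k)] := Fs.
by apply: infinite_sub; apply: ext_sub; exact: IH.
Qed.

Lemma CB_mono F G a : hereditary F -> finitary F -> hereditary G -> finitary G ->
  F `<=` G -> CB F a `<=` CB G a.
Proof.
move=> hF fF hG fG FG; elim: a => J g IH s /(CB_osupP _ _ hF fF)[Fs inf].
apply/CB_osupP => //; split=> [|j]; first exact: FG.
by apply: infinite_sub (inf j); apply: ext_sub; exact: IH.
Qed.

Lemma CB_nonempty F a : hereditary F -> finitary F -> CB F a !=set0 <-> CB F a set0.
Proof.
move=> hF fF; split=> [[s Fs]|]; last by exists set0.
by apply: CB_hereditary Fs _.
Qed.

(** The stage [osup g] is an intersection of derivatives of the stages [g j], and one of these must
    already lose [s]. *)
Lemma CB_drop F a s : hereditary F -> finitary F -> F s -> ~ CB F a s ->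
  exists b, olt b a /\ ~ CB F (osucc b) s.
Proof.
case: a => J g hF fF Fs; rewrite CB_osupP// => /not_andP[//|/existsNP[j fin]].
exists (g j); split; first exact: (@olt_osub (osup g) j).
by rewrite CB_succP// => -[_ /fin].
Qed.

Lemma CB_exact F a s : hereditary F -> finitary F -> F s -> ~ CB F a s ->
  exists b, [/\ olt b a, CB F b s & ~ CB F (osucc b) s].
Proof.
move=> hF fF Fs na.
have [m [nm min]] := @exists_olt_min (fun c => ~ CB F c s) a na.
have [b [bm nb]] := CB_drop hF fF Fs nm.
exists b; split=> //; last by apply: contrapT; exact: (min b bm).
by apply: olt_ole_trans bm _; apply: oltNgeP => am; exact: (min a am na).
Qed.

Lemma CB_lt F a b s : hereditary F -> finitary F -> CB F a s -> ~ CB F b s -> olt a b.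
Proof.
by move=> hF fF Fa nb; apply: oleNgtP => ba; apply: nb; exact: CB_anti ba _ Fa.
Qed.

(** A finite subset of [M] has infinitely many extensions of the same kind, so no derivative removes
    it. This is how a rank bound excludes infinite limits of a family. *)
Lemma CB_infinite F M : hereditary F -> finitary F -> infinite_set M ->
  (forall t, finite_set t -> t `<=` M -> F t) ->
  forall a t, finite_set t -> t `<=` M -> CB F a t.
Proof.
move=> hF fF iM FM; elim=> J g IH t ft tM; apply/CB_osupP => //.
split=> [|j]; first exact: FM.
apply: infinite_sub (infinite_diff iM ft) => x [Mx tx]; split=> //.
by apply: IH => [|y [->//|/tM//]]; exact: finite_set_U1.
Qed.

(** All finite subsets of a limit of the family are members. By [CB_infinite] the rank bound keeps
    the limit from being infinite, and a finite limit is one of its own finite subsets. *)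
Lemma rank_compact F a : hereditary F -> finitary F -> ~ CB F a set0 -> compact_family F.
Proof.
move=> hF fF na f cf; pose s := [set i | f i].
have fs : f = char_fun s.
  by apply/funext => i; rewrite char_funE /s /=; apply/esym/asbool_equiv_eqP; [exact: idP|].
have Fs t : finite_set t -> t `<=` s -> F t.
  move=> ft ts; have [_ [[s' Fs' <-] e]] := cf _ (nbhs_cylinder f ft).
  apply: hF Fs' _ => i ti; have := e i ti; rewrite char_funE.
  by rewrite (ts i ti : f i = true) => /asboolP.
exists s => //; apply: contrapT => nF.
have [fin|inf] := pselect (finite_set s); first by apply: nF; exact: Fs.
by apply: na; exact: (CB_infinite hF fF inf Fs).
Qed.

Lemma is_rk_leP F r b : hereditary F -> finitary F -> is_rk F r ->
  CB F b set0 <-> ole b r.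
Proof.
move=> hF fF [/(CB_nonempty _ hF fF) Fr max]; split=> [Fb|br].
  by apply: max; exists set0.
exact: CB_anti br _ Fr.
Qed.

Lemma is_rk_exists F a : hereditary F -> finitary F -> F set0 -> ~ CB F a set0 ->
  exists r, is_rk F r /\ olt r a.
Proof.
move=> hF fF F0 /(CB_exact hF fF F0)[r [ra Fr nFr]]; exists r; split=> //.
split=> [|b /(CB_nonempty _ hF fF) Fb]; first by exists set0.
apply: oltNgeP => rb; apply: nFr; apply: CB_anti Fb => //; exact/ole_succ.
Qed.

Lemma fam_restrict_hereditary F A : hereditary F -> hereditary (fam_restrict F A).
Proof. by move=> hF s t [Fs sA] ts; split; [exact: hF Fs ts|apply: subset_trans sA]. Qed.

Lemma fam_restrict_finitary F A : finitary F -> finitary (fam_restrict F A).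
Proof. by move=> fF s [/fF]. Qed.

Lemma fam_restrict_sub F A : fam_restrict F A `<=` F.
Proof. by move=> s []. Qed.

Lemma CB_restrict_sub F A a : hereditary F -> finitary F ->
  CB (fam_restrict F A) a `<=` CB F a.
Proof.
move=> hF fF; apply: CB_mono => //; [exact: fam_restrict_hereditary|
  exact: fam_restrict_finitary|exact: fam_restrict_sub].
Qed.

Lemma CB_link F b x s : hereditary F -> finitary F -> 
  CB F b (x |` s) -> CB [set t | F (x |` t)] b s.
Proof.
move=> hF fF; pose L := [set t | F (x |` t)].
have hL : hereditary L by move=> t u Lt ut; apply: hF Lt _ => y [->|/ut]; [left|right].
have fL : finitary L by move=> t /fF; apply: sub_finite_set => y; right.
rewrite -/L; elim: b s => J g IH s /(CB_osupP _ _ hF fF)[Fs inf].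
apply/CB_osupP => //; split=> // j; apply: infinite_sub (inf j) => y [/not_orP[yx ys] Fy].
by split=> //; apply: IH; rewrite setUCA.
Qed.

End Ranks.

(** The map [m] may fail to commute with adding points: as derivatives of [G] are hereditary, it is
    enough that infinitely many [y] fit, together with [m d], inside images of extensions of [d].
    Quantifying over infinite [X] leaves room for finitely many exceptional points. *)
Lemma CB_transfer (J K : Type) (F : set_family J) (G : set_family K)
    (m : set J -> set K) :
  hereditary F -> finitary F -> hereditary G -> finitary G ->
  (forall d, F d -> G (m d)) ->
  (forall d X, F d -> infinite_set X -> X `<=` ext F d ->
    infinite_set [set y | ~ m d y /\ exists x, X x /\ y |` m d `<=` m (x |` d)]) ->
  forall b d, CB F b d -> CB G b (m d).
Proof.
move=> hF fF hG fG FG H; elim=> L g IH d /(CB_osupP _ _ hF fF)[Fd inf].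
apply/CB_osupP => //; split=> [|j]; first exact: FG.
have Xs : ext (CB F (g j)) d `<=` ext F d by apply: ext_sub; exact: CB_sub.
apply: infinite_sub (H _ _ Fd (inf j) Xs) => y [my [x [[_ Fx] sub]]].
by split=> //; apply: (CB_hereditary hG fG) sub; exact: IH.
Qed.

(* The exact rank of [s] in [F]; a junk value when it does not exist. *)
Definition rkof (P : Type) (F : set_family P) (s : set P) : Ord :=
  if pselect (exists a, CB F a s /\ ~ CB F (osucc a) s) is left h
  then projT1 (cid h) else ozero.

Lemma rkofP (P : Type) (F : set_family P) a s : hereditary F -> finitary F ->
  F s -> ~ CB F a s ->
  [/\ CB F (rkof F s) s, ~ CB F (osucc (rkof F s)) s & olt (rkof F s) a].
Proof.
move=> hF fF Fs na; have [b [ba Fb nb]] := CB_exact hF fF Fs na.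
have [Fr nr] : CB F (rkof F s) s /\ ~ CB F (osucc (rkof F s)) s.
  rewrite /rkof; case: pselect => [h|[]]; first exact: projT2 (cid h).
  by exists b.
by split=> //; exact: CB_lt Fr na.
Qed.

Lemma ext_rkof_finite (P : Type) (F : set_family P) a s :
  hereditary F -> finitary F -> F s -> ~ CB F a s ->
  finite_set (ext (CB F (rkof F s)) s).
Proof.
move=> hF fF Fs na; have [_ n _] := rkofP hF fF Fs na.
by apply: contrapT => inf; apply: n; apply/CB_succP.
Qed.

Lemma rkof_decr (P : Type) (F : set_family P) a s t :
  hereditary F -> finitary F -> F t -> s `<=` t -> ~ CB F a s ->
  ole (rkof F t) (rkof F s).
Proof.
move=> hF fF Ft st na; have Fs := hF _ _ Ft st.
have nt : ~ CB F a t by move=> h; apply: na; exact: CB_hereditary h st.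
have [Frt _ _] := rkofP hF fF Ft nt; have [_ ns _] := rkofP hF fF Fs na.
by apply/olt_succ; apply: (CB_lt hF fF) ns; exact: CB_hereditary Frt st.
Qed.

Lemma rkof_drop (P : Type) (F : set_family P) a s x :
  hereditary F -> finitary F -> ~ s x -> F (x |` s) -> ~ CB F a s ->
  ~ ext (CB F (rkof F s)) s x -> olt (rkof F (x |` s)) (rkof F s).
Proof.
move=> hF fF sx Fx na nx.
have n : ~ CB F (rkof F s) (x |` s) by move=> h; exact: nx.
by have [_ _] := rkofP hF fF Fx n.
Qed.

(* A new point either lowers the rank of [f @` s] in [Q], or, with finitely many  *)
(* exceptions, that of [s] in one of finitely many fibers. *)
Section Composition.
Variables (T J : Type) (F : set_family T) (f : T -> J) (Q : set_family J).
Variables (U V : Ord).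
Hypotheses (hF : hereditary F) (fF : finitary F).
Hypotheses (hQ : hereditary Q) (fQ : finitary Q).
Hypothesis FQ : forall s, F s -> Q (f @` s).

Let pw n := iter n (fun x => omul x U) oone.
Hypothesis pwV : forall n, ole (pw n) V.

Let fiber j : set T := [set x | f x = j].
Hypothesis fiber_rank : forall j, ~ CB (fam_restrict F (fiber j)) U set0.

(** The number with digits [e j] in base [U], the most significant digit first. Lowering one digit
    while raising none lowers the number. *)
Fixpoint lexsum (z : seq J) (e : J -> Ord) : Ord :=
  if z is j :: z' then oadd (omul (pw (size z')) (e j)) (lexsum z' e) else ozero.

Lemma lexsum_lt z e : (forall j, olt (e j) U) -> olt (lexsum z e) (pw (size z)).
Proof.
move=> eU; elim: z => [|j z IH]; first exact: osucc_gt.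
exact: olt_ole_trans (oadd_ltr _ IH) (omul_olt _ (eU j)).
Qed.

Lemma lexsum_ltl z e e' j : (forall j, olt (e' j) U) ->
  (forall j, ole (e' j) (e j)) -> (j : {classic J}) \in z -> olt (e' j) (e j) ->
  olt (lexsum z e') (lexsum z e).
Proof.
move=> e'U ee + ltj; elim: z => [//|i z IH]; rewrite inE => /orP[/eqP <-|jz]; last first.
  exact: ole_olt_trans (oadd_lel _ (omul_ler _ (ee i))) (oadd_ltr _ (IH jz)).
apply: olt_ole_trans (oadd_ltr _ (lexsum_lt z e'U)) _.
exact: ole_trans (omul_olt _ ltj) (oadd_ole _ _).
Qed.

Let hR j : hereditary (fam_restrict F (fiber j)).
Proof. exact: fam_restrict_hereditary. Qed.
Let fR j : finitary (fam_restrict F (fiber j)).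
Proof. exact: fam_restrict_finitary. Qed.

Let part (s : set T) j := s `&` fiber j.
Let e s j := rkof (fam_restrict F (fiber j)) (part s j).

Let Rpart s j : F s -> fam_restrict F (fiber j) (part s j).
Proof. by move=> Fs; split=> [|x []//]; apply: hF Fs _ => x []. Qed.

Let npart s j : ~ CB (fam_restrict F (fiber j)) U (part s j).
Proof. by move=> h; apply: (fiber_rank (j := j)); exact: CB_hereditary h _. Qed.

Let e_lt s j : F s -> olt (e s j) U.
Proof. by move=> Fs; have [] := rkofP (@hR j) (@fR j) (Rpart j Fs) (@npart s j). Qed.

Lemma CB_fibered a s b : F s -> ~ CB Q (osucc a) (f @` s) -> CB F b s ->
  olt b (omul V (osucc a)).
Proof.
elim/olt_ind: a s b => a IHa s b Fs; rewrite CB_succP// => /not_andP[[]|fin Fbs].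
  exact: FQ.
(* [Z] holds the indices that can be present without the image falling out of the stage [a]; it is
   finite because the image of [s] does not survive the stage [osucc a]. An index outside [Z] is
   left to the outer induction. *)
pose Z := f @` s `|` ext (CB Q a) (f @` s).
have fZ : finite_set Z.
  rewrite /Z finite_setU; split; first by apply: finite_image; exact: fF.
  exact: contrapT.
have [z zZ] : exists z : seq {classic J}, Z = [set` z].
  exact: (@finite_seqP {classic J} Z).1.
(* While the image stays inside [Z], the ranks in the fibers are the digits of a number below
   [pw (size z)], hence below [V]: this is the surplus over [V * a]. *)
suff inner : forall b s', s `<=` s' -> f @` s' `<=` Z -> CB F b s' ->
    ole b (oadd (omul V a) (lexsum z (e s'))).
  apply: ole_olt_trans (inner _ _ _ _ Fbs) _ => //; first by move=> j sj; left.
  apply: olt_ole_trans (oadd_ltr _ (lexsum_lt z _)) _; first by move=> j; exact: e_lt.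
  apply: ole_trans (oadd_ler _ (pwV _)) _; exact/omul_olt/osucc_gt.
elim=> L g IHb s' ss' s'Z /(CB_osupP _ _ hF fF)[Fs' inf].
apply/ole_osup => k.
pose bad := \bigcup_(j in Z) ext (CB (fam_restrict F (fiber j)) (e s' j)) (part s' j).
have fbad : finite_set bad.
  apply: bigcup_finite => // j _.
  exact: (ext_rkof_finite (@hR j) (@fR j) (Rpart j Fs') (@npart s' j)).
have [x [[s'x Fx] nbx]] := infinite_pick (inf k) fbad.
have Fxs' := CB_sub Fx.
have [Zx|nZx] := pselect (Z (f x)); last first.
  have nQ : ~ CB Q a (f @` (x |` s')).
    move=> h; apply: nZx; have [|nfx] := pselect ((f @` s) (f x)); first by left.
    right; split=> //; apply: (CB_hereditary hQ fQ) h _.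
    by move=> j [->|[y sy <-]]; [exists x => //; left|exists y => //; right; exact: ss'].
  have [a' [a'a na']] := CB_drop hQ fQ (FQ Fxs') nQ.
  apply: olt_ole_trans (IHa _ a'a _ _ Fxs' na' Fx) _.
  apply: ole_trans (oadd_ole _ _); apply: omul_ler; exact/ole_succ.
apply: ole_olt_trans (IHb k (x |` s') _ _ Fx) _.
- by move=> y /ss'; right.
- by move=> j [y [->|s'y] <-//]; apply: s'Z; exists y.
apply: oadd_ltr; apply: (@lexsum_ltl _ _ _ (f x)); last 2 first.
- by move: Zx; rewrite zZ.
- rewrite /e; have pe : part (x |` s') (f x) = x |` part s' (f x).
    apply/seteqP; split=> y; first by move=> [[->|s'y] fy]; [left|right].
    by move=> [->|[s'y fy]]; split=> //; [left|right].
  rewrite pe; apply: (rkof_drop (@hR _) (@fR _) _ _ (@npart s' _)).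
  + by case.
  + by rewrite -pe; exact: Rpart.
  + by move=> h; apply: nbx; exists (f x).
- by move=> j; exact: e_lt.
- move=> j; apply: (rkof_decr (@hR _) (@fR _) _ _ (@npart s' _)); first exact: Rpart.
  by move=> y [s'y fy]; split=> //; right.
Qed.

End Composition.

Lemma finite_subsets (T : Type) (A : set T) :
  finite_set A -> finite_set [set B | B `<=` A].
Proof.
move: A; apply: (@finite_set_rect T (fun A => finite_set [set B | B `<=` A])).
  by apply: sub_finite_set (finite_set1 set0) => B /=; rewrite subset0.
move=> x A _ IH.
have : finite_set ([set B | B `<=` A] `|` (setU [set x]) @` [set B | B `<=` A]).
  by rewrite finite_setU; split=> //; exact: finite_image.
apply: sub_finite_set => B BA; have [Bx|nBx] := pselect (B x).
  right; exists (B `\ x); first by move=> y [/BA[//|]].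
  by apply/seteqP; split=> [y [->|[]]//|y By]; have [->|yx] := pselect (y = x); [left|right].
by left=> y By; have [yx|//] := BA y By; case: nBx; rewrite -yx.
Qed.

Lemma finite_max (X : Type) (D : set X) (v : X -> Ord) : finite_set D -> D !=set0 ->
  exists2 d, D d & forall d', D d' -> ole (v d') (v d).
Proof.
move: D; apply: (@finite_set_rect X (fun D => D !=set0 -> exists2 d, D d & _)).
  by case.
move=> x A _ IH _; have [/IH[d Ad dmax]|nA] := pselect (A !=set0).
  have [dx|xd] := olt_total (v d) (v x); [exists x|exists d]; [by left| |by right|].
    move=> y [->|/dmax yd]; first exact: ole_refl.
    exact: oltW (ole_olt_trans yd dx).
  by move=> y [->|/dmax].
exists x; first by left.
move=> y [->|Ay]; first exact: ole_refl.
by case: nA; exists y.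
Qed.

(** * Rank of the unions of members of two families *)

Section SqcupRank.
Variables (P : Type) (R : P -> P -> Prop).

Lemma is_chain_sub (C D : set P) : C `<=` D -> is_chain R D -> is_chain R C.
Proof. by move=> CD cD x y /CD Dx /CD; exact: cD. Qed.

Lemma is_chain0 : is_chain R set0. Proof. by move=> x y []. Qed.

Lemma is_chain1 x : is_chain R [set x].
Proof. by move=> y z -> ->; exact: Or31. Qed.

Variables (F G : set_family P).
Hypotheses (hF : hereditary F) (fF : finitary F).
Hypotheses (hG : hereditary G) (fG : finitary G).

Lemma sqcup_hereditary : hereditary (sqcup R F G).
Proof.
move=> _ u [s [t [Fs Gt -> st]]] ust.
exists (s `&` u), (t `&` u); split.
- by apply: hF Fs _ => x [].
- by apply: hG Gt _ => x [].
- by rewrite -setIUl; apply/seteqP; split=> [x ux|x []//]; split=> //; exact: ust.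
- exact: is_chain_sub ust st.
Qed.

Lemma sqcup_finitary : finitary (sqcup R F G).
Proof. by move=> _ [s [t [/fF fs /fG ft -> _]]]; rewrite finite_setU. Qed.

Lemma sqcup_ge : G set0 -> family_on_chains R F -> F `<=` sqcup R F G.
Proof.
move=> G0 cF s Fs; exists s, set0; split=> //; first by rewrite setU0.
exact: (cF _ Fs).2.
Qed.

Lemma sqcup_ger : F set0 -> family_on_chains R G -> G `<=` sqcup R F G.
Proof.
move=> F0 cG s Gs; exists set0, s; split=> //; first by rewrite set0U.
exact: (cG _ Gs).2.
Qed.

Variables a1 a2 : Ord.
Hypotheses (ra1 : ~ CB F a1 set0) (ra2 : ~ CB G a2 set0).

Let na1 s : ~ CB F a1 s.
Proof. by move=> h; apply: ra1; exact: CB_hereditary h _. Qed.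
Let na2 s : ~ CB G a2 s.
Proof. by move=> h; apply: ra2; exact: CB_hereditary h _. Qed.

(** The pair of ranks as one ordinal, the first rank leading: the second stays below [a2], so any
    drop of the first outweighs it. *)
Let v (d : set P * set P) := oadd (omul a2 (rkof F d.1)) (rkof G d.2).

Let D (s : set P) : set (set P * set P) :=
  [set d | [/\ F d.1, G d.2 & s = d.1 `|` d.2]].

Let v_drop s d x : D s d -> ~ s x ->
  ~ ext (CB F (rkof F d.1)) d.1 x -> ~ ext (CB G (rkof G d.2)) d.2 x ->
  forall d', D (x |` s) d' -> d.1 = d'.1 `\ x -> d.2 = d'.2 `\ x -> olt (v d') (v d).
Proof.
case: d => d1 d2 [/= Fd1 Gd2 sd] sx n1 n2 [d1' d2'] [/= Fd1' Gd2' sd'] e1 e2.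
have [d1x d2x] : ~ d1 x /\ ~ d2 x by split=> dx; apply: sx; rewrite sd; [left|right].
have le1 : ole (rkof F d1') (rkof F d1).
  by apply: (rkof_decr hF fF Fd1' _ (@na1 _)); rewrite e1 => y [].
have lt2 : olt (rkof G d2') a2 by have [] := rkofP hG fG Gd2' (@na2 _).
have addx (A B : set P) : A = B `\ x -> B x -> B = x |` A.
  move=> -> Bx; apply/seteqP; split=> [y By|y [->//|[]//]].
  by have [->|yx] := pselect (y = x); [left|right].
rewrite /v /=; have [xd1|xd1] := pselect (d1' x).
  apply: olt_ole_trans (oadd_ltr _ lt2) _; apply: ole_trans (oadd_ole _ _).
  apply: omul_olt; move: Fd1'; rewrite (addx _ _ e1 xd1) => Fd1'.
  exact: rkof_drop Fd1' (@na1 _) n1.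
have xd2 : d2' x.
  have : (x |` s) x by left.
  by rewrite sd' => -[].
apply: ole_olt_trans (oadd_lel _ (omul_ler _ le1)) _; apply: oadd_ltr.
move: Gd2'; rewrite (addx _ _ e2 xd2) => Gd2'.
exact: rkof_drop Gd2' (@na2 _) n2.
Qed.

(** A set has several decompositions, and which one an extension will use is not known in advance;
    but it restricts to some decomposition of [s]. The potential is therefore controlled over all
    decompositions at once. They are finitely many, so there is a maximum, and the points failing to
    lower one of them form a finite set. *)
Lemma CB_sqcup_decomp b s g : (forall d, D s d -> olt (v d) g) ->
  CB (sqcup R F G) b s -> olt b g.
Proof.
elim: b s g => J h IH s g Dg /(CB_osupP _ _ sqcup_hereditary sqcup_finitary)[Fs inf].
have fs := sqcup_finitary Fs.
have fD : finite_set (D s).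
  have /finite_setX := finite_subsets fs; move=> /(_ _ _ (finite_subsets fs)).
  by apply: sub_finite_set => d [_ _ ->]; split=> x /=; [left|right].
have D0 : D s !=set0 by case: Fs => d1 [d2 [? ? ? _]]; exists (d1, d2).
have [d Dd dmax] := finite_max v fD D0.
apply: ole_olt_trans (Dg d Dd); apply/ole_osup => j.
pose bad := \bigcup_(d in D s)
  (ext (CB F (rkof F d.1)) d.1 `|` ext (CB G (rkof G d.2)) d.2).
have fbad : finite_set bad.
  apply: bigcup_finite => // d' [Fd Gd _]; rewrite finite_setU.
  by split; [exact: ext_rkof_finite hF fF Fd (@na1 _)|exact: ext_rkof_finite hG fG Gd (@na2 _)].
have [x [[sx Fx] nbad]] := infinite_pick (inf j) fbad.
apply: IH Fx => d' Dd'; pose d0 := (d'.1 `\ x, d'.2 `\ x).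
have Dd0 : D s d0.
  case: Dd' => [F1 G2 e]; split=> /=; [by apply: hF F1 _ => y []|by apply: hG G2 _ => y []|].
  rewrite -setDUl -e; apply/seteqP; split=> [y sy|y [[]//]].
  by split; [right|move=> yx; apply: sx; rewrite -yx].
apply: olt_ole_trans (v_drop Dd0 sx _ _ Dd' _ _) (dmax _ Dd0) => //.
  by move=> ex; apply: nbad; exists d0 => //; left.
by move=> ex; apply: nbad; exists d0 => //; right.
Qed.

Lemma CB_sqcup b : CB (sqcup R F G) b set0 -> olt b (omul a2 (osucc a1)).
Proof.
apply: CB_sqcup_decomp => d [Fd Gd _].
have [_ _ lt1] := rkofP hF fF Fd (@na1 _); have [_ _ lt2] := rkofP hG fG Gd (@na2 _).
apply: olt_ole_trans (oadd_ltr _ lt2) _; apply: omul_olt.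
exact: olt_trans lt1 (osucc_gt _).
Qed.

End SqcupRank.

(** * Exp-indecomposable ordinals *)

Lemma ocountable_le a b : ocountable b -> ole a b -> ocountable a.
Proof. by move=> [e eb] ab; exists e => c ca; apply: eb; exact: olt_ole_trans ca ab. Qed.

Section ExpIndecomposable.
Variable l : Ord.
Hypothesis hl : exp_indecomposable l.

Lemma expi_omega : ole oomega l. Proof. by case: hl. Qed.

Lemma expi_nat n : olt (onat n) l.
Proof. exact: olt_ole_trans (onat_omega n) expi_omega. Qed.

Lemma expi_exp a b : olt a l -> olt b l -> olt (oexp a b) l.
Proof. by case: hl => _ _; apply. Qed.

(** The clause [2 <= m] is what gives [m + m <= m * m] in [expi_add]. *)
Lemma expi_max a b : olt a l -> olt b l ->
  exists m, [/\ olt m l, ole a m, ole b m & ole (onat 2) m].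
Proof.
have max c d : exists m, [/\ ole c m, ole d m & m = c \/ m = d].
  have [dc|cd] := olt_total d c; [exists c|exists d]; split;
  by [exact: oltW|exact: ole_refl|auto].
move=> al bl; have [m [am bm em]] := max a b; have [m' [mm' nm' em']] := max m (onat 2).
exists m'; split; [|exact: ole_trans am mm'|exact: ole_trans bm mm'|by []].
by case: em' => ->; [case: em => ->|exact: expi_nat].
Qed.

Lemma expi_mul a b : olt a l -> olt b l -> olt (omul a b) l.
Proof.
move=> al bl; have [m [ml am bm m2]] := expi_max al bl.
apply: ole_olt_trans (expi_exp ml (expi_nat 2)).
apply: ole_trans (omul_lel _ am) _; apply: ole_trans (omul_ler _ bm) _.
apply: ole_trans (omul_lel _ (oexp1_ge m)) _.
exact: oexp_olt (osucc_gt oone).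
Qed.

Lemma expi_add a b : olt a l -> olt b l -> olt (oadd a b) l.
Proof.
move=> al bl; have [m [ml am bm m2]] := expi_max al bl.
apply: ole_olt_trans (expi_mul ml ml).
apply: ole_trans (oadd_lel _ am) _; apply: ole_trans (oadd_ler _ bm) _.
apply: ole_trans (oadd_lel _ (omul1_ge m)) _.
by apply: omul_olt; exact/ole_succ.
Qed.

Lemma expi_succ a : olt a l -> olt (osucc a) l.
Proof.
move=> al; apply: ole_olt_trans (expi_add al (expi_nat 1)).
apply/ole_succ; apply: ole_olt_trans (oadd_ltr a (osucc_gt ozero)); exact: oadd_ole.
Qed.

End ExpIndecomposable.

Lemma is_iota_mono a b l : is_iota a l -> ole a b -> olt b l -> is_iota b l.
Proof.
by move=> [hl al min] ab bl; split=> // m hm /(ole_olt_trans ab); exact: min.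
Qed.

(** Exp-indecomposable ordinals are closed under products, so [k] is simply the larger of [l] and
    [m]. *)
Lemma is_iota_mul a b l m : is_iota a l -> is_iota b m -> ole oone a -> ole oone b ->
  exists k, [/\ is_iota (omul a b) k, ole l k & ole m k].
Proof.
move=> il im a1 b1; have [hl al _] := il; have [hm bm _] := im.
have aab : ole a (omul a b) by apply: omul_gel; exact/ole_succ.
have bab : ole b (omul a b) by apply: omul_ge; exact/ole_succ.
have [ml|lm] := olt_total m l; [exists l|exists m]; split; do ?[exact: ole_refl|exact: oltW|by []].
  by apply: is_iota_mono il aab _; apply: expi_mul => //; exact: olt_trans bm ml.
by apply: is_iota_mono im bab _; apply: expi_mul => //; exact: olt_ole_trans al lm.
Qed.

Lemma onat_oexp m n : exists k, ole (oexp (onat m) (onat n)) (onat k).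
Proof.
elim: n => [|n [k IH]]; first by exists 1; apply/oexp_osup_ole; split; [exact: ole_refl|].
exists (maxn 1 (k * m)); apply/oexp_osup_ole; split.
  exact: (@onat_ole 1 _ (leq_maxl 1 (k * m))).
move=> _; apply: ole_trans (omul_lel _ IH) _; apply: ole_trans (onat_omul _ _) _.
exact: (@onat_ole (k * m) _ (leq_maxr 1 (k * m))).
Qed.

Lemma exp_indecomposable_omega : exp_indecomposable oomega.
Proof.
split; last 2 first.
- exact: ole_refl.
- move=> b c [m bm] [n cn]; have [k mnk] := onat_oexp m n.
  exists k; apply: ole_trans mnk; apply: ole_trans (oexp_lel _ bm) _.
  exact: oexp_ler.
exists onat => b [n]; elim: n b => [|n IH] b bn.
  by exists 0; split=> //; exact: ozero_ole.
have [bn'|nb] := olt_total b (onat n.+1).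
  by apply: IH; exact/olt_succ.
by exists n.+1.
Qed.

Lemma is_iota_nat n : is_iota (onat n) oomega.
Proof.
split=> [||m hm _]; [exact: exp_indecomposable_omega|exact: onat_omega|exact: expi_omega].
Qed.

(** * Families of chains of bounded size *)

Section Sizes.
Variable P : Type.
Implicit Types s t : set P.

Lemma card_le_seqP s n :
  s #<= `I_n <-> exists l : seq {classic P}, size l <= n /\ s `<=` [set` l].
Proof.
have nthE (l : seq {classic P}) x : [set` l] = (nth x l) @` `I_(size l).
  apply/seteqP; split=> y /=; first by move=> yl; exists (index y l); rewrite /= ?index_mem// nth_index.
  by move=> [i il <-]; exact: mem_nth.
split=> [sn|[l [ln sl]]]; last first.
  apply: card_le_trans (subset_card_le sl) _.
  apply: (@card_le_trans _ _ _ `I_(size l)); last by rewrite card_le_II.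
  case: l {ln sl} nthE => [|x l] nthE; last by rewrite (nthE _ x); exact: card_image_le.
  by rewrite set_nil; exact: card_ge0.
have : finite_set s by apply/finite_set_leP; exists n.
move=> /(@finite_seqP {classic P})[l0 sl]; pose l := undup l0.
have {}sl : s = [set` l] by rewrite sl; apply/seteqP; split=> x /=; rewrite mem_undup.
exists l; split; last by rewrite sl.
have : uniq l by exact: undup_uniq.
move: sn; rewrite sl; case: l {sl} => [//|x l] sn ul.
rewrite -card_le_II; apply: card_le_trans sn.
rewrite (nthE _ x); suff : nth x (x :: l) @` `I_(size (x :: l)) #= `I_(size (x :: l)).
  by rewrite card_eq_sym card_eq_le => /andP[].
apply: inj_card_eq => i j; rewrite !inE /= => il jl /eqP.
by rewrite nth_uniq// => /eqP.
Qed.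

Lemma card_le_finite_set s n : s #<= `I_n -> finite_set s.
Proof. by move=> sn; apply/finite_set_leP; exists n. Qed.

Lemma card_le_U m n s t : s #<= `I_m -> t #<= `I_n -> s `|` t #<= `I_(m + n).
Proof.
move=> /card_le_seqP[l [lm sl]] /card_le_seqP[k [kn tk]]; apply/card_le_seqP.
exists (l ++ k); rewrite size_cat leq_add//; split=> // x /= [/sl|/tk] /= h.
  by rewrite mem_cat h.
by rewrite mem_cat h orbT.
Qed.

Lemma card_le_bigcup (x : set nat) (s : nat -> set P) k n :
  x #<= `I_k -> (forall i, s i #<= `I_n) -> \bigcup_(i in x) s i #<= `I_(k * n).
Proof.
move=> xk sn; have : finite_set x by apply/finite_set_leP; exists k.
move=> /finite_seqP[l0 xl]; pose l := undup l0.
have {}xl : x = [set` l] by rewrite xl; apply/seteqP; split=> y /=; rewrite mem_undup.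
have lk : size l <= k.
  have ul : uniq l := undup_uniq _.
  rewrite -card_le_II; apply: card_le_trans xk; rewrite xl.
  apply: (@card_le_trans _ _ _ ((fun i => nth 0 l i) @` `I_(size l))); last first.
    by apply: subset_card_le => _ [i il <-]; exact: mem_nth.
  suff : (fun i => nth 0 l i) @` `I_(size l) #= `I_(size l).
    by rewrite card_eq_le => /andP[].
  apply: inj_card_eq => i j; rewrite !inE /= => il jl /eqP.
  by rewrite nth_uniq// => /eqP.
suff h : \bigcup_(i in x) s i #<= `I_(size l * n).
  by apply: card_le_trans h _; rewrite card_le_II leq_mul.
rewrite xl; elim: l {xl lk} => [|i l IH].
  by rewrite (_ : bigcup _ _ = set0) ?card_ge0//; apply/seteqP; split=> y [].
rewrite /= mulSn; apply: card_le_trans (card_le_U (sn i) IH).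
apply: subset_card_le => y [j /=]; rewrite inE => /orP[/eqP ->|jl sy]; first by left.
by right; exists j.
Qed.

Lemma card_le_U1N n s x : ~ s x -> x |` s #<= `I_n.+1 -> s #<= `I_n.
Proof.
move=> sx /card_le_seqP[l [ln xsl]]; apply/card_le_seqP.
exists (rem (x : {classic P}) l); split.
  have xl : (x : {classic P}) \in l by apply: xsl; left.
  by rewrite size_rem//; case: (size l) ln.
move=> y sy /=; have yl : (y : {classic P}) \in l by apply: xsl; right.
by apply: rem_mem => //; apply/eqP => yx; apply: sx; rewrite -yx.
Qed.

Lemma card_set_le1P s : s #<= `I_1 <-> s = set0 \/ exists x, s = [set x].
Proof.
split=> [/card_le_seqP[[|x [|y l]] [// _ sl]]|[->|[x ->]]].
- by left; rewrite -subset0 => y /sl.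
- have [sx|nsx] := pselect (s x).
    right; exists x; apply/seteqP; split=> [y /sl/=|y ->//]; first by rewrite inE => /eqP.
  left; rewrite -subset0 => y sy; have := sl y sy; rewrite /= inE => /eqP yx.
  by apply: nsx; rewrite -yx.
- exact: card_ge0.
- by apply/card_le_seqP; exists [:: x]; split=> // y -> /=; rewrite inE.
Qed.

Lemma card_le_sub n s t : s #<= `I_n -> t `<=` s -> t #<= `I_n.
Proof. by move=> sn ts; exact: card_le_trans (subset_card_le ts) sn. Qed.

End Sizes.

Section ChainsLe.
Variables (P : Type) (R : P -> P -> Prop).
Implicit Types (F : set_family P) (s t M : set P).

Lemma chains_le_hereditary n : hereditary (chains_le R n).
Proof.
by move=> s t [sn cs] ts; split; [exact: card_le_sub sn ts|exact: is_chain_sub ts cs].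
Qed.

Lemma chains_le_on_chains n : family_on_chains R (chains_le R n).
Proof. by move=> s [/card_le_finite_set]. Qed.

Lemma on_chains_finitary F : family_on_chains R F -> finitary F.
Proof. by move=> cF s /cF[]. Qed.

Lemma chains_le_set0 n : chains_le R n set0.
Proof. by split; [exact: card_ge0|exact: is_chain0]. Qed.

Lemma chains_le_mono m n : m <= n -> chains_le R m `<=` chains_le R n.
Proof. by move=> mn s [sm cs]; split=> //; apply: card_le_trans sm _; rewrite card_le_II. Qed.

Lemma chains_le1P s : chains_le R 1 s <-> s = set0 \/ exists x, s = [set x].
Proof.
split=> [[/card_set_le1P//]|h]; split; first exact/card_set_le1P.
by case: h => [->|[x ->]]; [exact: is_chain0|exact: is_chain1].
Qed.

Lemma chains_le0 : chains_le R 0 = [set set0].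
Proof.
apply/seteqP; split=> [s [s0 _]|s ->]; last exact: chains_le_set0.
by move: s0; rewrite II0 card_le0 => /eqP.
Qed.

(** A set surviving [k] derivatives can be enlarged [k] times inside the family, and [n + 1]
    enlargements of the empty set exceed the size bound. *)
Lemma sub_chains_le_rank F n : hereditary F -> finitary F ->
  (forall s, F s -> s #<= `I_n) -> ~ CB F (onat n.+1) set0.
Proof.
move=> hF fF Fn.
have big (k m : nat) s : CB F (onat k) s -> ~ (s #<= `I_m) -> exists2 t, F t & ~ (t #<= `I_(m + k)).
  elim: k m s => [|k IH] m s; first by move=> /CB_sub Fs ns; exists s; rewrite ?addn0.
  move=> /(CB_succP _ _ hF fF)[Fs /infinite_setN0[x [sx Fx]]] ns.
  rewrite -addSnnS; apply: IH Fx _ => /(card_le_U1N sx); exact: ns.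
move=> /(CB_succP _ _ hF fF)[_ /infinite_setN0[x [_ Fx]]].
have [|t /Fn tn] := big _ 0 _ Fx; last by rewrite add0n.
by rewrite II0 card_le0 => /eqP e; have : (x |` set0) x by [left]; rewrite e.
Qed.

Lemma chains_le_rank n : ~ CB (chains_le R n) (onat n.+1) set0.
Proof.
apply: sub_chains_le_rank; [exact: chains_le_hereditary|
  exact: on_chains_finitary (@chains_le_on_chains n)|by move=> s []].
Qed.

Lemma le_rank_ge F M n k s : hereditary F -> finitary F -> infinite_set M ->
  (forall t, t `<=` M -> t #<= `I_n -> F t) ->
  s `<=` M -> s #<= `I_k -> k <= n -> CB F (onat (n - k)) s.
Proof.
move=> hF fF iM FM.
suff H (j i : nat) t : t `<=` M -> t #<= `I_i -> j + i = n -> CB F (onat j) t.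
  by move=> sM sk kn; apply: H sM sk _; rewrite subnK.
elim: j i t => [|j IH] i t tM ti jin.
  by split; [apply: FM; rewrite // -jin|case].
apply/CB_succP => //; split.
  by apply: FM => //; apply: card_le_trans ti _; rewrite card_le_II -jin leq_addl.
apply: infinite_sub (infinite_diff iM (card_le_finite_set ti)) => x [Mx tx].
split=> //; apply: (IH i.+1); last by rewrite addnS -jin addSn.
  by move=> y [->|/tM].
have x1 : [set x] #<= `I_1 by apply/card_set_le1P; right; exists x.
by have := card_le_U x1 ti; rewrite add1n.
Qed.

Lemma chains_le_rank_ge M n : infinite_chain R M ->
  CB (fam_restrict (chains_le R n) M) (onat n) set0.
Proof.
move=> [iM cM]; rewrite -[in onat n](subn0 n); apply: (@le_rank_ge _ M n 0) => //.
- exact/fam_restrict_hereditary/chains_le_hereditary.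
- exact/fam_restrict_finitary/on_chains_finitary/chains_le_on_chains.
- by move=> t tM tn; split; [split; [|exact: is_chain_sub tM cM]|].
Qed.

End ChainsLe.

(** * Homogeneous families *)

Section Homogeneous.
Variables (P : Type) (R : P -> P -> Prop).
Implicit Types F G : set_family P.

(** A lower bound for the small rank which makes sense before any exact value is known to exist, and
    which passes to larger families. *)
Definition rank_ge F a := forall M, infinite_chain R M -> CB (fam_restrict F M) a set0.

Lemma is_srk_exists F l : hereditary F -> finitary F -> F set0 ->
  ~ CB F l set0 -> (exists C, infinite_chain R C) -> exists a, is_srk R F a.
Proof.
move=> hF fF F0 Fl [C iC].
have rkC D : exists r, is_rk (fam_restrict F D) r.
  have hD := @fam_restrict_hereditary _ F D hF; have fD := @fam_restrict_finitary _ F D fF.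
  have [| |r [? _]] := @is_rk_exists _ (fam_restrict F D) l hD fD; last by exists r.
  - by split.
  - by move=> /(CB_restrict_sub hF fF).
have [r rC] := rkC C.
have [a [[D [iD aD]] min]] := @exists_olt_min
  (fun a => exists C, infinite_chain R C /\ is_rk (fam_restrict F C) a) r (ex_intro _ C (conj iC rC)).
exists a; split; first by exists D.
move=> D' b iD' bD'; apply: oltNgeP => /min; apply; by exists D'.
Qed.

Lemma is_srk_uniq F a b : is_srk R F a -> is_srk R F b -> ole a b.
Proof. by move=> [_ mina] [[C [iC bC]] _]; exact: mina bC. Qed.

Lemma is_srk_rank_ge F a l : hereditary F -> finitary F -> F set0 ->
  ~ CB F l set0 -> is_srk R F a -> rank_ge F a.
Proof.
move=> hF fF F0 Fl [_ min] M iM.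
have hM := @fam_restrict_hereditary _ F M hF; have fM := @fam_restrict_finitary _ F M fF.
have [| |r [rM _]] := @is_rk_exists _ (fam_restrict F M) l hM fM.
- by split.
- by move=> /(CB_restrict_sub hF fF).
- exact/(is_rk_leP _ hM fM rM)/(min M).
Qed.

Lemma is_srk_le F a b : hereditary F -> finitary F ->
  rank_ge F a -> is_srk R F b -> ole a b.
Proof.
move=> hF fF ge [[C [iC bC]] _].
apply/(is_rk_leP _ _ _ bC); [exact: fam_restrict_hereditary|
  exact: fam_restrict_finitary|exact: ge].
Qed.

Lemma is_srk_lt F a l : hereditary F -> finitary F ->
  ~ CB F l set0 -> is_srk R F a -> olt a l.
Proof.
move=> hF fF Fl [[C [iC aC]] _]; apply: oleNgtP => la; apply: Fl.
apply: (CB_restrict_sub hF fF (A := C)).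
by apply/(is_rk_leP _ _ _ aC) => //; [exact: fam_restrict_hereditary|exact: fam_restrict_finitary].
Qed.

Lemma rank_ge_mono F G a : hereditary F -> finitary F -> hereditary G -> finitary G ->
  F `<=` G -> rank_ge F a -> rank_ge G a.
Proof.
move=> hF fF hG fG FG ge M /ge; apply: CB_mono;
  do ?[exact: fam_restrict_hereditary|exact: fam_restrict_finitary].
by move=> s [/FG].
Qed.

(** The exact small rank and the full rank both lie between [a] and [l = iota(a)], so they have the
    same [iota]; compactness comes from the rank bound. Two bounds thus replace the computation of
    ranks. *)
Lemma homogeneous_intro F a l : (exists C, infinite_chain R C) ->
  family_on_chains R F -> hereditary F -> chains_le R 1 `<=` F ->
  ~ CB F l set0 -> is_iota a l -> ole oone a -> rank_ge F a ->
  exists b, [/\ is_srk R F b, ole a b, is_iota b l & homogeneous R F].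
Proof.
move=> exC cF hF F1 Fl il a1 ge; have fF := on_chains_finitary cF.
have F0 : F set0 by apply: F1; exact: chains_le_set0.
have [b sb] := is_srk_exists hF fF F0 Fl exC.
have ab := is_srk_le hF fF ge sb; have bl := is_srk_lt hF fF Fl sb.
have ib := is_iota_mono il ab bl.
have cb : ocountable b by case: il => -[cl _ _] _ _; exact: ocountable_le cl (oltW bl).
exists b; split=> //; exists b; split=> //; split=> //; first exact: rank_compact Fl.
right; split=> //; first exact: ole_trans a1 ab.
have [r [rr rl]] := is_rk_exists hF fF F0 Fl; exists r, l; split=> //.
apply/(is_rk_leP _ hF fF rr); case: sb => -[C [iC bC]] _.
apply: (CB_restrict_sub hF fF (A := C)).
by apply/(is_rk_leP _ _ _ bC); [exact: fam_restrict_hereditary|exact: fam_restrict_finitary|exact: ole_refl].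
Qed.

Lemma homogeneousP F : homogeneous R F ->
  [/\ family_on_chains R F, hereditary F & F set0] /\
  (F = [set set0] \/ exists a l,
    [/\ is_srk R F a, ole oone a, is_iota a l, ~ CB F l set0 & chains_le R 1 `<=` F]).
Proof.
move=> [a [_ [cF _ hF [[_ ->]|[a1 _ F1 sa [r [l [rr ar il rl]]]]]]]].
  split; last by left.
  rewrite -(chains_le0 R); split; [exact: chains_le_on_chains|
    exact: chains_le_hereditary|exact: chains_le_set0].
have F0 : F set0 by apply: F1; exact: chains_le_set0.
split=> //; right; exists a, l; split=> //.
by move=> /(is_rk_leP _ hF (on_chains_finitary cF) rr) /(olt_ole_trans rl)/olt_irr.
Qed.

Lemma is_srk_set0 : (exists C, infinite_chain R C) -> is_srk R [set set0] ozero.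
Proof.
move=> [C iC]; have h0 (D : set P) : is_rk (fam_restrict [set set0] D) ozero.
  have e : fam_restrict (chains_le R 0) D = fam_restrict [set set0] D by rewrite chains_le0.
  have hD := @fam_restrict_hereditary _ _ D (@chains_le_hereditary _ R 0).
  have fD := @fam_restrict_finitary _ _ D (on_chains_finitary (@chains_le_on_chains _ R 0)).
  rewrite -e; split; first by exists set0; split; [split; [exact: chains_le_set0|]|case].
  move=> b /(CB_nonempty _ hD fD) Db; apply/olt_succ; apply: (CB_lt hD fD Db).
  move=> /CB_restrict_sub-/(_ (@chains_le_hereditary _ R 0)).
  by move=> /(_ (on_chains_finitary (@chains_le_on_chains _ R 0))); exact: chains_le_rank.
split; first by exists C.
by move=> D b _ /(fun h => proj2 h ozero); apply; have [] := h0 D.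
Qed.

End Homogeneous.

Lemma infinite_inj (T : Type) (A : set T) : infinite_set A ->
  exists j : nat -> T, injective j /\ forall n, A (j n).
Proof.
move=> /infiniteP/card_leP[f]; exists (fun n => val (f (to_setT n))).
split=> [m n /val_inj|n]; last exact: set_valP.
by move=> /inj; rewrite !inE => /(_ Logic.I Logic.I) /(congr1 val).
Qed.

(** * Families of prescribed small rank *)

Section Descent.
Variables (a : Ord) (e : nat -> Ord).

(** The labels count down how often the set may still be extended: an element added after [n] must
    find a label below [v n]. The sequence [e] is meant to enumerate the ordinals below [a]. *)
Definition descent (v : nat -> Ord) (s : set nat) : Prop :=
  (forall n, s n -> olt (v n) a /\ exists2 k, k <= n & oeq (v n) (e k)) /\
  (forall m n, s m -> s n -> m < n -> olt (v n) (v m)).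

(* The value attached to [n] is one of [e 0, ..., e n]: this finiteness is what *)
(* keeps the rank down to [a]. *)
Definition descent_family : set_family nat :=
  [set s | finite_set s /\ exists v, descent v s].

Lemma descent_hereditary : hereditary descent_family.
Proof.
move=> s t [fs [v [v1 v2]]] ts; split; first exact: sub_finite_set fs.
by exists v; split=> [n /ts/v1//|m n /ts sm /ts sn]; exact: v2.
Qed.

Lemma descent_finitary : finitary descent_family.
Proof. by move=> s []. Qed.

Lemma descent_last b s n : CB descent_family b s -> s n -> (forall m, s m -> m <= n) ->
  exists v, descent v s /\ ole b (v n).
Proof.
elim: b s n => J g IH s n /(CB_osupP _ _ descent_hereditary descent_finitary).
move=> [[fs [v0 v0s]] inf] sn nmax.
pose D := [set k | k <= n /\ exists v, descent v s /\ oeq (v n) (e k)].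
have fD : finite_set D by apply: sub_finite_set (finite_II n.+1) => k [].
have D0 : D !=set0.
  by have [k kn vk] := (v0s.1 n sn).2; exists k; split=> //; exists v0.
(* The labelling may change completely when a point is added. Only finitely many labels are possible
   at [n], though, and the greatest one bounds the label given to [n] by every extension. *)
have [k [kn [v [vs vk]]] kmax] := finite_max e fD D0.
exists v; split=> //; apply/ole_osup => j.
have [x [[sx Fx] xn]] := infinite_pick (inf j) (finite_II n.+1).
have {}xn : n < x by rewrite ltnNge; exact/negP.
have [||v' [v's gv]] := IH j _ x Fx; first by left.
  by move=> m [->//|/nmax mn]; exact: leq_trans mn (ltnW xn).
have v'ss : descent v' s.
  by case: v's => v1 v2; split=> [m sm|m m' sm sm']; [apply: v1|apply: v2]; right.
apply: ole_olt_trans gv _; apply: olt_ole_trans (v's.2 n x _ _ xn) _; [by right|by left|].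
have [k' k'n v'k'] := (v'ss.1 n sn).2.
apply: ole_trans v'k'.1 _; apply: ole_trans vk.2.
by apply: kmax; split=> //; exists v'.
Qed.

Lemma descent_rank : ~ CB descent_family (osucc a) set0.
Proof.
move=> /(CB_succP _ _ descent_hereditary descent_finitary)[_].
move=> /infinite_setN0[x [_ Fx]].
have [||v [[v1 _] av]] := descent_last (n := x) Fx; first by left.
  by move=> m [->|[]].
have [vx _] : olt (v x) a /\ exists2 k, k <= x & oeq (v x) (e k) by apply: v1; left.
exact: oltNge vx av.
Qed.

Hypothesis e0 : e 0 = ozero.
Hypothesis ea : forall b, olt b a -> exists n, oeq b (e n).

Lemma descent_set1 n : olt ozero a -> descent_family [set n].
Proof.
move=> a0; split; first exact: finite_set1.
exists (fun=> ozero); split=> [m _|p m -> ->]; last by rewrite ltnn.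
by split=> //; exists 0 => //; rewrite e0; split; exact: ole_refl.
Qed.

(** A new point can carry the label [g i] as soon as its index is past the elements of [s] and past
    the position of [g i] in [e]. This excludes finitely many points, so up to [a] no rank is
    lost. *)
Lemma descent_rank_ge (P : Type) (j : nat -> P) (E : set_family P) (M : set P) b s v :
  injective j -> hereditary E -> finitary E -> infinite_set M ->
  M `<=` range j -> ole b a -> CB (fam_restrict E M) b s ->
  descent v (j @^-1` s) -> (forall n, s (j n) -> ole b (v n)) ->
  CB [set t | fam_restrict E M t /\ descent_family (j @^-1` t)] b s.
Proof.
move=> ij hE fE iM Mj; set F := [set t | _].
have hM := @fam_restrict_hereditary _ E M hE; have fM := @fam_restrict_finitary _ E M fE.
have hF : hereditary F.
  move=> t u [Et Kt] ut; split; first exact: hM Et ut.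
  by apply: descent_hereditary Kt _ => n /ut.
have fF : finitary F by move=> t [/fM].
elim: b s v => J g IH s v ba /(CB_osupP _ _ hM fM)[Es inf] vs bv.
have fs := fM _ Es; have fjs : finite_set (j @^-1` s).
  apply: finite_preimage => // m n _ _; exact: ij.
apply/(CB_osupP _ _ hF fF); split=> [|i].
  by split=> //; split=> //; exists v.
have gia : olt (g i) a := ba i.
have [k [gk kg]] := ea gia.
pose bad := j @` ((j @^-1` s) `|` `I_k `|` \bigcup_(n in j @^-1` s) `I_n).
have fbad : finite_set bad.
  apply: finite_image; rewrite !finite_setU; split; first by split=> //; exact: finite_II.
  by apply: bigcup_finite => // n _; exact: finite_II.
apply: infinite_sub (infinite_diff (inf i) fbad) => x [[sx Fx] nbad]; split=> //.
have [n _ jn] : range j x.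
  by apply: Mj; have [_] := CB_sub Fx; apply; left.
move: Fx sx nbad; rewrite -jn => Fx sx nbad.
have kn : k <= n by rewrite leqNgt; apply/negP => nk; apply: nbad; exists n => //; left; right.
have sn m : s (j m) -> m < n.
  move=> sm; rewrite ltn_neqAle; apply/andP; split.
    by apply/eqP => mn; apply: sx; rewrite -mn.
  by rewrite leqNgt; apply/negP => nm; apply: nbad; exists n => //; right; exists m.
pose v' m := if m == n then g i else v m.
apply: (IH i _ v') => //; first exact: oltW.
  split=> [m [/ij ->|sm]|m p [/ij ->|sm] [/ij ->|sp]].
  - by rewrite /v' eqxx; split=> //; exists k.
  - by rewrite /v' (ltn_eqF (sn m sm)); exact: vs.1.
  - by rewrite ltnn.
  - by move=> /(ltn_trans (sn p sp)); rewrite ltnn.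
  - by rewrite /v' eqxx (ltn_eqF (sn m sm)) => _; exact: bv.
  - by rewrite /v' (ltn_eqF (sn m sm)) (ltn_eqF (sn p sp)); exact: vs.2.
move=> m [/ij ->|sm]; first by rewrite /v' eqxx; exact: ole_refl.
by rewrite /v' (ltn_eqF (sn m sm)); apply: oltW; exact: (bv m sm).
Qed.

End Descent.

(** Only the traces on one countable chain [range j] are cut down, and there the rank becomes [a]. A
    chain meeting [range j] in a finite set keeps the rank of [E] on the remainder; one meeting it
    in an infinite set is covered by [descent_rank_ge]. *)
Lemma srk_cut (P : Type) (R : P -> P -> Prop) (E : set_family P) a :
  family_on_chains R E -> hereditary E -> chains_le R 1 `<=` E -> rank_ge R E a ->
  ole oone a -> ocountable a -> (exists C, infinite_chain R C) ->
  exists F, [/\ F `<=` E, hereditary F, chains_le R 1 `<=` F, rank_ge R F a & is_srk R F a].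
Proof.
move=> cE hE E1 ge a1 [e0 e0a] [C [iC cC]].
have fE := on_chains_finitary cE.
have [j [ij jC]] := infinite_inj iC.
(* The enumeration is shifted to make [e 0] zero: this label is allowed at every position, which
   puts all singletons into [K]. *)
pose e n := if n is k.+1 then e0 k else ozero.
have ea b : olt b a -> exists n, oeq b (e n) by move=> /e0a[n]; exists n.+1.
pose K := descent_family a e.
have hK : hereditary K := @descent_hereditary a e.
have fK : finitary K := @descent_finitary a e.
pose F := [set t | E t /\ K (j @^-1` t)].
have hF : hereditary F.
  move=> t u [Et Kt] ut; split; first exact: hE Et ut.
  by apply: hK Kt _ => n /ut.
have FE : F `<=` E by move=> t [].
have fF : finitary F by move=> t /FE/fE.
have K0 : K set0.
  split; first exact: finite_set0.
  by exists (fun=> ozero); split=> [n []|m n []].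
have F1 : chains_le R 1 `<=` F.
  move=> t t1; split; first exact: E1.
  move: t1 => /chains_le1P[->|[x ->]]; first by rewrite preimage_set0.
  have [[n jn]|nj] := pselect (exists n, j n = x).
    rewrite (_ : _ @^-1` _ = [set n]); last first.
      by apply/seteqP; split=> m /=; rewrite -jn; [exact: ij|move=> ->].
    by apply: descent_set1 => //; exact/ole_succ.
  rewrite (_ : _ @^-1` _ = set0)//; apply/seteqP; split=> m //= jm.
  by apply: nj; exists m.
have Fge : rank_ge R F a.
  move=> M [iM cM].
  have hFM := @fam_restrict_hereditary _ F M hF; have fFM := @fam_restrict_finitary _ F M fF.
  have [fMj|iMj] := pselect (finite_set (M `&` range j)).
    have iMD : infinite_chain R (M `\` (M `&` range j)).
      split; first exact: infinite_diff.
      by apply: is_chain_sub cM => x [].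
    have := ge _ iMD; apply: CB_mono => //.
    - exact: fam_restrict_hereditary.
    - exact: fam_restrict_finitary.
    move=> t [Et tM]; split; last by move=> x /tM[].
    split=> //; rewrite (_ : _ @^-1` _ = set0)//; apply/seteqP; split=> n //= jn.
    by have [Mj] := tM _ jn; apply; split=> //; exists n.
  have iN : infinite_chain R (M `&` range j) by split=> //; apply: is_chain_sub cM => x [].
  have := @descent_rank_ge a e ea P j E (M `&` range j) a set0 (fun=> ozero) ij hE fE iMj.
  move=> /(_ (@subIsetr _ _ _) (ole_refl a) (ge _ iN)).
  have d0 : descent a e (fun=> ozero) (j @^-1` set0) by split=> [n []|m n []].
  move=> /(_ d0 (fun n => False_ind _)); apply: CB_mono => //.
  - move=> t u [Et Kt] ut; split; first exact: fam_restrict_hereditary Et ut.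
    by apply: hK Kt _ => n /ut.
  - by move=> t [[/fE]].
  - by move=> t [[Et tM] Kt]; split=> // x /tM[].
exists F; split=> //; split; last first.
  move=> D b iD bD; apply/(is_rk_leP _ _ _ bD); last exact: Fge.
    exact: fam_restrict_hereditary.
  exact: fam_restrict_finitary.
have iR : infinite_chain R (range j).
  split; last by apply: is_chain_sub cC => _ [n _ <-].
  move=> fj; apply: infinite_nat; rewrite -(preimage_range j).
  by apply: finite_preimage fj => m n _ _; exact: ij.
exists (range j); split=> //.
have hFj := @fam_restrict_hereditary _ F (range j) hF.
have fFj := @fam_restrict_finitary _ F (range j) fF.
split=> [|b /(CB_nonempty _ hFj fFj) Fb]; first by exists set0; exact: Fge.
(* Preimages under [j] carry the derivatives of the trace on [range j] into those of [K], which
   vanish at [osucc a]. *)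
apply/olt_succ; apply: (CB_lt hK fK) (@descent_rank a e).
rewrite -(preimage_set0 j); apply: CB_transfer Fb => //; first by move=> d [[]].
move=> d X [[Ed Kd] dj] iX Xd iN; apply: iX.
apply: sub_finite_set (finite_image j iN) => x Xx.
have [dx [[Exd _] xdj]] := Xd x Xx.
have [n _ jn] : range j x by apply: xdj; left.
exists n => //; split; first by rewrite /= jn.
exists x; split=> // m [->|]; first by left.
by move=> dm; right.
Qed.

(** * Subsequences *)

Lemma greedy_sequence (X : Type) (S : X -> Prop) (Q : X -> X -> Prop) :
  (forall l : seq {classic X}, (forall x, x \in l -> S x) ->
     exists y, S y /\ forall x, x \in l -> Q x y) ->
  exists f : nat -> X, (forall n, S (f n)) /\ forall m n, m < n -> Q (f m) (f n).
Proof.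
move=> H.
have /choice[g gP] (l : seq {classic X}) : exists y : X,
    (forall x, x \in l -> S x) -> S y /\ forall x, x \in l -> Q x y.
  have [/H[y yP]|nS] := pselect (forall x, x \in l -> S x); first by exists y.
  by have [y _] := H [::] (fun x (h : x \in [::]) => False_ind _ (notF h)); exists y.
pose L := fix L n : seq {classic X} := if n is k.+1 then g (L k) :: L k else [::].
have LS n x : x \in L n -> S x.
  elim: n x => [//|n IH] x /=; rewrite inE => /orP[/eqP ->|/IH//].
  exact: (gP (L n) IH).1.
exists (fun n => g (L n)); split=> [n|m n mn]; first exact: (gP (L n) (LS n)).1.
apply: (gP (L n) (LS n)).2; elim: n mn => [//|n IH].
rewrite ltnS leq_eqVlt => /orP[/eqP ->|/IH mn]; first by rewrite /= mem_head.
by rewrite /= inE mn orbT.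
Qed.

Lemma mem_classic (X : eqType) (x : X) (l : seq X) :
  (x \in l) = ((x : {classic X}) \in (l : seq {classic X})).
Proof.
elim: l => [//|y l IH]; rewrite !inE IH; congr orb.
by apply/eqP/eqP.
Qed.

Lemma greedy_subsequence (S : set nat) (Q : nat -> nat -> Prop) :
  (forall l : seq nat, (forall n, n \in l -> S n) ->
     infinite_set [set m | S m /\ forall n, n \in l -> Q n m]) ->
  exists phi : nat -> nat, [/\ {homo phi : m n / m < n}, forall n, S (phi n) &
    forall m n, m < n -> Q (phi m) (phi n)].
Proof.
move=> H; have [l lS|phi [phiS phiQ]] := @greedy_sequence nat S (fun n m => n < m /\ Q n m).
  have [|m [[Sm mQ] ml]] := infinite_pick (H l _) (finite_II (\max_(i <- l) i).+1).
    by move=> n; rewrite mem_classic; exact: lS.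
  exists m; split=> // n; rewrite -mem_classic => nl; split; last exact: mQ.
  rewrite ltnNge; apply/negP => mn; apply: ml; rewrite /= ltnS.
  exact: leq_trans mn (leq_bigmax_seq _ nl _).
by exists phi; split=> // m n /phiQ[].
Qed.

Lemma infinite_subsequence (S : set nat) : infinite_set S ->
  exists phi : nat -> nat, {homo phi : m n / m < n} /\ forall n, S (phi n).
Proof.
move=> iS; have [l lS|phi [? ? _]] := @greedy_subsequence S (fun _ _ => True); last by exists phi.
by apply: infinite_sub iS => n Sn; split.
Qed.

Lemma infinite_pigeon (T : Type) (S : set nat) (s : nat -> T) (V : set T) :
  infinite_set S -> finite_set V -> (forall n, S n -> V (s n)) ->
  exists2 v, V v & infinite_set [set n | S n /\ s n = v].
Proof.
move=> iS fV SV; apply: contrapT => h; apply: iS.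
suff : finite_set (\bigcup_(v in V) [set n | S n /\ s n = v]).
  by apply: sub_finite_set => n Sn; exists (s n); [exact: SV|].
by apply: bigcup_finite => // v Vv; apply: contrapT => inf; apply: h; exists v.
Qed.

(** * Uniform families *)

Lemma uniform_finitary H : uniform_families H -> finitary H.
Proof.
move=> [_ _ [a [_ u]]]; case: u => [b M F _ _ -> s ->|b c M F _ _ FM _ _ s /FM[]//|
  b c M F _ _ FM _ _ _ _ _ s /FM[]//]; exact: finite_set0.
Qed.

Lemma all2_leq (s t : seq nat) : size s = size t ->
  (forall m n, m \in s -> n \in t -> m <= n) -> all2 leq s t.
Proof.
elim: s t => [|m s IH] [|n t] //= [st] H; rewrite H ?mem_head// IH// => p q ps qt.
by apply: H; rewrite inE ?ps ?qt orbT.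
Qed.

Lemma sorted_seqP (s : set nat) : finite_set s ->
  exists l : seq nat, sorted ltn l /\ s = [set` l].
Proof.
move=> /finite_seqP[l ->]; exists (sort leq (undup l)); split.
  by rewrite ltn_sorted_uniq_leq sort_uniq undup_uniq sort_sorted//; exact: leq_total.
by apply/seteqP; split=> n /=; rewrite mem_sort mem_undup.
Qed.

(** A strictly increasing map satisfies [n <= psi n], so this is an instance of spreading. It is
    what allows passing to further subsequences. *)
Lemma uniform_shift H (psi : nat -> nat) x : uniform_families H ->
  {homo psi : m n / m < n} -> H x -> H (psi @` x).
Proof.
move=> UH psim Hx; have [l [sl xl]] := sorted_seqP (uniform_finitary UH Hx).
have -> : psi @` x = [set` map psi l].
  by rewrite xl; apply/seteqP; split=> [_ [n /= nl <-]|_ /= /mapP[n nl ->]]; [exact: map_f|exists n].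
have [_ sp _] := UH; apply: (sp l); rewrite -?xl//.
  by apply: homo_sorted sl => m n; exact: psim.
have psi_ge n : n <= psi n.
  by elim: n => [//|n IH]; apply: leq_ltn_trans IH _; exact: psim.
by elim: l {sl xl} => [//|n l IH] /=; rewrite psi_ge.
Qed.

(* Spreading moves a large member of [H] into any infinite set, whose           *)
(* restriction of [H] therefore contains all small enough finite subsets.       *)
Lemma uniform_size H c k : uniform_families H -> is_srk nat_lt H c ->
  ole c (onat k) -> forall x, H x -> x #<= `I_k.
Proof.
move=> UH sc ck x Hx; have [hH sp _] := UH; have fH := uniform_finitary UH.
have [l [sl xl]] := sorted_seqP (fH _ Hx).
have [lk|kl] := leqP (size l) k.
  by apply/card_le_seqP; exists l; split=> // n; rewrite xl /= mem_classic.
exfalso; apply: (@oltNge c (onat k.+1)); first by apply/olt_succ.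
apply: is_srk_le sc => // M [iM cM].
pose N := (\max_(i <- l) i).+1; pose M' := M `\` `I_N.
have iM' : infinite_set M' by apply: infinite_diff => //; exact: finite_II.
rewrite -[in onat _](subn0 k.+1); apply: (@le_rank_ge _ _ M' k.+1 0) => //.
- exact: fam_restrict_hereditary.
- exact: fam_restrict_finitary.
move=> t tM' tk; split; last by move=> n /tM'[].
have [lt [slt tlt]] := sorted_seqP (card_le_finite_set tk).
have slk : size lt <= size l.
  apply: leq_trans kl; rewrite -card_le_II; apply: card_le_trans tk; rewrite tlt.
  have e : nth 0 lt @` `I_(size lt) = [set` lt].
    apply/seteqP; split=> [_ [i il <-]|n /= nl]; first exact: mem_nth.
    by exists (index n lt); rewrite /= ?index_mem// nth_index.
  rewrite -e; suff : nth 0 lt @` `I_(size lt) #= `I_(size lt).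
    by rewrite card_eq_sym card_eq_le => /andP[].
  apply: inj_card_eq => i j; rewrite !inE /= => il jl /eqP.
  by rewrite nth_uniq ?(sorted_uniq ltn_trans ltnn)// => /eqP.
rewrite tlt; apply: (sp (take (size lt) l)) => //.
- exact: take_sorted.
- apply: all2_leq; first by rewrite size_takel.
  move=> m n /mem_take ml nt; have [_ /negP] : M' n by apply: tM'; rewrite tlt.
  by rewrite -leqNgt; apply: leq_trans; apply: leqW; exact: leq_bigmax_seq.
- by apply: hH Hx _; rewrite xl => n /= /mem_take.
Qed.

(** * Graded systems of families on chains *)

Lemma is_iota_eq a b l : is_iota a l -> ole a b -> ole b a -> is_iota b l.
Proof.
move=> il ab ba; apply: (is_iota_mono il ab).
by case: il => _ al _; exact: ole_olt_trans ba al.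
Qed.

Section System.
Variables (P : Type) (R : P -> P -> Prop).
Implicit Types (E F G : set_family P) (D : Ord -> set (set_family P)).

(** Condition (M.2), separated from the requirements on ranks. *)
Definition multiplies (H : set_family nat) E E' := forall s : nat -> set P,
  (forall n, E (s n)) -> is_chain R (\bigcup_n s n) ->
  exists phi : nat -> nat, {homo phi : m n / m < n} /\
    forall x, H x -> E' (\bigcup_(n in x) s (phi n)).

(* A basis up to domination and up to exact ranks: [D l] consists of families   *)
(* of rank below [l]. *)
Record chain_system D : Prop := ChainSystem {
  cs_fam : forall l E, exp_indecomposable l -> D l E ->
    [/\ family_on_chains R E, hereditary E, E set0 & ~ CB E l set0];
  cs_mono : forall l m E, exp_indecomposable l -> exp_indecomposable m ->
    ole l m -> D l E -> D m E;
  cs_chains : forall l n, exp_indecomposable l -> D l (chains_le R n);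
  cs_sqcup : forall l E F, exp_indecomposable l -> D l E -> D l F ->
    exists2 G, D l G & sqcup R E F `<=` G;
  cs_mult : forall l E H c, exp_indecomposable l -> D l E -> uniform_families H ->
    is_srk nat_lt H c -> olt c l -> exists2 E', D l E' & multiplies H E E';
  cs_large : forall l a, is_iota a l -> ole oomega a ->
    exists2 E, D l E & rank_ge R E a }.

Lemma set0_family :
  [/\ family_on_chains R [set set0], hereditary [set set0 : set P] &
      forall l, ole oone l -> ~ CB [set set0 : set P] l set0].
Proof.
rewrite -(chains_le0 R); have h := @chains_le_hereditary _ R 0.
have f := on_chains_finitary (@chains_le_on_chains _ R 0).
split=> [||l l1 Fl] //; first exact: chains_le_on_chains.
by apply: (@chains_le_rank _ R 0); exact: CB_anti l1 _ Fl.
Qed.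

Lemma homogeneous_set0 : homogeneous R [set set0].
Proof.
have [cF hF rF] := set0_family.
exists ozero; split; first by exists (fun=> ozero) => b /nolt0.
split=> //; first exact: (rank_compact hF (on_chains_finitary cF) (rF _ (ole_refl _))).
by left; split=> //; split; exact: ole_refl.
Qed.

Section Basis.
Variables (D : Ord -> set (set_family P)).
Hypothesis sysD : chain_system D.
Hypothesis exC : exists C, infinite_chain R C.
Hypothesis exI : forall a, ole oomega a -> ocountable a -> exists l, is_iota a l.
Hypothesis exH : forall H, uniform_families H ->
  exists c l, is_srk nat_lt H c /\ is_iota c l.

Let fin E : family_on_chains R E -> finitary E := @on_chains_finitary _ R E.

Let B F := homogeneous R F /\
  exists a l E, [/\ is_srk R F a, is_iota a l, D l E & F `<=` E].

Lemma system_enlarge a l E : is_iota a l -> ole oone a -> D l E ->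
  exists G, [/\ D l G, E `<=` G, chains_le R 1 `<=` G & rank_ge R G a].
Proof.
move=> il a1 DE; have [hl al _] := il.
have [L DL Lge] : exists2 L, D l L & rank_ge R L a.
  (* The field [cs_large] starts at omega; a finite rank is reached by chains of bounded size. *)
  have [aw|wa] := olt_total a oomega; last exact: cs_large.
  have [n an] := aw; exists (chains_le R n); first exact: cs_chains.
  move=> M iM; apply: CB_anti an _ (chains_le_rank_ge n iM).
    exact/fam_restrict_hereditary/chains_le_hereditary.
  exact/fam_restrict_finitary/fin/chains_le_on_chains.
have [G1 DG1 EG1] := cs_sqcup sysD hl DE (cs_chains sysD 1 hl).
have [G2 DG2 EG2] := cs_sqcup sysD hl DG1 DL.
have [cE hE E0 _] := cs_fam sysD hl DE; have [cL hL L0 _] := cs_fam sysD hl DL.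
have [cG1 hG1 G10 _] := cs_fam sysD hl DG1; have [cG2 hG2 _ _] := cs_fam sysD hl DG2.
have G12 : G1 `<=` G2 by apply: subset_trans EG2; exact: sqcup_ge.
exists G2; split=> //.
- apply: subset_trans G12; apply: subset_trans EG1; apply: sqcup_ge => //.
  exact: chains_le_set0.
- apply: subset_trans G12; apply: subset_trans EG1; apply: sqcup_ger => //.
  exact: chains_le_on_chains.
- apply: rank_ge_mono Lge => //; [exact: fin|exact: fin|].
  by apply: subset_trans EG2; exact: sqcup_ger.
Qed.

Lemma system_basisI F a l E : is_iota a l -> ole oone a -> D l E -> F `<=` E ->
  hereditary F -> chains_le R 1 `<=` F -> rank_ge R F a ->
  exists b, [/\ is_srk R F b, ole a b, is_iota b l & B F].
Proof.
move=> il a1 DE FE hF F1 ge; have [hl _ _] := il.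
have [cE hE E0 El] := cs_fam sysD hl DE.
have cF : family_on_chains R F by move=> s /FE/cE.
have Fl : ~ CB F l set0 by move=> /(CB_mono hF (fin cF) hE (fin cE) FE).
have [b [sb ab ib hoF]] := homogeneous_intro exC cF hF F1 Fl il a1 ge.
by exists b; split=> //; split=> //; exists b, l, E.
Qed.

Let BP F : B F -> [/\ family_on_chains R F, hereditary F & F set0] /\
  (F = [set set0] \/ exists a l E, [/\ is_srk R F a, ole oone a, is_iota a l, D l E & F `<=` E] /\
    [/\ ~ CB F l set0, chains_le R 1 `<=` F & rank_ge R F a]).
Proof.
move=> [/homogeneousP[h [FE0|[a [l [sa a1 il Fl F1]]]]] [a' [l' [E [sa' il' DE FE]]]]].
  by split=> //; left.
split=> //; right; exists a', l', E; have [cF hF F0] := h.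
have aa' := is_srk_uniq sa sa'; have a'a := is_srk_uniq sa' sa.
have [hl' a'l' _] := il'; have [cE hE E0 El] := cs_fam sysD hl' DE.
have Fl' : ~ CB F l' set0 by move=> /(CB_mono hF (fin cF) hE (fin cE) FE).
split; first by split=> //; exact: ole_trans aa'.
by split; [| |exact: (is_srk_rank_ge hF (fin cF) F0 Fl' sa')].
Qed.

(** Serves for the union and for [sqcup] alike. The larger of the two levels is used; [cs_mono]
    lifts the other family to it, and the lower bound on the rank comes from the family whose level
    it is. *)
Lemma system_basis_join F G K : B F -> B G -> hereditary K ->
  F `<=` K -> G `<=` K -> K `<=` sqcup R F G -> B K.
Proof.
move=> BF BG hK FK GK KFG.
have [[cF hF F0] HF] := BP BF; have [[cG hG G0] HG] := BP BG.
case: HF => [F0E|[a [l [E [[sa a1 il DE FE] [Fl F1 Fge]]]]]].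
  suff -> : K = G by [].
  apply/seteqP; split=> // _ /KFG[s [t [+ Gt -> _]]].
  by rewrite F0E => ->; rewrite set0U.
case: HG => [G0E|[b [m [E' [[sb b1 im DE' GE] [Gm G1 Gge]]]]]].
  suff -> : K = F by [].
  apply/seteqP; split=> // _ /KFG[s [t [Fs + -> _]]].
  by rewrite G0E => ->; rewrite setU0.
have [hl _ _] := il; have [hm _ _] := im.
have cK : family_on_chains R K.
  move=> s Ks; split; last by have [? [? []]] := KFG _ Ks.
  exact: (sqcup_finitary (R := R) (fin cF) (fin cG) (KFG _ Ks)).
have K1 : chains_le R 1 `<=` K by exact: subset_trans FK.
have sub X : sqcup R E E' `<=` X -> K `<=` X.
  move=> EX s /KFG[u [v [Fu Gv -> c]]]; apply: EX.
  by exists u, v; split=> //; [exact: FE|exact: GE].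
have [ml|lm] := olt_total m l.
  have [X DX EX] := cs_sqcup sysD hl DE (cs_mono sysD hm hl (oltW ml) DE').
  have [|_ []//] := system_basisI il a1 DX (sub _ EX) hK K1.
  exact: (rank_ge_mono hF (fin cF) hK (fin cK) FK Fge).
have [X DX EX] := cs_sqcup sysD hm (cs_mono sysD hl hm lm DE) DE'.
have [|_ []//] := system_basisI im b1 DX (sub _ EX) hK K1.
exact: (rank_ge_mono hG (fin cG) hK (fin cK) GK Gge).
Qed.

Lemma system_mult F H : B F -> uniform_families H ->
  exists G, B G /\ is_multiplication R F H G.
Proof.
move=> BF UH; have [c [lc [sc ic]]] := exH UH; have [[cF hF F0] HF] := BP BF.
(* The degenerate products, where [F] contains only the empty set or [H] has small rank zero: all
   unions in question are empty, and the family of the empty set alone is a multiplication. *)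
have trivial b : is_srk R F b -> ole (omul b c) ozero ->
    (forall s : nat -> set P, (forall n, F (s n)) -> forall x, H x ->
      \bigcup_(n in x) s n = set0) ->
    exists G, B G /\ is_multiplication R F H G.
  move=> sb bc0 s0; exists [set set0]; split.
    split; first exact: homogeneous_set0.
    exists ozero, oomega, (chains_le R 0); split.
    - exact: is_srk_set0.
    - exact: (is_iota_nat 0).
    - exact: (cs_chains sysD 0 exp_indecomposable_omega).
    - by rewrite chains_le0.
  split; first exact: homogeneous_set0.
    exists ozero, b, c; split=> //; first exact: is_srk_set0.
    exists oomega; split; first exact: (is_iota_nat 0).
    by apply: is_iota_eq (is_iota_nat 0) _ bc0; exact: ozero_ole.
  by move=> s Fs _; exists id; split=> // x Hx; rewrite s0.
case: HF => [FE|[b [l [E [[sb b1 il DE FE] [Fl F1 Fge]]]]]].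
  apply: (trivial ozero); first by rewrite FE; exact: is_srk_set0.
    elim: c {sc ic trivial} => J g IH; apply/omul_osup_ole => j.
    exact: ole_trans (oadd0 _) (IH j).
  move=> s; rewrite FE => s0 x _; apply/seteqP; split=> // y [n _].
  by rewrite s0.
have [c0|c1] := olt_total ozero c; last first.
  apply: trivial sb _ _; first exact: ole_trans (omul_ler _ c1) (omul0 _).
  move=> s _ x /(uniform_size UH sc (k := 0) c1); rewrite II0 card_le0 => /eqP ->.
  by rewrite bigcup_set0.
have {}c1 : ole oone c by exact/ole_succ.
have [k [ik lk lck]] := is_iota_mul il ic b1 c1.
have [hk bck _] := ik; have [hl _ _] := il.
have bc1 : ole oone (omul b c).
  by apply: ole_trans b1 _; apply: omul_gel; exact/ole_succ.
have ck : olt c k by apply: olt_ole_trans lck; case: ic.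
have [E' DE' mE] := cs_mult sysD hk (cs_mono sysD hl hk lk DE) UH sc ck.
have [G [DG EG G1 Gge]] := system_enlarge ik bc1 DE'.
have [_ hG _ _] := cs_fam sysD hk DG.
have [g [sg bcg ig BG]] := system_basisI ik bc1 DG (fun s h => h) hG G1 Gge.
exists G; split=> //; split; first by case: BG.
  by exists g, b, c; split=> //; exists k.
move=> s Fs cs; have [|phi [phim phiE]] := mE s _ cs; first by move=> n; exact: FE.
by exists phi; split=> // x /phiE/EG.
Qed.

Lemma basis_of_system : has_basis_on_chains R.
Proof.
(* The value [F] is a default for pairs without a multiplication; by [system_mult] no pair from [B]
   and [uniform_families] is of this kind. *)
pose times F H := if pselect (exists G, B G /\ is_multiplication R F H G) is left h
  then projT1 (cid h) else F.
exists B, times; split.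
- split=> [F []//|n|a wa ca].
    case: n => [|n].
      rewrite chains_le0; split; first exact: homogeneous_set0.
      exists ozero, oomega, (chains_le R 0); split; last by rewrite chains_le0.
      + exact: is_srk_set0.
      + exact: (is_iota_nat 0).
      + exact: (cs_chains sysD 0 exp_indecomposable_omega).
    have [|_ []//] := system_basisI (is_iota_nat n.+1) _
      (cs_chains sysD n.+1 exp_indecomposable_omega) (fun s h => h)
      (@chains_le_hereditary _ R n.+1) (@chains_le_mono _ R 1 n.+1 isT)
      (@chains_le_rank_ge _ R ^~ n.+1).
    exact: (@onat_ole 1 n.+1).
  have [l il] := exI wa ca; have [hl _ _] := il.
  have a1 : ole oone a by apply: ole_trans wa; exact: oltW (onat_omega 1).
  have [G [DG _ G1 Gge]] := system_enlarge il a1 (cs_chains sysD 0 hl).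
  have [cG hG _ _] := cs_fam sysD hl DG.
  (* The family [G] has rank at least [a] on every infinite chain, whereas (B.1) prescribes the
     small rank exactly. *)
  have [F [FG hF F1 Fge sF]] := srk_cut cG hG G1 Gge a1 ca exC.
  exists F => //; have [_ []//] := system_basisI il a1 DG FG hF F1 Fge.
- split=> [F G BF BG|F G BF BG|F G FG BG hoF [a [b [sa sb [l [ial ibl]]]]]].
  + have [[cF hF F0] _] := BP BF; have [[cG hG G0] _] := BP BG.
    apply: (system_basis_join BF BG); [|by left|by right|].
      by move=> s t [Fs|Gs] ts; [left; exact: hF ts|right; exact: hG ts].
    by move=> s []; [exact: sqcup_ge|exact: sqcup_ger].
  + have [[cF hF F0] _] := BP BF; have [[cG hG G0] _] := BP BG.
    apply: (system_basis_join BF BG) => //;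
      [exact: sqcup_hereditary|exact: sqcup_ge|exact: sqcup_ger].
  + case: BG => _ [b' [l' [E [sb' ib' DE GE]]]].
    split=> //; exists a, l', E; split=> //; last exact: subset_trans GE.
    have {}ib' := is_iota_eq ib' (is_srk_uniq sb' sb) (is_srk_uniq sb sb').
    case: ial ibl ib' => hl al minl [_ bl minl1] [hl' bl' minl'].
    have ll' := minl1 _ hl' bl'; have l'l := minl' _ hl bl.
    split=> //; first exact: olt_ole_trans al ll'.
    by move=> m hm am; apply: ole_trans l'l _; exact: minl.
- move=> F H BF UH; rewrite /times.
  case: pselect => [h|[]]; last exact: system_mult.
  exact: projT2 (cid h).
Qed.

End Basis.

End System.

(** * From bases to systems *)

Section SystemOfBasis.
Variables (P : Type) (R : P -> P -> Prop).
Implicit Types (E F G : set_family P).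

Let fin E : family_on_chains R E -> finitary E := @on_chains_finitary _ R E.

Lemma is_iota_le a b l m : is_iota a l -> is_iota b m -> ole a b -> ole l m.
Proof. by move=> [_ _ min] [hm bm _] ab; apply: min => //; exact: ole_olt_trans bm. Qed.

Lemma homogeneous_rank F a l : homogeneous R F -> is_srk R F a -> is_iota a l ->
  ~ CB F l set0.
Proof.
move=> /homogeneousP[[cF hF F0]] [->|[b [m [sb b1 im Fm _]]]] sa il.
  have [_ _] := set0_family R; apply; case: il => hl _ _.
  exact: oltW (expi_nat hl 1).
have ml := is_iota_le im il (is_srk_uniq sb sa).
by move=> /(CB_anti hF (fin cF) ml).
Qed.

(** By (B.1) there is a homogeneous family of small rank [a], and homogeneity asserts the existence
    of [iota(a)], except for the family of the empty set, whose small rank is too small. *)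
Lemma basis_iota a : has_basis_on_chains R -> ole oomega a -> ocountable a ->
  exists l, is_iota a l.
Proof.
move=> [B [times [[hom _ large] _ _]]] wa ca; have [F BF sa] := large a wa ca.
have [[cF hF F0] [FE|[b [l [sb _ il _ _]]]]] := homogeneousP (hom F BF).
  have [_ _ r0] := set0_family R.
  have /is_srk_lt := sa; move=> /(_ oone hF (fin cF)); rewrite FE.
  move=> /(_ (r0 _ (ole_refl _))) a1; exfalso; apply: (oltNge a1).
  by apply: ole_trans wa; exact: oltW (onat_omega 1).
by exists l; apply: is_iota_eq il _ _; [exact: is_srk_uniq sb sa|exact: is_srk_uniq sa sb].
Qed.

(** Multiply the chains of size at most one by [H]. Their small rank [b] satisfies [1 <= b < 2], so
    (M.1) supplies a small rank [c] of [H] together with the [iota] of [b * c], which is also that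
    of [c]. *)
Lemma basis_uniform H : has_basis_on_chains R -> uniform_families H ->
  exists c l, is_srk nat_lt H c /\ is_iota c l.
Proof.
move=> [B [times [[hom chains _] _ mult]]] UH.
have [_ [_ [a [b [c [_ sb sc [l [_ il]]]]]] _]] := mult _ H (chains 1) UH.
have h := @chains_le_hereditary _ R 1; have f := fin (@chains_le_on_chains _ R 1).
have b1 : ole oone b.
  by apply: (is_srk_le h f _ sb) => M iM; exact: (chains_le_rank_ge 1 iM).
have b2 : olt b (onat 2) by exact: (is_srk_lt h f (@chains_le_rank _ R 1) sb).
exists c, l; split=> //; case: il => hl bcl min; split=> //.
  by apply: ole_olt_trans bcl; apply: omul_ge; exact/ole_succ.
move=> m hm cm; apply: min => //; apply: expi_mul => //.
exact: olt_trans b2 (expi_nat hm 2).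
Qed.

(** A basis member is put on every level above its rank. A level is closed under [sqcup] by the
    estimate [CB_sqcup], and under multiplication because [b * c < l] forces [iota(b * c) <= l]. *)
Lemma system_of_basis : has_basis_on_chains R -> exists D, chain_system R D.
Proof.
move=> [B [times [[hom chains large] [_ join _] mult]]].
exists (fun l E => B E /\ ~ CB E l set0); split.
- by move=> l E hl [BE El]; have [[cE hE E0] _] := homogeneousP (hom E BE).
- move=> l m E hl hm lm [BE El]; split=> //.
  have [[cE hE E0] _] := homogeneousP (hom E BE).
  by move=> /(CB_anti hE (fin cE) lm).
- move=> l n hl; split; first exact: chains.
  move=> Cl; apply: (@chains_le_rank _ R n).
  apply: CB_anti (oltW (expi_nat hl n.+1)) _ Cl; first exact: chains_le_hereditary.
  exact/fin/chains_le_on_chains.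
- move=> l E F hl [BE El] [BF Fl]; exists (sqcup R E F) => //; split; first exact: join.
  have [[cE hE E0] _] := homogeneousP (hom E BE).
  have [[cF hF F0] _] := homogeneousP (hom F BF).
  have [a [al _ Ea]] := CB_exact hE (fin cE) E0 El.
  have [b [bl _ Fb]] := CB_exact hF (fin cF) F0 Fl.
  move=> /(CB_sqcup hE (fin cE) hF (fin cF) Ea Fb) lt; apply: (oltNge lt); apply: oltW.
  by do ?[apply: expi_mul => //|apply: expi_succ => //].
- move=> l E H c hl [BE El] UH sc cl.
  have [BG [hG [a [b [c' [sa sb sc' [k [ia ibc]]]]]] m]] := mult _ _ BE UH.
  exists (times E H) => //; split=> //.
  have [[cE hE E0] _] := homogeneousP (hom E BE).
  have [[cG hoG G0] _] := homogeneousP hG.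
  have bl : olt b l by exact: (is_srk_lt hE (fin cE) El sb).
  have c'l : olt c' l := ole_olt_trans (is_srk_uniq sc' sc) cl.
  have kl : ole k l by case: ibc => _ _; apply=> //; exact: expi_mul.
  by move=> /(CB_anti hoG (fin cG) kl); exact: (homogeneous_rank hG sa ia).
- move=> l a il wa; have [hl al _] := il.
  have [|F BF sa] := large a wa; first by case: hl => cl _ _; exact: ocountable_le cl (oltW al).
  have [[cF hF F0] _] := homogeneousP (hom F BF).
  have Fl := homogeneous_rank (hom F BF) sa il.
  by exists F => //; exact: is_srk_rank_ge hF (fin cF) F0 Fl sa.
Qed.

(** Lets an order without infinite chains enter the construction on the tree like any other. Lower
    bounds on ranks hold vacuously; a sequence whose union is a chain lives in a finite set, so it
    has a constant subsequence. *)
Lemma finite_chains_system : ~ (exists C, infinite_chain R C) ->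
  chain_system R (fun l E => exists n, E = chains_le R n).
Proof.
move=> nC; split.
- move=> l _ hl [n ->]; split; [exact: chains_le_on_chains|
    exact: chains_le_hereditary|exact: chains_le_set0|].
  move=> Cl; apply: (@chains_le_rank _ R n).
  apply: CB_anti (oltW (expi_nat hl n.+1)) _ Cl; first exact: chains_le_hereditary.
  exact/fin/chains_le_on_chains.
- by [].
- by move=> l n _; exists n.
- move=> l _ _ hl [m ->] [n ->]; exists (chains_le R (m + n)); first by exists (m + n).
  by move=> _ [s [t [[sm _] [tn _] -> c]]]; split=> //; exact: card_le_U.
- move=> l _ H c hl [n ->] UH _ _; exists (chains_le R n); first by exists n.
  move=> s sn cs.
  have fs : finite_set (\bigcup_n s n) by apply: contrapT => iS; apply: nC; exists (\bigcup_n s n).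
  have [|v _ iv] := infinite_pigeon infinite_nat (finite_subsets fs) (s := s).
    by move=> i _ x sx; exists i.
  have [phi [phim phiv]] := infinite_subsequence iv.
  exists phi; split=> // x _; apply: (@chains_le_hereditary _ R n v).
    by rewrite -(phiv 0).2; exact: sn.
  by move=> y [i _]; rewrite (phiv i).2.
- move=> l a _ _; exists (chains_le R 0); first by exists 0.
  by move=> M iM; case: nC; exists M.
Qed.

Lemma system_of_basis_opt :
  ((exists C, infinite_chain R C) -> has_basis_on_chains R) ->
  exists D, chain_system R D.
Proof.
have [exC /(_ exC)|nC _] := pselect (exists C, infinite_chain R C).
  exact: system_of_basis.
by eexists; exact: finite_chains_system.
Qed.

(** All subsets of an infinite chain [M] are chains, so discarding the sets that are not chains
    leaves the trace on [M], and with it the lower bound on its rank, intact. *)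
Lemma system_restrict D : chain_system (fun x y : P => x <> y) D ->
  chain_system R (fun l E => exists2 F, D l F & E = [set s | F s /\ is_chain R s]).
Proof.
set N := (fun x y => _) => sysD.
have cN (C : set P) : is_chain N C.
  by move=> x y _ _; have [|xy] := pselect (x = y); [exact: Or31|exact: Or32].
have hR F : hereditary F -> hereditary [set s | F s /\ is_chain R s].
  by move=> hF s t [Fs cs] ts; split; [exact: hF ts|exact: is_chain_sub ts cs].
have fR F : finitary F -> finitary [set s | F s /\ is_chain R s] by move=> fF s [/fF].
have sR F : [set s | F s /\ is_chain R s] `<=` F by move=> s [].
have finN F : family_on_chains N F -> finitary F := @on_chains_finitary _ N F.
split.
- move=> l _ hl [F DF ->]; have [cF hF F0 Fl] := cs_fam sysD hl DF.
  split; [by move=> s [/cF[]]|exact: hR| |].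
  + by split=> //; exact: is_chain0.
  + by move=> /(CB_mono (hR _ hF) (fR _ (finN _ cF)) hF (finN _ cF) (@sR F)).
- by move=> l m _ hl hm lm [F DF ->]; exists F => //; exact: (cs_mono sysD hl hm lm DF).
- move=> l n hl; exists (chains_le N n); first exact: cs_chains.
  by apply/seteqP; split=> [s [sn cs]|s [[sn _] cs]].
- move=> l _ _ hl [F DF ->] [G DG ->]; have [X DX FGX] := cs_sqcup sysD hl DF DG.
  eexists; first by exists X.
  by move=> _ [s [t [[Fs _] [Gt _] -> c]]]; split=> //; apply: FGX; exists s, t.
- move=> l _ H c hl [F DF ->] UH sc cl; have [G DG mG] := cs_mult sysD hl DF UH sc cl.
  eexists; first by exists G.
  move=> s Fs cs; have [|phi [phim phiG]] := mG s _ (cN _); first by move=> n; have [] := Fs n.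
  exists phi; split=> // x Hx; split; first exact: phiG.
  by apply: is_chain_sub cs => y [n _ sy]; exists (phi n).
- move=> l a il wa; have [F DF Fge] := cs_large sysD il wa; have [hl _ _] := il.
  have [cF hF F0 Fl] := cs_fam sysD hl DF; have fF := finN _ cF.
  eexists; first by exists F.
  move=> M [iM cM]; have := Fge M (conj iM (cN M)).
  apply: CB_mono; do ?[exact: fam_restrict_hereditary|exact: fam_restrict_finitary].
  + by apply: fam_restrict_hereditary; exact: hR.
  + by apply: fam_restrict_finitary; exact: fR.
  + by move=> s [Fs sM]; split=> //; split=> //; exact: is_chain_sub sM cM.
Qed.

End SystemOfBasis.

Lemma basis_on_chains_of_all (P : Type) (R : P -> P -> Prop) :
  (exists C, infinite_chain R C) ->
  has_basis_on_chains (fun x y : P => x <> y) -> has_basis_on_chains R.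
Proof.
move=> exC bN; have [D sysD] := system_of_basis bN.
apply: (basis_of_system (system_restrict R sysD) exC).
- by move=> a wa ca; exact: (basis_iota bN).
- by move=> H UH; exact: (basis_uniform bN).
Qed.

Lemma is_basis_eq_chains (P : Type) (R S : P -> P -> Prop) B times :
  is_chain R = is_chain S -> is_basis R B times -> is_basis S B times.
Proof.
by rewrite /is_basis /is_multiplication /sqcup /homogeneous /homogeneous_at
  /is_srk /infinite_chain /family_on_chains /chains_le => ->.
Qed.

(* Every set is a chain for [x <> y], as for a total order. *)
Lemma has_basis_on_setP (P : Type) :
  has_basis_on_set P <-> has_basis_on_chains (fun x y : P => x <> y).
Proof.
have eN (R : P -> P -> Prop) : strict_total_order_on [set: P] R ->
    is_chain R = is_chain (fun x y : P => x <> y).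
  move=> [_ _ total]; apply/funext => C; apply/propext; split=> _ x y _ _.
    by have [|xy] := pselect (x = y); [exact: Or31|exact: Or32].
  exact: total.
split=> [[B [times basis]]|[B [times basis]]]; last first.
  by exists B, times => R totR; apply: is_basis_eq_chains basis; rewrite (eN R).
have [R wR] := well_ordering_principle {classic P}.
have woR : wo_chain R predT by move=> A _; exact: wR.
have total : total R by move=> x y; exact: (wo_chainW woR).
have anti : antisymmetric R by move=> x y; exact: (wo_chain_antisymmetric woR).
have trans : transitive R.
  move=> y x z Rxy Ryz; have [|m [[+ lb] _]] := wR [pred u | u \in [:: x; y; z]].
    by exists x; rewrite !inE eqxx.
  have [Rmx Rmy Rmz] : [/\ R m x, R m y & R m z].
    by split; apply: lb; rewrite !inE eqxx ?orbT.
  rewrite inE /= !inE => /or3P[] /eqP e; subst m => //.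
    by rewrite (anti x y) ?Rxy ?Rmx.
  by rewrite -(anti y z) ?Ryz.
exists B, times; pose S (x y : P) := x <> y /\ R x y.
have totS : strict_total_order_on [set: P] S.
  split=> [x _ [//]|x y z _ _ _ [xy Rxy] [yz Ryz]|x y _ _].
  - split; last exact: trans Rxy Ryz.
    by move=> xz; apply: xy; apply: anti; rewrite Rxy xz Ryz.
  - have [->|xy] := pselect (x = y); first exact: Or31.
    by have /orP[Rxy|Ryx] := total x y; [apply: Or32|apply: Or33]; split=> // /esym.
by apply: is_basis_eq_chains (basis S totS); exact: eN.
Qed.

(** * Trees *)

Section Tree.
Variables (d : Order.disp_t) (T : bMeetSemilatticeType d).
Hypothesis T_tree : is_tree T.
Local Notation meet := (@Order.meet d T).
Local Open Scope order_scope.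
Implicit Types (x y z t u v : T).

Lemma tree_total a b y : a <= y -> b <= y -> (a <= b) || (b <= a).
Proof.
rewrite !le_eqVlt => /orP[/eqP ->|ay] /orP[/eqP ->|by_].
- by rewrite eqxx.
- by rewrite by_ !orbT.
- by rewrite ay orbT.
- by rewrite -!le_eqVlt; have := @wo_chainW _ _ _ (@T_tree y) a b; rewrite !inE; apply.
Qed.

Lemma tree_min (A : set T) y : A !=set0 -> A `<=` [set x | x <= y] ->
  exists2 m, A m & forall x, A x -> m <= x.
Proof.
move=> [a Aa] Ay; have [[b [Ab byy]]|nb] := pselect (exists b, A b /\ b < y); last first.
  have E x : A x -> x = y.
    move=> Ax; have := Ay x Ax; rewrite /= le_eqVlt => /orP[/eqP //|xy].
    by case: nb; exists x.
  by exists a => // x /E ->; rewrite (E a Aa).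
have [||m [[mA lb] _]] := @T_tree y [pred u | (u < y) && `[< A u >]].
- by move=> u; rewrite !inE => /andP[].
- by exists b; rewrite inE byy; exact/asboolP.
move: mA; rewrite inE => /andP[my /asboolP Am]; exists m => // x Ax.
have := Ay x Ax; rewrite /= le_eqVlt => /orP[/eqP ->|xy]; first exact: ltW.
by apply: lb; rewrite inE xy; exact/asboolP.
Qed.

(** The nodes below [q] are linearly ordered, and [y] has left this branch before [r]; prolonging
    the branch from [r] to [q] does not move the meet. *)
Lemma meet_trunc r q y : r <= q -> ~ r <= y -> meet y q = meet y r.
Proof.
move=> rq ry; apply/le_anti/andP; split; last by rewrite leI2.
rewrite lexI leIl /=.
have /orP[//|] := tree_total (leIr q y) rq.
by rewrite lexI => /andP[/ry].
Qed.

Lemma meet_trunc_lt r y : ~ r <= y -> meet y r < r.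
Proof.
move=> ry; rewrite lt_neqAle leIr andbT; apply/eqP => e; apply: ry.
by rewrite -e leIl.
Qed.

Lemma imm_succ_exists t y : t < y -> exists v, imm_succ t v /\ v <= y.
Proof.
move=> ty; have [||v [/= tv vy] vmin] := @tree_min [set v | t < v /\ v <= y] y.
- by exists y; split.
- by move=> v [].
exists v; split=> //; split=> // w [tw wv].
have vw : v <= w by apply: vmin; split=> //; exact: le_trans (ltW wv) vy.
by have := le_lt_trans vw wv; rewrite ltxx.
Qed.

(* The immediate successor of [t] below [y], for [t < y]; a junk value otherwise. *)
Definition Is t y : T :=
  if pselect (exists v, imm_succ t v /\ v <= y) is left h then projT1 (cid h) else y.

Lemma IsP t y : t < y -> imm_succ t (Is t y) /\ Is t y <= y.
Proof.
move=> ty; rewrite /Is; case: pselect => [h|[]]; first exact: projT2 (cid h).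
exact: imm_succ_exists.
Qed.

Lemma Is_gt t y : t < y -> t < Is t y.
Proof. by move=> /IsP[[]]. Qed.

Lemma Is_ley t y : t < y -> Is t y <= y.
Proof. by move=> /IsP[]. Qed.

Lemma Is_le t z y : t < z -> z <= y -> Is t y <= z.
Proof.
move=> tz zy; have ty := lt_le_trans tz zy; have [[tv vmin] vy] := IsP ty.
have /orP[//|zv] := tree_total vy zy.
move: zv; rewrite le_eqVlt => /orP[/eqP -> //|zv].
by case: (vmin z).
Qed.

Lemma Is_eq t z y : t < z -> z <= y -> Is t z = Is t y.
Proof.
move=> tz zy; apply/le_anti; apply/andP; split; last first.
  by apply: Is_le; [exact: Is_gt|exact: le_trans (Is_ley tz) zy].
have ty := lt_le_trans tz zy.
by apply: Is_le; [exact: Is_gt|exact: Is_le].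
Qed.

Lemma Is_meet t x y : t < x -> t < y -> Is t x = Is t y <-> t < meet x y.
Proof.
move=> tx ty; split=> [e|txy]; last by rewrite -(Is_eq txy (leIl _ _)) -(Is_eq txy (leIr _ _)).
by apply: lt_le_trans (Is_gt tx) _; rewrite lexI Is_ley// e Is_ley.
Qed.

Lemma Is_neq_meet t x y : t < x -> t < y -> Is t x <> Is t y -> meet x y = t.
Proof.
move=> tx ty ne; apply/esym/eqP; rewrite eq_le lexI (ltW tx) (ltW ty) /=.
have /orP[//|] := tree_total (leIl x y) (ltW tx).
rewrite (le_eqVlt t) => /predU1P[<-|txy]; first exact: lexx.
by case: ne; exact: (Is_meet tx ty).2.
Qed.

Lemma Is_imm t v : imm_succ t v -> Is t v = v.
Proof.
move=> [tv vmin]; have [[tw _] wv] := IsP tv.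
by move: wv; rewrite le_eqVlt => /orP[/eqP //|wv]; case: (vmin (Is t v)).
Qed.

Definition fan t (x : nat -> T) :=
  (forall n, t < x n) /\ forall m n, (m < n)%N -> Is t (x m) <> Is t (x n).

Definition comb (r x : nat -> T) :=
  [/\ forall m n, (m < n)%N -> r m < r n, forall n, r n <= x n &
      forall m n, (m < n)%N -> meet (x m) (r n) = r m].

(* If the set of nodes lying below infinitely many [x n] has a maximal element  *)
(* we find a constant sequence or a fan there; otherwise Zorn's lemma gives in  *)
(* it an unbounded chain, along which a comb is found. *)
Lemma tree_subsequence (x : nat -> T) : exists phi : nat -> nat,
  {homo phi : m n / (m < n)%N} /\
  [\/ exists q, forall n, x (phi n) = q, exists t, fan t (x \o phi) |
      exists r, comb r (x \o phi)].
Proof.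
pose Z := [set z | infinite_set [set n | z <= x n]].
have [[z [Zz zmax]]|nmax] := pselect (exists z, Z z /\ forall y, Z y -> ~ z < y).
  have [izx|fzx] := pselect (infinite_set [set n | x n = z]).
    have [phi [phim phiz]] := infinite_subsequence izx.
    by exists phi; split=> //; apply: Or31; exists z.
  have iS : infinite_set [set n | z < x n].
    apply: infinite_sub (infinite_diff Zz (contrapT fzx)) => n [/= zn /eqP nz].
    by rewrite lt_neqAle eq_sym nz.
  have [l lS|phi [phim phiS phiQ]] := @greedy_subsequence [set n | z < x n]
      (fun m n => Is z (x m) <> Is z (x n)).
    (* By maximality of [z], an immediate successor of [z] lies below only finitely many [x n], so
       finitely many directions exclude finitely many indices. *)
    have fl : finite_set (\bigcup_(m in [set` l]) [set n | z < x n /\ Is z (x m) = Is z (x n)]).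
      apply: bigcup_finite; first exact: finite_seq.
      move=> m /lS /= zm; apply: contrapT => inf; apply: (zmax (Is z (x m))); last exact: Is_gt.
      by apply: infinite_sub inf => n [zn ->]; exact: Is_ley.
    apply: infinite_sub (infinite_diff iS fl) => n [zn nl]; split=> // m ml e.
    by apply: nl; exists m.
  by exists phi; split=> //; apply: Or32; exists z; split.
have [C [cC CZ nub]] : exists C : set T, [/\ forall y z, C y -> C z -> (y <= z) || (z <= y),
    C `<=` Z & forall u, Z u -> exists2 z, C z & ~ z <= u].
  apply: contrapT => nC.
  have [||C CZ woC|z Zz zmax] := @Zorn's_lemma T <=%O [pred z | `[< Z z >]].
  - by move=> z _; exact: lexx.
  - by apply: in3W; exact: le_trans.
  - have CZ' y : y \in C -> Z y by move=> yC; have /asboolP := CZ y yC.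
    apply: contrapT => nub; apply: nC; exists [set z | z \in C]; split=> [y z|//|u Zu].
      exact: (wo_chainW woC).
    apply: contrapT => h; apply: nub; exists u; first exact/asboolP.
    by move=> z zC; apply: contrapT => zu; apply: h; exists z.
  - have {}Zz : Z z by exact/asboolP.
    apply: nmax; exists z; split=> // y Zy zy.
    have yz : y <= z by apply: zmax; [exact/asboolP|exact: ltW].
    by have := lt_le_trans zy yz; rewrite ltxx.
(* Otherwise the least upper bound of [C] below one such point [x n0] would lie below infinitely
   many [x n], hence belong to [Z] and bound [C]. *)
have fC : finite_set [set n | forall z, C z -> z <= x n].
  apply: contrapT => inf; have [n0 n0C] := infinite_setN0 inf.
  have [||u [/= uC ux] umin] := @tree_min [set u | (forall z, C z -> z <= u) /\ u <= x n0] (x n0).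
  - by exists (x n0).
  - by move=> u [].
  have [|z Cz] := nub u; last by apply; exact: uC.
  apply: infinite_sub inf => n nC; apply: le_trans (leIr (x n) (x n0)).
  by apply: umin; split; [move=> z Cz; rewrite lexI n0C ?nC|exact: leIl].
have Zbot : Z \bot.
  by apply: (infinite_sub _ infinite_nat) => n _; exact: le0x.
(* Each index [n] is paired with a node of [C] not below [x n], a witness that [x n] has left the
   chain before it; all later points lie above this node. The branching points of the comb are the
   meets of [x n] with its witness. *)
have [l lS|f [fS fQ]] := @greedy_sequence (nat * T)%type
    (fun p => C p.2 /\ ~ p.2 <= x p.1)
    (fun p q => [/\ (p.1 < q.1)%N, p.2 <= x q.1 & p.2 <= q.2]).
  have [z [Cz zl]] : exists z, C z /\ forall p, p \in l -> p.2 <= z.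
    elim: l lS => [_|p l IH lS]; first by have [c Cc _] := nub _ Zbot; exists c.
    have [q ql|z [Cz zl]] := IH; first by apply: lS; rewrite inE ql orbT.
    have [Cp _] := lS p (mem_head _ _).
    have /orP[zp|pz] := cC _ _ Cz Cp; [exists p.2|exists z]; split=> // q.
      by rewrite inE => /orP[/eqP ->//|/zl qz]; exact: le_trans zp.
    by rewrite inE => /orP[/eqP ->|/zl].
  pose N := (\max_(i <- map fst (l : seq (nat * T))) i).+1.
  have fbad : finite_set ([set n | forall z, C z -> z <= x n] `|` `I_N).
    by rewrite finite_setU; split=> //; exact: finite_II.
  have [n [zn /not_orP[nC nN]]] := infinite_pick (CZ _ Cz) fbad.
  have [z' /not_implyP[Cz' z'n]] : exists z', ~ (C z' -> z' <= x n) by apply/existsNP.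
  exists (n, z'); split=> // p pl /=.
  have pz := zl p pl; split; last 2 first.
  - exact: le_trans zn.
  - have Cp := (lS p pl).1.
    have /orP[//|z'p] := cC _ _ Cp Cz'.
    by case: z'n; apply: le_trans zn; exact: le_trans pz.
  rewrite ltnNge; apply/negP => np; apply: nN; rewrite /= ltnS.
  apply: leq_trans np _; apply: (@leq_bigmax_seq _ _ xpredT id p.1) => //.
  by apply: (@map_f (nat * T)%type); rewrite mem_classic.
exists (fst \o f); split; first by move=> m n /fQ[].
apply: Or33; exists (fun n => meet (x (f n).1) (f n).2).
have key m n : (m < n)%N -> meet (x (f m).1) (f n).2 = meet (x (f m).1) (f m).2.
  by move=> /fQ[_ _ mn]; apply: meet_trunc => //; case: (fS m).
split=> [m n mn|n|m n mn /=]; last 2 first.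
- exact: leIl.
- have [_ mxn mn2] := fQ m n mn.
  have e : (f m).2 <= meet (x (f n).1) (f n).2 by rewrite lexI mxn.
  by rewrite (meet_trunc e)//; case: (fS m).
apply: lt_le_trans (meet_trunc_lt (fS m).2) _.
by have [_ mxn mn2] := fQ m n mn; rewrite lexI mxn.
Qed.

End Tree.

Lemma oexpM a b c : olt ozero a -> ole (oexp (oexp a b) c) (oexp a (omul b c)).
Proof.
move=> a0; elim: c => J g IH; apply/oexp_osup_ole; split; first exact: oexp_ge1.
move=> j; apply: ole_trans (omul_lel _ (IH j)) _.
apply: ole_trans (oexpD _ _ a0) _; apply: oexp_ler.
exact: omul_olt (@olt_osub (osup g) j).
Qed.

(** * Rank of the tree families *)

Section TreeFamily.
Variables (d : Order.disp_t) (T : bMeetSemilatticeType d).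
Hypothesis T_tree : is_tree T.
Local Notation meet := (@Order.meet d T).
Implicit Types (x y z t u v p q w : T).

Definition tree_family (A C : set_family T) : set_family T :=
  [set s | [/\ finite_set s, forall t, A (Is t @` (s `&` [set y | (t < y)%O])) &
    forall x, C (meet x @` s)]].

Lemma tree_family_hereditary A C : hereditary A -> hereditary C ->
  hereditary (tree_family A C).
Proof.
move=> hA hC s t [fs sA sC] ts; split=> [|u|x]; first exact: sub_finite_set fs.
  by apply: hA (sA u) _; apply: image_subset => y [/ts].
by apply: hC (sC x) _; exact: image_subset.
Qed.

Section TreeFamilyRank.
Variables (A C : set_family T) (l : Ord).
Hypotheses (hA : hereditary A) (fA : finitary A) (A0 : A set0) (rA : ~ CB A l set0).
Hypotheses (hC : hereditary C) (fC : finitary C) (C0 : C set0) (rC : ~ CB C l set0).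
Hypotheses (hl : exp_indecomposable l) (wl : olt oomega l).

(* The members of [tree_family A C] above [w], when the meets in [c] are already *)
(* present below them. *)
Let cone w (c : set T) : set_family T := [set s | [/\ finite_set s,
    forall y, s y -> (w <= y)%O,
    forall t, A (Is t @` (s `&` [set y | (t < y)%O])) &
    forall x, (w <= x)%O -> C (c `|` meet x @` s)]].

Let cone_hereditary w c : hereditary (cone w c).
Proof.
move=> s t [fs ws sA sC] ts; split=> [||u|x wx]; first exact: sub_finite_set fs.
- by move=> y /ts/ws.
- by apply: hA (sA u) _; apply: image_subset => y [/ts].
- apply: hC (sC x wx) _; apply: setUS; exact: image_subset.
Qed.

Let cone_finitary w c : finitary (cone w c). Proof. by move=> s []. Qed.

(* The pairs (m, v) of a new meet [m] on a fixed branch and an immediate         *)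
(* successor [v] of [m]; [v = m] encodes the node [m] itself. *)
Let spine (c : set T) : set_family (T * T) := [set e | [/\ finite_set e,
    C (c `|` fst @` e) & forall p, A [set v | e (p, v) /\ v <> p]]].

Let spine_hereditary c : hereditary (spine c).
Proof.
move=> e e' [fe eC eA] ee; split=> [||p]; first exact: sub_finite_set fe.
  by apply: hC eC _; apply: setUS; exact: image_subset.
by apply: hA (eA p) _ => v [/ee].
Qed.

Let spine_finitary c : finitary (spine c). Proof. by move=> e []. Qed.

Variables alA alC : Ord.
Hypotheses (nalA : ~ CB A (osucc alA) set0) (nalC : ~ CB C (osucc alC) set0).

(** The bound that [CB_fibered] gives for the projection of a spine to its first coordinates, with
    [U = osucc (osucc alA)] for the fibers, [V] the power of [U] to omega, and [alC] for the
    base. *)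
Let al := omul (oexp (osucc (osucc alA)) oomega) (osucc alC).

Let spine_rank c : finite_set c -> ~ CB (spine c) (osucc al) set0.
Proof.
move=> fc Qal.
pose Cc : set_family T := [set e | C (c `|` e)].
have hCc : hereditary Cc by move=> e e' Ce ee; apply: hC Ce _; exact: setUS.
have fCc : finitary Cc by move=> e /fC; apply: sub_finite_set => x; right.
have nCc : ~ CB Cc (osucc alC) (fst @` (set0 : set (T * T))).
  rewrite image_set0 => /(CB_transfer hCc fCc hC fC (m := setU c)) h; apply: nalC.
  apply: (CB_hereditary hC fC) (h _ _) _ => // e X Ce iX Xe iN; apply: (infinite_diff iX fc).
  apply: sub_finite_set iN => x [Xx cx]; have [ex _] := Xe x Xx.
  split; first by case.
  by exists x; split=> //; rewrite setUCA.
have := @CB_fibered _ _ (spine c) fst Cc (osucc (osucc alA)) (oexp (osucc (osucc alA)) oomega)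
  (@spine_hereditary c) (@spine_finitary c) hCc fCc.
have H1 s : spine c s -> Cc (fst @` s) by case.
have H2 n : ole (iter n (fun a : Ord => omul a (osucc (osucc alA))) oone) (oexp (osucc (osucc alA)) oomega).
  apply: ole_trans (omul_iter_oexp _ _) _; apply: oexp_ler; apply: oltW; exact: onat_omega.
move=> /(_ H1 H2) H3.
have H4 p : ~ CB (fam_restrict (spine c) [set i | i.1 = p]) (osucc (osucc alA)) set0.
  set F := fam_restrict _ _ => Fp; apply: nalA.
  have hF : hereditary F by apply: fam_restrict_hereditary; exact: spine_hereditary.
  have fF : finitary F by apply: fam_restrict_finitary; exact: spine_finitary.
  apply: CB_anti hA fA (oltW (osucc_gt _)) _ _.
  have := @CB_transfer _ _ F A (fun e => [set v | e (p, v) /\ v <> p]) hF fF hA fA _ _ _ _ Fp.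
  rewrite (_ : [set v | _] = set0); last by apply/seteqP; split=> v [].
  apply; first by move=> e [[_ _]].
  move=> e X Fe iX Xe iN; apply: iX.
  (* The pair [(p, p)] contributes no successor, but as a single exception it cannot exhaust an
     infinite [X]. *)
  have : finite_set ((pair p) @` ([set p] `|` [set y | ~ (e (p, y) /\ y <> p) /\
    exists i, X i /\ y |` [set v | e (p, v) /\ v <> p] `<=` [set v | (i |` e) (p, v) /\ v <> p]])).
    by apply: finite_image; rewrite finite_setU; split=> //; exact: finite_set1.
  apply: sub_finite_set => -[q v] Xv; have [ev [_ Fv]] := Xe _ Xv.
  have qp : q = p by apply: (Fv (q, v)); left.
  subst q; exists v => //; have [->|vp] := pselect (v = p); first by left.
  right; split; first by case.
  exists (p, v); split=> // u [->|[eu up]]; first by split=> //; left.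
  by split=> //; right.
have := H3 H4 alC set0 (osucc al) _ nCc Qal.
move=> h; have {}h := h (CB_sub Qal).
exact: olt_irr (olt_trans h (osucc_gt _)).
Qed.

(** [Om] exceeds the factor [osucc al], and [ka] is [omega + 1], so that
    [ka^de * omega + ka^de <= ka^(de + 1)]. Hence one application of [CB_fibered] over a spine, with
    fibers bounded by [Om^(ka^de)], stays below [Om^(ka^(de + 1))]. *)
Let Om := osucc (osucc al).
Let ka := osucc oomega.

Let Om0 : olt ozero Om. Proof. by apply/olt_succ; exact: ozero_ole. Qed.

Let bound_step de : olt (omul (oexp Om (omul (oexp ka de) oomega)) (osucc al))
  (oexp Om (oexp ka (osucc de))).
Proof.
set eta := oexp ka de.
apply: (@olt_ole_trans (omul (oexp Om (omul eta oomega)) Om)).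
  by apply: omul_ltr; [exact: oexp_gt0|exact: osucc_gt].
apply: (@ole_trans (omul (oexp Om (omul eta oomega)) (oexp Om eta))).
  apply: omul_ler; apply: ole_trans (oexp1_ge Om) _; apply: oexp_ler; exact: oexp_ge1.
apply: ole_trans (oexpD _ _ Om0) _; apply: oexp_ler.
apply: ole_trans (omul_olt eta (osucc_gt oomega)) _.
exact: oexp_olt (osucc_gt de).
Qed.

(* [ro] bounds the rank of [c] in [C], and [z] lists the nodes that do not lower  *)
(* that bound when they are added to [c]. *)
Let cone_rank de w (c : set T) ro (z : seq T) :
  ole (oadd (omul oomega ro) (onat (size z))) de -> C c -> ~ CB C (osucc ro) c ->
  (forall x, ~ c x -> CB C ro (x |` c) -> x \in z) ->
  (forall y, c y -> ~ (w <= y)%O) ->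
  forall b, CB (cone w c) b set0 -> olt b (oexp Om (oexp ka (osucc de))).
Proof.
elim/olt_ind: de w c ro z => de IH w c ro z zde Cc nro cz cw b Cb.
apply: ole_olt_trans (bound_step de).
case: b Cb => J g /(CB_osupP _ _ (@cone_hereditary w c) (@cone_finitary w c))[_ inf].
(* One point [y0] is fixed at the price of one derivative; the other points are sorted along its
   branch. *)
apply/ole_osup => j; have [y0 [_ Cy0]] := infinite_setN0 (inf j).
have wy0 : (w <= y0)%O by have [_ ws _ _] := CB_sub Cy0; apply: ws; left.
have {}Cy0 := CB_link (@cone_hereditary w c) (@cone_finitary w c) Cy0.
set L := [set t | _] in Cy0.
have hL : hereditary L.
  by move=> s t Ls ts; apply: cone_hereditary Ls _; exact: setUS.
have fL : finitary L by move=> s /cone_finitary; apply: sub_finite_set => y; right.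
pose f y := let p := meet y y0 in (p, if (p < y)%O then Is p y else p).
have fc := fC Cc.
have LQ s : L s -> spine c (f @` s).
  move=> Ls; have [_ _ sA sC] := Ls; split; first by apply: finite_image; exact: fL.
    apply: hC (sC y0 wy0) _; apply: setUS => _ [_ [y sy <-] <-] /=.
    by exists y; [right|rewrite meetC].
  move=> p; apply: hA (sA p) _ => v [[y sy [<-]]].
  case: ifP => [py <- _|_ <-//].
  by exists y => //; split=> //; right.
have pwV n : ole (iter n (fun a : Ord => omul a (oexp Om (oexp ka de))) oone)
    (oexp Om (omul (oexp ka de) oomega)).
  apply: ole_trans (omul_iter_oexp _ _) _; apply: ole_trans (oexpM _ _ Om0) _.
  by apply: oexp_ler; apply: omul_ler; apply: oltW; exact: onat_omega.
apply: (@CB_fibered _ _ L f (spine c) (oexp Om (oexp ka de))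
  (oexp Om (omul (oexp ka de) oomega)) hL fL (@spine_hereditary c) (@spine_finitary c)
  LQ pwV _ al set0 (g j) (CB_sub Cy0)) => //; last by rewrite image_set0; exact: spine_rank.
move=> [p v]; set F := fam_restrict _ _ => FU.
have hF : hereditary F by exact: fam_restrict_hereditary.
have fF : finitary F by exact: fam_restrict_finitary.
(* Apart from [p] itself every point of the fiber lies strictly above [p]; a fiber of positive rank
   contains such a point, so [v] is a genuine successor. *)
have [y [[_ Fy] yp]] : exists y, ext (CB F ozero) set0 y /\ ~ [set p] y.
  apply: infinite_pick (finite_set1 p).
  have /(CB_succP _ _ hF fF)[] // : CB F (osucc ozero) set0.
  by apply: CB_anti hF fF _ _ FU; exact: oexp_ge1.
have [Ly /(_ y) fy] := CB_sub Fy.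
have [py vE] : meet y y0 = p /\ (if (p < y)%O then Is p y else p) = v.
  have e : f y = (p, v) by apply: fy; left.
  by split; [exact: (congr1 fst e)|have pe : meet y y0 = p := congr1 fst e; rewrite -pe; exact: (congr1 snd e)].
have ply : (p < y)%O.
  by rewrite lt_neqAle -{2}py leIl andbT; apply/eqP => e; apply: yp; rewrite e.
move: vE; rewrite ply => vE.
have pv : (p < v)%O by rewrite -vE; exact: Is_gt.
have [_ wL AL CL] := Ly.
have wp : (w <= p)%O by rewrite -py lexI wy0 wL//; right; left.
have ncp : ~ c p by move=> /cw.
have Cpc : C (p |` c).
  apply: hC (CL y0 wy0) _ => u [->|cu]; [right|by left].
  by exists y; [right; left|rewrite meetC].
have cv u : (p |` c) u -> ~ (v <= u)%O.
  move=> [->|cu vu]; first by rewrite (lt_geF pv).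
  by apply: cw cu _; apply: le_trans vu; apply: le_trans wp (ltW pv).
(* The fiber lies in a smaller instance of the problem: the cone above [v], with [p] among the meets
   already present. A fiber of too large rank thus contradicts the induction hypothesis. *)
have FG : F `<=` cone v (p |` c).
  move=> s [Ls sf]; have [_ ws sA sC] := Ls.
  have sv y' : s y' -> [/\ meet y' y0 = p, (p < y')%O & Is p y' = v].
    move=> /sf; rewrite /f /= => -[-> e]; move: e; case: ifP => // _ e.
    by move: pv; rewrite e ltxx.
  split; first exact: fL.
  - by move=> y' /sv[_ py' <-]; exact: Is_ley.
  - by move=> t; apply: hA (sA t) _; apply: image_subset => u [su tu]; split=> //; right.
  - move=> x vx; have px : (p < x)%O := lt_le_trans pv vx.
    (* Since [v] is not on the branch of [y0], every [x] above [v] meets [y0] exactly at [p]: it is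
       [y0] that makes [p] present among the meets with [x]. *)
    have xy0 : meet x y0 = p.
      have pm' : (p <= meet x y0)%O by rewrite lexI (ltW px) -py leIr.
      apply: contrapT => ne; have pm : (p < meet x y0)%O.
        by rewrite lt_neqAle pm' andbT; apply/eqP => e; apply: ne.
      have py0 : (p < y0)%O := lt_le_trans pm (leIr _ _).
      have e1 : Is p x = Is p y0 by apply/(Is_meet T_tree px py0).
      have e2 : Is p x = v.
        by rewrite -(Is_eq T_tree pv vx) -vE; apply: (Is_imm T_tree); case: (IsP T_tree ply).
      have := Is_meet T_tree ply py0; rewrite py ltxx => -[h _].
      by have := h (etrans vE (etrans (esym e2) e1)).
    apply: hC (sC x (le_trans wp (ltW px))) _ => u [[->|cu]|[u' su' <-]].
    + by right; exists y0; [left|].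
    + by left.
    + by right; exists u' => //; right.
have FU' : CB (cone v (p |` c)) (oexp Om (oexp ka de)) set0.
  exact: CB_mono hF fF (@cone_hereditary _ _) (@cone_finitary _ _) FG _ FU.
have step de' : olt de' de -> ~ olt (oexp Om (oexp ka de)) (oexp Om (oexp ka (osucc de'))).
  move=> de'de /oltNge; apply; apply: oexp_ler; apply: oexp_ler; exact/ole_succ.
(* Either [p] keeps the rank, and then it is in [z] and can be deleted there, or the rank drops to
   [ro'] and a new list of any finite length begins. The measure [omega * ro + size z] decreases in
   both cases. *)
have [Crp|nCrp] := pselect (CB C ro (p |` c)).
  have pz : p \in z by exact: cz.
  have lt : olt (oadd (omul oomega ro) (onat (size (rem p z)))) de.
    apply: olt_ole_trans zde; apply: oadd_ltr; rewrite size_rem//.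
    by case: (z) pz => // u z' _; exact: osucc_gt.
  apply: (step _ lt); apply: (IH _ lt v (p |` c) ro (rem p z)) FU' => //.
  - exact: ole_refl.
  - by move=> h; apply: nro; apply: CB_hereditary h _ => // u; right.
  - move=> x npx Cx; apply: rem_mem; first by apply/eqP => xp; apply: npx; left.
    apply: cz; first by move=> cx; apply: npx; right.
    by apply: CB_hereditary Cx _ => // u [->|cu]; [left|right; right].
have [ro' [roro nro']] := CB_drop hC fC Cpc nCrp.
have [z' z'P] : exists z' : seq T, ext (CB C ro') (p |` c) = [set` z'].
  apply/finite_seqP; apply: contrapT => inf'; apply: nro'.
  by apply/(CB_succP _ _ hC fC).
have lt : olt (oadd (omul oomega ro') (onat (size z'))) de.
  apply: olt_ole_trans zde; apply: olt_ole_trans (oadd_ole _ _).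
  by apply: olt_ole_trans (omul_olt oomega roro); apply: oadd_ltr; exact: onat_omega.
apply: (step _ lt); apply: (IH _ lt v (p |` c) ro' z') FU' => //; first exact: ole_refl.
move=> x npx Cx; have : ext (CB C ro') (p |` c) x by [].
by rewrite z'P.
Qed.

Hypotheses (alAl : olt alA l) (alCl : olt alC l).

Lemma tree_family_rank_aux : ~ CB (tree_family A C) l set0.
Proof.
move=> Gl.
have [z zP] : exists z : seq T, ext (CB C alC) set0 = [set` z].
  apply/finite_seqP; apply: contrapT => inf; apply: nalC.
  by apply/(CB_succP _ _ hC fC).
have hG := tree_family_hereditary hA hC.
have fG : finitary (tree_family A C) by move=> s [].
have all : olt al l.
  by do ?[apply: expi_mul => //|apply: expi_exp => //|apply: expi_succ => //].
have : olt l (oexp Om (oexp ka (osucc (oadd (omul oomega alC) (onat (size z)))))).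
  apply: (@cone_rank _ \bot%O set0 alC z) => //.
  - exact: ole_refl.
  - move=> x _ Cx; have : ext (CB C alC) set0 x by split=> // -[].
    by rewrite zP.
  - apply: CB_mono Gl => // s [fs sA sC]; split=> // x _; rewrite set0U; exact: sC.
(* All entries of the tower are below the exp-indecomposable [l]; for [ka] this is the assumption
   [omega < l]. *)
move=> h; apply: (oltNge h); apply: oltW.
by do ?[apply: expi_mul => //|apply: expi_add => //|apply: expi_exp => //|
  apply: expi_succ => //|exact: expi_nat].
Qed.

End TreeFamilyRank.

Lemma tree_family_rank A C l : hereditary A -> finitary A -> A set0 -> ~ CB A l set0 ->
  hereditary C -> finitary C -> C set0 -> ~ CB C l set0 ->
  exp_indecomposable l -> olt oomega l -> ~ CB (tree_family A C) l set0.
Proof.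
move=> hA fA A0 rA hC fC C0 rC hl wl.
have [a [al _ na]] := CB_exact hA fA A0 rA; have [c [cl _ nc]] := CB_exact hC fC C0 rC.
exact: (tree_family_rank_aux hA fA hC fC C0 hl wl na nc al cl).
Qed.

End TreeFamily.

Lemma mem_sqcup (P : Type) (R : P -> P -> Prop) (F G : set_family P) s u v :
  hereditary F -> hereditary G -> F u -> G v -> s `<=` u `|` v -> is_chain R s ->
  sqcup R F G s.
Proof.
move=> hF hG Fu Gv suv cs; exists (s `&` u), (s `&` v); split=> //.
- by apply: hF Fu _ => x [].
- by apply: hG Gv _ => x [].
- by rewrite -setIUr; apply/esym/setIidl.
Qed.

Lemma is_chain_neq (P : Type) (C : set P) : is_chain (fun x y : P => x <> y) C.
Proof. by move=> x y _ _; have [|xy] := pselect (x = y); [exact: Or31|exact: Or32]. Qed.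

(** * Multiplication along sequences *)

(** A set maximal among those contained in infinitely many [a n] serves as root. It exists because
    endless growth would put all finite subsets of an infinite set into [K]. Outside the root, a
    point joins the root in only finitely many [a n], and a greedy choice avoids these. *)
Lemma delta_sequence (J : Type) (K : set_family J) l (a : nat -> set J) :
  hereditary K -> finitary K -> ~ CB K l set0 -> (forall n, K (a n)) ->
  exists phi r, [/\ {homo phi : m n / m < n}, finite_set r &
    forall m n, m < n -> a (phi m) `&` a (phi n) `<=` r].
Proof.
move=> hK fK rK Ka; pose root r := infinite_set [set n | r `<=` a n].
have Kroot r : root r -> K r by move=> /infinite_setN0[n rn]; exact: hK (Ka n) rn.
have [r [rr rmax]] : exists r, root r /\ forall x, ~ r x -> ~ root (x |` r).
  apply: contrapT => nmax; apply: rK.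
  have /choice[g gP] r : exists x, root r -> ~ r x /\ root (x |` r).
    have [rr|nr] := pselect (root r); last first.
      have [[x _]|nx] := pselect (exists x : J, True); first by exists x.
      exfalso; apply: nr; apply: (infinite_sub _ infinite_nat) => n _ x _.
      by case: nx; exists x.
    apply: contrapT => h; apply: nmax; exists r; split=> // x rx nrx.
    by apply: h; exists x.
  pose L := fix L n := if n is k.+1 then g (L k) |` L k else set0.
  have rL n : root (L n).
    elim: n => [|n IH] /=; last by have [] := gP _ IH.
    by apply: (infinite_sub _ infinite_nat) => n _ x [].
  have Lmono m n : m <= n -> L m `<=` L n.
    move=> mn; rewrite -(subnK mn); elim: (n - m) => [|k IH] //=.
    by move=> x /IH; right.
  pose M := \bigcup_n L n.
  have fM t : finite_set t -> t `<=` M -> exists n, t `<=` L n.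
    move: t; apply: (@finite_set_rect J (fun t => t `<=` M -> exists n, t `<=` L n)).
      by exists 0.
    move=> x t _ IH xtM; have [|n tn] := IH; first by move=> y ty; apply: xtM; right.
    have [m _ xm] : M x by apply: xtM; left.
    exists (maxn m n) => y [->|/tn].
      exact: Lmono (leq_maxl _ _) _ xm.
    exact: Lmono (leq_maxr _ _) _.
  have iM : infinite_set M.
    move=> /fM[//|n Mn]; have [ng _] := gP _ (rL n); apply: ng.
    by apply: Mn; exists n.+1 => //; left.
  apply: (CB_infinite hK fK iM) => // t ft tM.
  by have [n tn] := fM t ft tM; exact: hK (Kroot _ (rL n)) tn.
have [k kS|phi [phim phiS phiQ]] := @greedy_subsequence [set n | r `<=` a n]
    (fun m n => a m `&` a n `<=` r); last first.
  by exists phi, r; split=> //; exact/fK/Kroot.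
have fbad : finite_set (\bigcup_(m in [set` k]) \bigcup_(v in a m `\` r)
    [set n | (v |` r) `<=` a n]).
  apply: bigcup_finite; first exact: finite_seq.
  move=> m _; apply: bigcup_finite; first exact/finite_setD/fK.
  by move=> v [_ /rmax nv]; apply: contrapT.
apply: infinite_sub (infinite_diff rr fbad) => n [rn nbad]; split=> // m mk v [am an].
apply: contrapT => rv; apply: nbad; exists m => //; by exists v => // w [->//|/rn].
Qed.

Section Along.
Variables (P : Type) (H : set_family nat).
Hypothesis UH : uniform_families H.
Implicit Types (E F : set_family P) (s : nat -> set P) (phi psi : nat -> nat).
Let N (x y : P) := x <> y.

Definition along E s phi := forall x, H x -> E (\bigcup_(n in x) s (phi n)).

(* The property is inherited by subsequences, so that it can be imposed on       *)
(* finitely many sequences simultaneously. *)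
Definition Along E s := forall psi, {homo psi : m n / m < n} ->
  exists phi, {homo phi : m n / m < n} /\ along E s (psi \o phi).

Lemma along_comp E s phi psi : {homo psi : m n / m < n} -> along E s phi ->
  along E s (phi \o psi).
Proof.
by move=> psim Es x /(uniform_shift UH psim)/Es; rewrite bigcup_image.
Qed.

Lemma homo_comp phi psi : {homo phi : m n / m < n} -> {homo psi : m n / m < n} ->
  {homo phi \o psi : m n / m < n}.
Proof. by move=> phim psim m n /psim/phim. Qed.

Lemma AlongU E F s t : Along E s -> Along F t ->
  Along (sqcup N E F) (fun n => s n `|` t n).
Proof.
move=> Es Ft psi psim; have [phi [phim Ephi]] := Es psi psim.
have [xi [xim Fxi]] := Ft _ (homo_comp psim phim).
exists (phi \o xi); split; first exact: homo_comp.
move=> x Hx; exists (\bigcup_(n in x) s (psi (phi (xi n)))),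
  (\bigcup_(n in x) t (psi (phi (xi n)))); split.
- exact: (along_comp xim Ephi).
- exact: Fxi.
- by rewrite -bigcupU.
- exact: is_chain_neq.
Qed.

Lemma Along_sub E F s : E `<=` F -> Along E s -> Along F s.
Proof.
by move=> EF Es psi /Es[phi [phim Ephi]]; exists phi; split=> // x /Ephi/EF.
Qed.

Lemma multiplies_Along E F s : multiplies N H E F -> (forall n, E (s n)) -> Along F s.
Proof.
move=> mE Es psi _; have [|phi [phim Fphi]] := mE (s \o psi) _ (@is_chain_neq _ _).
  by move=> n; exact: Es.
by exists phi.
Qed.

Lemma Along_multiplies E F :
  (forall s, (forall n, E (s n)) -> exists phi, {homo phi : m n / m < n} /\ Along F (s \o phi)) ->
  multiplies N H E F.
Proof.
move=> EF s Es _; have [phi [phim Fphi]] := EF s Es.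
have [//|xi [xim Fxi]] := Fphi id.
by exists (phi \o xi); split=> //; exact: homo_comp.
Qed.

Lemma multiplies_simultaneous E F (J : Type) (V : set J) (u : J -> nat -> set P) psi :
  multiplies N H E F -> finite_set V -> (forall j n, E (u j n)) ->
  {homo psi : m n / m < n} ->
  exists phi, {homo phi : m n / m < n} /\ forall j, V j -> along F (u j) (psi \o phi).
Proof.
move=> mE + Eu psim; move: V; apply: (@finite_set_rect J (fun V => exists phi, _ /\ _)).
  by exists id; split.
move=> i V _ [phi [phim phiV]].
have [xi [xim xiE]] := multiplies_Along mE (Eu i) (homo_comp psim phim).
exists (phi \o xi); split; first exact: homo_comp.
move=> j [->|/phiV Vj]; first exact: xiE.
exact: (along_comp xim Vj).
Qed.

(** The index sets are multiplied by means of [K'] and thinned by [delta_sequence]. An index outside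
    the finite root then occurs for one [n] only, and its fiber is a single piece in [E]; the
    indices of the root are treated simultaneously and give fibers in [F]. *)
Lemma fibered_multiplies (J : Type) (R : J -> J -> Prop) (K K' : set_family J) l
    (ka : nat -> P -> J) E F s psi :
  hereditary K -> finitary K -> ~ CB K l set0 -> multiplies R H K K' ->
  hereditary E -> E set0 -> multiplies N H E F ->
  (forall n, K (ka n @` s n)) -> is_chain R (\bigcup_n ka n @` s n) ->
  (forall n j, E (s n `&` [set y | ka n y = j])) -> {homo psi : m n / m < n} ->
  exists phi, {homo phi : m n / m < n} /\ forall x, H x ->
    K' (\bigcup_(n in x) ka (psi (phi n)) @` s (psi (phi n))) /\
    forall j, (E `|` F) (\bigcup_(n in x)
      (s (psi (phi n)) `&` [set y | ka (psi (phi n)) y = j])).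
Proof.
move=> hK fK rK mK hE E0 mE Ks cs Es psim.
have [||phi1 [phi1m K'1]] := mK (fun n => ka (psi n) @` s (psi n)).
- by move=> n; exact: Ks.
- by apply: is_chain_sub cs => j [n _ sj]; exists (psi n).
pose a n := ka (psi (phi1 n)) @` s (psi (phi1 n)).
have [phi2 [r [phi2m fr disj]]] := delta_sequence (a := a) hK fK rK (fun n => Ks _).
have m12 := homo_comp phi1m phi2m.
pose u j n := s n `&` [set y | ka n y = j].
have [phi3 [phi3m F3]] := multiplies_simultaneous mE fr (u := u) (fun j n => Es n j)
  (homo_comp psim m12).
exists (phi1 \o phi2 \o phi3); split; first exact: homo_comp.
move=> x Hx; split.
  have := K'1 _ (uniform_shift UH (homo_comp phi2m phi3m) Hx).
  by rewrite bigcup_image.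
move=> j; have [rj|nrj] := pselect (r j); first by right; exact: F3.
left; have [[n [xn [y [sy yj]]]]|none] := pselect (exists n, x n /\
    (s (psi (phi1 (phi2 (phi3 n)))) `&`
    [set y | ka (psi (phi1 (phi2 (phi3 n)))) y = j]) !=set0); last first.
  apply: hE E0 _ => y [n xn h]; apply: none; exists n; split=> //.
  by exists y.
apply: hE (Es (psi (phi1 (phi2 (phi3 n)))) j) _ => z [m xm [sz zj]].
have aj k w : s (psi (phi1 (phi2 (phi3 k)))) w -> ka (psi (phi1 (phi2 (phi3 k)))) w = j ->
    a (phi2 (phi3 k)) j by move=> sw wj; exists w.
have [mn|nm|<-//] := ltngtP m n.
- by case: nrj; apply: (disj _ _ (phi3m _ _ mn)); split; [exact: aj zj|exact: aj yj].
- by case: nrj; apply: (disj _ _ (phi3m _ _ nm)); split; [exact: aj yj|exact: aj zj].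
Qed.

End Along.

(** * Families generated by fans and combs *)

Section FansAndCombs.
Variables (d : Order.disp_t) (T : bMeetSemilatticeType d).
Hypothesis T_tree : is_tree T.
Variable lts : T -> T -> T -> Prop.
Hypothesis lts_total : forall t : T, strict_total_order_on (imm_succ t) (lts t).
Local Notation meet := (@Order.meet d T).
Implicit Types (x y z t u v p q w : T) (A C E F : set_family T).

Let lt (x y : T) : Prop := (x < y)%O.
Let N (x y : T) := x <> y.

Definition fan_family A E : set_family T := [set s | finite_set s /\
  exists t, [/\ forall y, s y -> (t < y)%O, A (Is t @` s) &
    forall v, E (s `&` [set y | Is t y = v])]].

(** The single node [q] stands for a possibly unbounded branch, of which a finite set sees only an
    initial part. *)
Definition comb_family C E : set_family T := [set s | finite_set s /\
  exists q, C (meet^~ q @` s) /\ forall p, E (s `&` [set y | meet y q = p])].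

Lemma fan_family_hereditary A E : hereditary A -> hereditary E -> hereditary (fan_family A E).
Proof.
move=> hA hE s s' [fs [t [ts sA sE]]] s's; split; first exact: sub_finite_set fs.
exists t; split=> [y /s's/ts//||v].
  by apply: hA sA _; exact: image_subset.
by apply: hE (sE v) _; exact: setSI.
Qed.

Lemma comb_family_hereditary C E : hereditary C -> hereditary E -> hereditary (comb_family C E).
Proof.
move=> hC hE s s' [fs [q [sC sE]]] s's; split; first exact: sub_finite_set fs.
exists q; split; first by apply: hC sC _; exact: image_subset.
by move=> p; apply: hE (sE p) _; exact: setSI.
Qed.

Lemma fan_family_set0 A E : A set0 -> E set0 -> fan_family A E set0.
Proof.
move=> A0 E0; split; first exact: finite_set0.
by exists \bot%O; split=> [y []||v]; rewrite ?image_set0 ?set0I.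
Qed.

Lemma comb_family_set0 C E : C set0 -> E set0 -> comb_family C E set0.
Proof.
move=> C0 E0; split; first exact: finite_set0.
by exists \bot%O; split=> [|v]; rewrite ?image_set0 ?set0I.
Qed.

Lemma is_chain_Is t (s : set T) : (forall y, s y -> (t < y)%O) ->
  is_chain (lt_a lts) (Is t @` s).
Proof.
move=> ts _ _ [x sx <-] [y sy <-].
have [ix _] := IsP T_tree (ts x sx); have [iy _] := IsP T_tree (ts y sy).
have [_ _ total] := lts_total t.
by case: (total _ _ ix iy) => [->|xy|yx]; [exact: Or31|apply: Or32|apply: Or33]; exists t.
Qed.

Lemma is_chain_le q (s : set T) : (forall y, s y -> (y <= q)%O) -> is_chain lt s.
Proof.
move=> sq x y sx sy; have [->|/eqP xy] := pselect (x = y); first exact: Or31.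
have /orP[le|le] := tree_total T_tree (sq x sx) (sq y sy).
  by apply: Or32; rewrite /lt lt_neqAle xy.
by apply: Or33; rewrite /lt lt_neqAle eq_sym xy.
Qed.

Lemma is_chain_increasing (r : nat -> T) :
  (forall m n, (m < n)%N -> (r m < r n)%O) -> is_chain lt (range r).
Proof.
move=> ri _ _ [m _ <-] [n _ <-]; have [mn|nm|->] := ltngtP m n.
- by apply: Or32; exact: ri.
- by apply: Or33; exact: ri.
- exact: Or31.
Qed.

Section SequencesMultiply.
Variable H : set_family nat.
Hypothesis UH : uniform_families H.

(** Different [n] use different successors of [t], so each piece lies in one [w n], and only the set
    of successors has to be multiplied. *)
Lemma fan_Along A E t (q : nat -> T) (w : nat -> set T) :
  hereditary A -> hereditary E -> E set0 ->
  multiplies (lt_a lts) H (chains_le (lt_a lts) 1) A -> fan t q ->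
  (forall n, E (w n)) -> (forall n, finite_set (w n)) ->
  (forall n y, w n y -> (t < y)%O /\ Is t y = Is t (q n)) ->
  Along H (fan_family A E) w.
Proof.
move=> hA hE E0 mA [tq fq] Ew fw wq psi psim.
have [||phi [phim phiA]] := mA (fun n => [set Is t (q (psi n))]).
- by move=> n; apply/chains_le1P; right; exists (Is t (q (psi n))).
- apply: is_chain_sub (is_chain_Is (t := t) (s := range q) _).
    by move=> _ [n _ ->]; exists (q (psi n)) => //; exists (psi n).
  by move=> _ [n _ <-].
exists phi; split=> // x Hx; have fx := uniform_finitary UH Hx; split.
  by apply: bigcup_finite => // n _.
exists t; split.
- by move=> y [n _ /wq[]].
- apply: hA (phiA x Hx) _ => _ [y [n xn /wq[_ e]] <-].
  by exists n.
move=> v; have [[n [xn nv]]|none] := pselect (exists n, x n /\ Is t (q (psi (phi n))) = v).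
  apply: hE (Ew (psi (phi n))) _ => y [[m xm wy] /=].
  have [_ ->] := wq _ _ wy; have [mn|nm|mn] := ltngtP m n; last by rewrite -mn.
    by rewrite -nv => /(fq _ _ (psim _ _ (phim _ _ mn))).
  by rewrite -nv => /esym/(fq _ _ (psim _ _ (phim _ _ nm))).
apply: hE E0 _ => y [[n xn wy] /=] yv; apply: none; exists n; split=> //.
by have [_ <-] := wq _ _ wy.
Qed.

Lemma finite_nat_bound (x : set nat) : finite_set x -> exists M, forall n, x n -> n < M.
Proof.
move=> /finite_seqP[l ->]; exists (\max_(i <- l) i).+1 => n nl.
by rewrite ltnS; apply: (@leq_bigmax_seq _ _ xpredT id n).
Qed.

Lemma homo_mono (phi : nat -> nat) : {homo phi : m n / m < n} -> {homo phi : m n / m <= n}.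
Proof. by move=> phim m n; rewrite leq_eqVlt => /orP[/eqP ->//|/phim/ltnW]. Qed.

Lemma comb_Along C E (r : nat -> T) (w : nat -> set T) :
  hereditary C -> hereditary E -> E set0 ->
  multiplies lt H (chains_le lt 1) C ->
  (forall m n, (m < n)%N -> (r m < r n)%O) ->
  (forall n, E (w n)) -> (forall n, finite_set (w n)) ->
  (forall m n y, w m y -> (m < n)%N -> meet y (r n) = r m) ->
  Along H (comb_family C E) w.
Proof.
move=> hC hE E0 mC ri Ew fw wr psi psim.
have [||phi [phim phiC]] := mC (fun n => [set r (psi n)]).
- by move=> n; apply/chains_le1P; right; exists (r (psi n)).
- apply: is_chain_sub (is_chain_increasing ri).
  by move=> _ [n _ ->]; exists (psi n).
exists phi; split=> // x Hx; have fx := uniform_finitary UH Hx; split.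
  by apply: bigcup_finite => // n _.
(* For a finite [x], one node far enough along [r] replaces the whole branch. *)
have [M xM] := finite_nat_bound fx.
have wM n y : x n -> w (psi (phi n)) y -> meet y (r (psi (phi M))) = r (psi (phi n)).
  by move=> /xM nM /wr; apply; apply: psim; exact: phim.
exists (r (psi (phi M))); split.
  by apply: hC (phiC x Hx) _ => _ [y [n xn wy] <-]; exists n => //; exact: wM.
move=> p; have [[n [xn np]]|none] := pselect (exists n, x n /\ r (psi (phi n)) = p).
  apply: hE (Ew (psi (phi n))) _ => y [[m xm wy] /=].
  rewrite (wM m) // -np; have [mn|nm|mn] := ltngtP m n; last by rewrite -mn.
    by move=> e; have := ri _ _ (psim _ _ (phim _ _ mn)); rewrite e ltxx.
  by move=> e; have := ri _ _ (psim _ _ (phim _ _ nm)); rewrite e ltxx.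
apply: hE E0 _ => y [[n xn wy] /=] yp; apply: none; exists n; split=> //.
by rewrite -(wM n y).
Qed.

(** In contrast to [comb_Along], different [n] may share a meet. Fibers then accumulate, which is
    why the pieces come from [sqcup N E F] with [F] multiplying [E]. The last hypothesis puts all
    the meets on one branch. *)
Lemma path_Along C C' E F l (r q : nat -> T) (s : nat -> set T) :
  hereditary C -> finitary C -> ~ CB C l set0 -> multiplies lt H C C' ->
  hereditary C' -> hereditary E -> E set0 -> F set0 -> multiplies N H E F ->
  (forall m n, (m <= n)%N -> (r m <= r n)%O) ->
  (forall n, C (meet^~ (q n) @` s n)) ->
  (forall n p, E (s n `&` [set y | meet y (q n) = p])) ->
  (forall n, finite_set (s n)) ->
  (forall m n y, s m y -> (m <= n)%N -> meet y (q m) = meet y (r n)) ->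
  Along H (comb_family C' (sqcup N E F)) s.
Proof.
move=> hC fC rC mC hC' hE E0 F0 mE rm sC sE fs sr psi psim.
have [|phi [phim phiP]] := @fibered_multiplies _ _ UH _ lt C C' l
  (fun n y => meet y (q n)) E F s psi hC fC rC mC hE E0 mE sC _ sE psim.
  move=> _ _ [m _ [y sy <-]] [n _ [z sz <-]].
  rewrite (sr m (maxn m n) y)// ?leq_maxl// (sr n (maxn m n) z)// ?leq_maxr//.
  apply: (@is_chain_le (r (maxn m n)) [set u | (u <= r (maxn m n))%O]) => //=.
    exact: leIr.
  exact: leIr.
exists phi; split=> // x Hx; have fx := uniform_finitary UH Hx; split.
  by apply: bigcup_finite => // n _.
have [M xM] := finite_nat_bound fx.
have e n y : x n -> s (psi (phi n)) y -> meet y (r (psi (phi M))) = meet y (q (psi (phi n))).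
  move=> /xM nM sy; apply/esym/sr => //; apply: homo_mono psim _ _ _.
  by apply: homo_mono phim _ _ _; exact: ltnW.
have [K' EF] := phiP x Hx; exists (r (psi (phi M))); split.
  apply: hC' K' _ => _ [y [n xn sy] <-]; exists n => //; exists y => //.
  by rewrite (e n).
move=> p; have sub : (\bigcup_(n in x) s (psi (phi n))) `&`
    [set y | meet y (r (psi (phi M))) = p] =
    \bigcup_(n in x) (s (psi (phi n)) `&` [set y | meet y (q (psi (phi n))) = p]).
  apply/seteqP; split=> [y [[n xn sy] /= yp]|y [n xn [sy /= yp]]].
    by exists n => //; split=> //=; rewrite -(e n).
  by split; [exists n|rewrite /= (e n)].
rewrite sub; case: (EF p) => h.
  by exists (\bigcup_(n in x) (s (psi (phi n)) `&` [set y | meet y (q (psi (phi n))) = p])), set0;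
    split=> //; [rewrite setU0|exact: is_chain_neq].
by exists set0, (\bigcup_(n in x) (s (psi (phi n)) `&` [set y | meet y (q (psi (phi n))) = p]));
    split=> //; [rewrite set0U|exact: is_chain_neq].
Qed.

Lemma branch_Along A A' E F l t (s : nat -> set T) :
  hereditary A -> finitary A -> ~ CB A l set0 -> multiplies (lt_a lts) H A A' ->
  hereditary A' -> hereditary E -> E set0 -> F set0 -> multiplies N H E F ->
  (forall n y, s n y -> (t < y)%O) -> (forall n, A (Is t @` s n)) ->
  (forall n v, E (s n `&` [set y | Is t y = v])) -> (forall n, finite_set (s n)) ->
  Along H (fan_family A' (sqcup N E F)) s.
Proof.
move=> hA fA rA mA hA' hE E0 F0 mE ts sA sE fs psi psim.
have [|phi [phim phiP]] := @fibered_multiplies _ _ UH _ (lt_a lts) A A' l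
  (fun n y => Is t y) E F s psi hA fA rA mA hE E0 mE sA _ sE psim.
  rewrite -image_bigcup; apply: is_chain_Is => y [n _ sy]; exact: ts sy.
exists phi; split=> // x Hx; have fx := uniform_finitary UH Hx; split.
  by apply: bigcup_finite => // n _.
have [K' EF] := phiP x Hx; exists t; split.
- by move=> y [n _ /ts].
- by rewrite image_bigcup.
move=> v; rewrite setI_bigcupl; case: (EF v) => h.
  by exists (\bigcup_(n in x) (s (psi (phi n)) `&` [set y | Is t y = v])), set0;
    split=> //; [rewrite setU0|exact: is_chain_neq].
by exists set0, (\bigcup_(n in x) (s (psi (phi n)) `&` [set y | Is t y = v]));
    split=> //; [rewrite set0U|exact: is_chain_neq].
Qed.

End SequencesMultiply.

End FansAndCombs.

(** * The system generated on the tree *)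

Section TreeSystem.
Variables (d : Order.disp_t) (T : bMeetSemilatticeType d).
Hypothesis T_tree : is_tree T.
Variable lts : T -> T -> T -> Prop.
Hypothesis lts_total : forall t : T, strict_total_order_on (imm_succ t) (lts t).
Local Notation meet := (@Order.meet d T).
Implicit Types (x y z t u v p q w : T) (A C E F : set_family T).

Let lt (x y : T) : Prop := (x < y)%O.
Let N (x y : T) := x <> y.

Variables DA DC : Ord -> set (set_family T).
Hypotheses (sysA : chain_system (lt_a lts) DA) (sysC : chain_system lt DC).

Inductive generated (l : Ord) : set_family T -> Prop :=
| generated_points : generated l (chains_le N 1)
| generated_sqcup E F : generated l E -> generated l F -> generated l (sqcup N E F)
| generated_fan A E : DA l A -> generated l E -> generated l (fan_family A E)
| generated_comb C E : DC l C -> generated l E -> generated l (comb_family C E).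

Section Level.
Variable l : Ord.
Hypothesis hl : exp_indecomposable l.

Let finA A : DA l A -> [/\ hereditary A, finitary A, A set0 & ~ CB A l set0].
Proof. by move=> /(cs_fam sysA hl)[cA hA A0 rA]; split=> //; exact: on_chains_finitary cA. Qed.

Let finC C : DC l C -> [/\ hereditary C, finitary C, C set0 & ~ CB C l set0].
Proof. by move=> /(cs_fam sysC hl)[cA hA A0 rA]; split=> //; exact: on_chains_finitary cA. Qed.

Lemma generated_fam E : generated l E -> [/\ hereditary E, finitary E & E set0].
Proof.
elim=> {E} [|E F _ [hE fE E0] _ [hF fF F0]|A E DA_A _ [hE fE E0]|C E DC_C _ [hE fE E0]].
- split; [exact: chains_le_hereditary|exact: on_chains_finitary (@chains_le_on_chains _ N 1)|
    exact: chains_le_set0].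
- split; [exact: sqcup_hereditary|exact: sqcup_finitary|].
  by exists set0, set0; rewrite setU0; split=> //; exact: is_chain0.
- have [hA _ A0 _] := finA DA_A.
  by split; [exact: fan_family_hereditary|move=> s []|exact: fan_family_set0].
- have [hC _ C0 _] := finC DC_C.
  by split; [exact: comb_family_hereditary|move=> s []|exact: comb_family_set0].
Qed.

Let subl E F : generated l E -> generated l F -> E `<=` sqcup N E F.
Proof.
by move=> _ /generated_fam[_ _ F0] s Es; exists s, set0; split=> //;
  [rewrite setU0|exact: is_chain_neq].
Qed.

Let subr E F : generated l E -> generated l F -> F `<=` sqcup N E F.
Proof.
by move=> /generated_fam[_ _ E0] _ s Fs; exists set0, s; split=> //;
  [rewrite set0U|exact: is_chain_neq].
Qed.

Lemma generated_chains_le n : exists2 E, generated l E & chains_le N n `<=` E.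
Proof.
elim: n => [|n [E gE nE]].
  by exists (chains_le N 1); [exact: generated_points|exact: chains_le_mono].
exists (sqcup N (chains_le N 1) E).
  by apply: generated_sqcup => //; exact: generated_points.
have gP : generated l (chains_le N 1) by exact: generated_points.
move=> s [sn cs]; have [[x sx]|s0] := pselect (s !=set0); last first.
  apply: (subr gP gE); apply: nE; rewrite (_ : s = set0); first exact: chains_le_set0.
  by apply/seteqP; split=> // x sx; case: s0; exists x.
have sE : s = [set x] `|` (s `\ x).
  apply/seteqP; split=> [y sy|y [->//|[]//]].
  by have [->|yx] := pselect (y = x); [left|right].
exists [set x], (s `\ x); split=> //.
  by apply/chains_le1P; right; exists x.
apply: nE; split; last exact: is_chain_neq.
by apply: (@card_le_U1N _ _ _ x); [case=> _; apply|rewrite -sE].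
Qed.

Let joinA A1 A2 : DA l A1 -> DA l A2 -> exists2 A, DA l A &
  forall (s u v : set T) x, A1 u -> A2 v -> s `<=` u `|` v `|` [set x] -> is_chain (lt_a lts) s -> A s.
Proof.
move=> D1 D2; have [A3 D3 s3] := cs_sqcup sysA hl D1 D2.
have [A D s4] := cs_sqcup sysA hl D3 (cs_chains sysA 1 hl).
have [h1 _ _ _] := finA D1; have [h2 _ _ _] := finA D2; have [h3 _ _ _] := finA D3.
exists A => // s u v x u1 v2 suv cs; apply: s4.
apply: (mem_sqcup (u := s `&` (u `|` v)) (v := [set x])) => //.
- exact: chains_le_hereditary.
- apply: s3; apply: (mem_sqcup h1 h2 u1 v2) => [y []//|].
  by apply: is_chain_sub cs => y [].
- by apply/chains_le1P; right; exists x.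
- by move=> y sy; case: (suv y sy); [left|right].
Qed.

Let joinC C1 C2 : DC l C1 -> DC l C2 -> exists2 C, DC l C &
  forall (s u v : set T) x, C1 u -> C2 v -> s `<=` u `|` v `|` [set x] -> is_chain lt s -> C s.
Proof.
move=> D1 D2; have [A3 D3 s3] := cs_sqcup sysC hl D1 D2.
have [A D s4] := cs_sqcup sysC hl D3 (cs_chains sysC 1 hl).
have [h1 _ _ _] := finC D1; have [h2 _ _ _] := finC D2; have [h3 _ _ _] := finC D3.
exists A => // s u v x u1 v2 suv cs; apply: s4.
apply: (mem_sqcup (u := s `&` (u `|` v)) (v := [set x])) => //.
- exact: chains_le_hereditary.
- apply: s3; apply: (mem_sqcup h1 h2 u1 v2) => [y []//|].
  by apply: is_chain_sub cs => y [].
- by apply/chains_le1P; right; exists x.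
- by move=> y sy; case: (suv y sy); [left|right].
Qed.

(** Reduces the rank of nested constructions to one application of [tree_family_rank]. For a fixed
    successor set or branch, at most one piece is seen in detail; the remaining points contribute
    part of the index set or a single node, which [joinA] and [joinC] absorb. *)
Lemma generated_sub E : generated l E ->
  exists A C, [/\ DA l A, DC l C & E `<=` tree_family A C].
Proof.
have chI t (s : set T) : is_chain (lt_a lts) (Is t @` (s `&` [set y | (t < y)%O])).
  by apply: is_chain_Is => // y [].
have chM x (s : set T) : is_chain lt (meet x @` s).
  by apply: (is_chain_le T_tree (q := x)) => _ [y _ <-]; exact: leIl.
elim=> {E} [|E1 E2 _ [A1 [C1 [D1 D1' s1]]] _ [A2 [C2 [D2 D2' s2]]]|
  A0 E D0 _ [A1 [C1 [D1 D1' s1]]]|C0 E D0 _ [A1 [C1 [D1 D1' s1]]]].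
- exists (chains_le (lt_a lts) 1), (chains_le lt 1); split; [exact: cs_chains|exact: cs_chains|].
  move=> s /chains_le1P s1; split=> [|t|x].
  + by case: s1 => [->|[x ->]]; [exact: finite_set0|exact: finite_set1].
  + case: s1 => [->|[x ->]]; first by rewrite set0I image_set0; exact: chains_le_set0.
    apply: (@chains_le_hereditary _ _ 1 [set Is t x]); first by apply/chains_le1P; right; exists (Is t x).
    by move=> _ [y [-> _] <-].
  + case: s1 => [->|[y ->]]; first by rewrite image_set0; exact: chains_le_set0.
    by rewrite image_set1; apply/chains_le1P; right; exists (meet x y).
- have [A DA_A joinAP] := joinA D1 D2; have [C DC_C joinCP] := joinC D1' D2'.
  exists A, C; split=> // _ [s [s' [/s1[fs sA sC] /s2[ft tA tC] -> _]]]; split=> [|u|x].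
  + by rewrite finite_setU.
  + apply: (joinAP _ _ _ u (sA u) (tA u)) => //.
    by move=> _ [y [[sy|ty] uy] <-]; left; [left|right]; exists y.
  + apply: (joinCP _ _ _ x (sC x) (tC x)) => //.
    by move=> _ [y [sy|ty] <-]; left; [left|right]; exists y.
- have [A DA_A joinAP] := joinA D0 D1.
  have [C DC_C joinCP] := joinC D1' D1'.
  have [hA0 _ A00 _] := finA D0; have [hA1 _ A10 _] := finA D1; have [hC1 _ C10 _] := finC D1'.
  exists A, C; split=> // s [fs [t [ts sA sE]]]; split=> // [u|x].
  + have [[y0 [sy0 uy0]]|nou] := pselect (exists y, s y /\ (u < y)%O); last first.
      apply: (joinAP _ _ _ u A00 A10) => // _ [y [sy uy] <-].
      by case: nou; exists y.
    have [ut|nut] := pselect (u <= t)%O.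
      move: ut; rewrite le_eqVlt => /orP[/eqP ->|ut].
        apply: (joinAP _ _ _ t sA A10) => // _ [y [sy _] <-].
        by left; left; exists y.
      apply: (joinAP _ _ _ (Is u t) A00 A10) => // _ [y [sy uy] <-]; right.
      by rewrite /= (Is_eq T_tree ut (ltW (ts y sy))).
    have tu : (t < u)%O.
      have := tree_total T_tree (ltW uy0) (ltW (ts _ sy0)).
      by case/orP => [/nut//|]; rewrite le_eqVlt => /orP[/eqP e|//]; case: nut; rewrite e.
    have [_ vA _] := s1 _ (sE (Is t u)).
    apply: (joinAP _ _ _ u A00 (vA u)) => // _ [y [sy uy] <-]; left; right.
    exists y => //; split=> //; split=> //=; apply/esym.
    exact: (Is_eq T_tree tu (ltW uy)).
  + have [tx|ntx] := pselect (t < x)%O.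
      have [_ _ vC] := s1 _ (sE (Is t x)).
      apply: (joinCP _ _ _ t C10 (vC x)) => // _ [y sy <-].
      have [e|ne] := pselect (Is t y = Is t x); first by left; right; exists y.
      by right; rewrite /= (Is_neq_meet T_tree tx (ts y sy)) // => /esym.
    apply: (joinCP _ _ _ (meet x t) C10 C10) => // _ [y sy <-]; right => /=.
    have [tx|nt] := pselect (t <= x)%O; last exact: (meet_trunc T_tree (ltW (ts y sy)) nt).
    have -> : x = t.
      by move: tx; rewrite le_eqVlt => /orP[/eqP //|/ntx].
    by rewrite meetxx; apply/meet_idPl; exact: ltW (ts y sy).
- have [A DA_A joinAP] := joinA D1 D1.
  have [C DC_C joinCP] := joinC D0 D1'.
  have [hA1 _ A10 _] := finA D1; have [hC1 _ C10 _] := finC D1'.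
  have [hC0 _ C00 _] := finC D0.
  exists A, C; split=> // s [fs [q [sC sE]]]; split=> // [u|x].
  + have [uq|nuq] := pselect (u <= q)%O.
      have [_ vA _] := s1 _ (sE u).
      apply: (joinAP _ _ _ (Is u q) A10 (vA u)) => // _ [y [sy uy] <-].
      have uyq : (u <= meet y q)%O by rewrite lexI (ltW uy).
      have [e|ne] := pselect (meet y q = u); first by left; right; exists y.
      right; have uyq' : (u < meet y q)%O.
        by rewrite lt_neqAle uyq andbT; apply/eqP => e; apply: ne.
      apply/(Is_meet T_tree uy (lt_le_trans uyq' (leIr _ _))); exact: uyq'.
    have [_ vA _] := s1 _ (sE (meet u q)).
    apply: (joinAP _ _ _ u A10 (vA u)) => // _ [y [sy uy] <-]; left; right.
    exists y => //; split=> //; split=> //=.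
    by rewrite meetC (meet_trunc T_tree (ltW uy) nuq) meetC.
  + have [_ _ vC] := s1 _ (sE (meet x q)).
    apply: (joinCP _ _ _ (meet x q) sC (vC x)) => // _ [y sy <-].
    have [e|ne] := pselect (meet y q = meet x q); first by left; right; exists y.
    (* Compare where [y] and [x] leave the branch of [q]: if [y] leaves first, its meet with [x] is
       its meet with [q]; if [x] leaves first, it is the fixed node [meet x q]. *)
    have /orP[yx|xy] := tree_total T_tree (leIr q y) (leIr q x).
      have nx : ~ (meet x q <= y)%O.
        by move=> h; apply: ne; apply/le_anti; rewrite yx lexI h leIr.
      left; left; exists y => //.
      by rewrite (meet_trunc T_tree (leIr q x) nx) [RHS]meetC (meet_trunc T_tree (leIl x q) nx).
    have ny : ~ (meet y q <= x)%O.
      by move=> h; apply: ne; apply/le_anti; rewrite xy lexI h leIr.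
    right; rewrite /=.
    by rewrite (meet_trunc T_tree (leIl y q) ny) (meet_trunc T_tree (leIr q y) ny).
Qed.

(** By induction on the generation of [E], applying [tree_subsequence] to the nodes at which the
    sets are attached. When these nodes form a fan or a comb, whole members of the family [F] hang
    off one node or one branch, so fans and combs with pieces from [F] itself are needed. *)
Lemma generated_mult H c E : uniform_families H -> is_srk nat_lt H c -> olt c l ->
  generated l E -> exists2 E', generated l E' & multiplies N H E E'.
Proof.
move=> UH sc cl.
have [A1 DA1 mA1] := cs_mult sysA hl (cs_chains sysA 1 hl) UH sc cl.
have [C1 DC1 mC1] := cs_mult sysC hl (cs_chains sysC 1 hl) UH sc cl.
have [hA1 fA1 A10 rA1] := finA DA1; have [hC1 fC1 C10 rC1] := finC DC1.
elim=> {E} [|E F gE [E' gE' mE] gF [F' gF' mF]|A E DA_A gE [E' gE' mE]|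
  C E DC_C gE [E' gE' mE]].
- set Q := chains_le N 1; have gQ : generated l Q := generated_points l.
  have [hQ fQ Q0] := generated_fam gQ.
  have gX := generated_sqcup (generated_fan DA1 gQ) (generated_comb DC1 gQ).
  have gY := generated_sqcup gQ gX.
  exists (sqcup N Q (sqcup N (fan_family A1 Q) (comb_family C1 Q))) => //.
  apply: Along_multiplies => s Qs.
  have /choice[x sx] n : exists x, s n `<=` [set x].
    by case/chains_le1P: (Qs n) => [->|[x ->]]; [exists \bot%O; exact: sub0set|exists x].
  have fs n : finite_set (s n) := fQ _ (Qs n).
  have [phi [phim phiP]] := tree_subsequence T_tree x; exists phi; split=> //.
  have [[q xq]|[t ft]|[r [ri rx xr]]] := phiP.
  + apply: (Along_sub (subl gQ gX)) => psi psim; exists id; split=> // X _.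
    apply: (hQ [set q]); first by apply/chains_le1P; right; exists q.
    by move=> y [n _ /sx]; rewrite /= xq.
  + apply: (Along_sub (subr gQ gX)).
    apply: (Along_sub (subl (generated_fan DA1 gQ) (generated_comb DC1 gQ))).
    apply: (fan_Along T_tree lts_total UH hA1 hQ Q0 mA1 ft) => [n|n|n y /sx ->]; [exact: Qs|exact: fs|].
    by split=> //; exact: ft.1.
  + apply: (Along_sub (subr gQ gX)).
    apply: (Along_sub (subr (generated_fan DA1 gQ) (generated_comb DC1 gQ))).
    apply: (comb_Along UH hC1 hQ Q0 mC1 ri) => [n|n|m n y /sx -> mn]; [exact: Qs|exact: fs|].
    exact: xr.
- exists (sqcup N E' F'); first exact: generated_sqcup.
  apply: Along_multiplies => s EFs.
  have /choice[u uP] n : exists u : set T * set T, [/\ E u.1, F u.2 & s n = u.1 `|` u.2].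
    by have [u [v [Eu Fv -> _]]] := EFs n; exists (u, v).
  have e : s = fun n => (u n).1 `|` (u n).2 by apply/funext => n; have [_ _ ->] := uP n.
  exists id; split=> //; rewrite -/(comp s id) e.
  apply: (AlongU UH (s := fun n => (u n).1) (t := fun n => (u n).2)).
    by apply: (multiplies_Along mE) => n; have [] := uP n.
  by apply: (multiplies_Along mF) => n; have [] := uP n.
- have [A' DA' mA'] := cs_mult sysA hl DA_A UH sc cl.
  have [hA fA A0 rA] := finA DA_A; have [hA' fA' A'0 rA'] := finA DA'.
  have [hE fE E0] := generated_fam gE; have [hE' fE' E'0] := generated_fam gE'.
  set F := fan_family A E; have gF : generated l F := generated_fan DA_A gE.
  have [hF fF F0] := generated_fam gF.
  have g1 := generated_fan DA' (generated_sqcup gE gE').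
  have g2 := generated_fan DA1 gF; have g3 := generated_comb DC1 gF.
  have g4 := generated_sqcup gE' g3; have g5 := generated_sqcup g2 g4.
  have g6 := generated_sqcup g1 g5.
  eexists; first exact: g6.
  apply: Along_multiplies => s Fs.
  have fs n : finite_set (s n) := fF _ (Fs n).
  have /choice[t tP] n : exists t, [/\ forall y, s n y -> (t < y)%O, A (Is t @` s n) &
    forall v, E (s n `&` [set y | Is t y = v])] by have [_] := Fs n.
  have [phi [phim phiP]] := tree_subsequence T_tree t; exists phi; split=> //.
  have [[q tq]|[q ft]|[r [ri rt tr]]] := phiP.
  + apply: (Along_sub (subl g1 g5)).
    apply: (branch_Along T_tree lts_total UH (t := q) hA fA rA mA' hA' hE E0 E'0 mE) => [n y|n|n v|n];
      rewrite /= -?(tq n); by [have [] := tP (phi n); auto|exact: fs].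
  + apply: (Along_sub (subr g1 g5)); apply: (Along_sub (subl g2 g4)).
    apply: (fan_Along T_tree lts_total UH hA1 hF F0 mA1 ft) => [n|n|n y sy]; [exact: Fs|exact: fs|].
    have [ty _ _] := tP (phi n); have {}ty := ty y sy; have qt := ft.1 n.
    by split; [exact: lt_trans ty|apply/esym/(Is_eq T_tree qt)/ltW].
  apply: (Along_sub (subr g1 g5)); apply: (Along_sub (subr g2 g4)).
  (* The part [u n] follows [r] beyond [r n]; it can be nonempty only if [t (phi n)] equals [r n],
     and then lies in one piece. The part [w n] leaves the branch exactly at [r n]. *)
  pose u n := s (phi n) `&` [set y | (r n < meet y (r n.+1))%O].
  pose w n := s (phi n) `&` [set y | ~ (r n < meet y (r n.+1))%O].
  have -> : s \o phi = fun n => u n `|` w n.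
    apply/funext => n; rewrite /u /w -setIUr; apply/esym/setIidl => y _ /=.
    exact: EM.
  have ry n y : s (phi n) y -> (r n <= y)%O.
    by move=> sy; have [ty _ _] := tP (phi n); apply: le_trans (rt n) (ltW (ty y sy)).
  apply: (AlongU UH).
    apply: (multiplies_Along mE) => n.
    have [_ _ tE] := tP (phi n).
    apply: hE (tE (Is (t (phi n)) (r n.+1))) _ => y [sy ryr]; split=> //=.
    have [ty _ _] := tP (phi n); have {}ty := ty y sy.
    have tr1 := tr n n.+1 (ltnSn n).
    have /orP[le|le] := tree_total T_tree (ltW ty) (leIl y (r n.+1)); last first.
      have : (meet y (r n.+1) <= r n)%O by rewrite -tr1 lexI le leIr.
      by move=> /(lt_le_trans ryr); rewrite ltxx.
    have tn : t (phi n) = r n.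
      by rewrite -[RHS]tr1; apply/esym/meet_idPl; exact: le_trans le (leIr _ _).
    have trn : (t (phi n) < r n.+1)%O by rewrite tn; exact: ri.
    by apply/(Is_meet T_tree ty trn); rewrite tn.
  apply: (comb_Along UH hC1 hF F0 mC1 ri) => [n|n|m n y [sy nry] mn].
  - by apply: hF (Fs (phi n)) _ => y [].
  - by apply: sub_finite_set (fs (phi n)) => y [].
  have e : meet y (r m.+1) = r m.
    apply/esym/eqP; rewrite eq_le lexI (ry _ _ sy) (ltW (ri _ _ (ltnSn m))) /=.
    have /orP[//|] := tree_total T_tree (leIr (r m.+1) y) (ltW (ri _ _ (ltnSn m))).
    by rewrite (le_eqVlt (r m)) => /predU1P[<-|/nry//].
  rewrite -[RHS]e; apply: (meet_trunc T_tree).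
    by move: mn; rewrite leq_eqVlt => /orP[/eqP <-//|/ri/ltW].
  by move=> h; have := ri _ _ (ltnSn m); rewrite -e (meet_idPr h) ltxx.
- have [C' DC' mC'] := cs_mult sysC hl DC_C UH sc cl.
  have [hC fC C0 rC] := finC DC_C; have [hC' fC' C'0 rC'] := finC DC'.
  have [hE fE E0] := generated_fam gE; have [hE' fE' E'0] := generated_fam gE'.
  set F := comb_family C E; have gF : generated l F := generated_comb DC_C gE.
  have [hF fF F0] := generated_fam gF.
  have g1 := generated_comb DC' (generated_sqcup gE gE').
  have g2 := generated_fan DA1 gF; have g3 := generated_comb DC1 gF.
  have g4 := generated_sqcup g2 g3; have g5 := generated_sqcup gE' g4.
  have g6 := generated_sqcup g1 g5.
  eexists; first exact: g6.
  apply: Along_multiplies => s Fs.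
  have fs n : finite_set (s n) := fF _ (Fs n).
  have /choice[q qP] n : exists q, C (meet^~ q @` s n) /\
    forall p, E (s n `&` [set y | meet y q = p]) by have [_] := Fs n.
  have [phi [phim phiP]] := tree_subsequence T_tree q; exists phi; split=> //.
  (* Up to [r n] the node [q (phi n)] follows a branch common to all: this is the whole of it, the
     root of the fan, or the branching point of the comb. *)
  have [r [rmono rq wcase]] : exists r : nat -> T,
      [/\ forall m n, (m <= n)%N -> (r m <= r n)%O, forall n, (r n <= q (phi n))%O &
      (forall n, r n = q (phi n)) \/ ((exists t, (forall n, r n = t) /\ fan t (q \o phi)) \/
      comb r (q \o phi))].
    have [[p qp]|[t ft]|[r [ri rq qr]]] := phiP.
    + by exists (q \o phi); split=> [m n _|n|]; [rewrite /= !qp|exact: lexx|left].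
    + exists (fun=> t); split=> [//|n|]; first exact/ltW/ft.1.
      by right; left; exists t.
    + exists r; split=> //; last by right; right; split.
      by move=> m n; rewrite leq_eqVlt => /orP[/eqP ->//|/ri/ltW].
  (* Relative to [r n]: [lo n] leaves before it, with all its meets on the common branch; [u n]
     leaves [q (phi n)] exactly there and is a single piece; [w n] continues with [q (phi n)] and
     inherits the shape of the sequence of these nodes. *)
  pose lo n := s (phi n) `&` [set y | ~ (r n <= y)%O].
  pose u n := s (phi n) `&` [set y | meet y (q (phi n)) = r n].
  pose w n := s (phi n) `&` [set y | (r n < meet y (q (phi n)))%O].
  have -> : s \o phi = fun n => lo n `|` (u n `|` w n).
    apply/funext => n; apply/seteqP; split=> [y sy|y [[]|[[]|[]]]//].
    have [ry|nry] := pselect (r n <= y)%O; last by left.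
    right; have : (r n <= meet y (q (phi n)))%O by rewrite lexI ry rq.
    by rewrite le_eqVlt => /predU1P[e|lt']; [left|right].
  apply: (AlongU UH); last apply: (AlongU UH).
  + apply: (path_Along T_tree (r := r) (q := q \o phi) UH hC fC rC mC' hC' hE E0 E'0 mE rmono).
    * move=> n; apply: hC (qP (phi n)).1 _ => _ [y [sy _] <-]; by exists y.
    * by move=> n p; apply: hE ((qP (phi n)).2 p) _ => y [[sy _] yp].
    * by move=> n; apply: sub_finite_set (fs (phi n)) => y [].
    * move=> m n y [sy nry] mn /=.
      by rewrite (meet_trunc T_tree (rq m) nry) (meet_trunc T_tree (rmono _ _ mn) nry).
  + apply: (multiplies_Along mE) => n; exact: (qP (phi n)).2.
  have Fw n : F (w n) by apply: hF (Fs (phi n)) _ => y [].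
  have fw n : finite_set (w n) := fF _ (Fw n).
  have [rE|[[t [rt ft]]|[ri _ qr]]] := wcase.
  + apply: (Along_sub (subl g2 g3)) => psi psim; exists id; split=> // X _.
    rewrite (_ : \bigcup_(n in X) _ = set0).
      by have [_ _] := generated_fam g2.
    apply/seteqP; split=> // y [n _ [_ /=]]; rewrite rE => h.
    by have := lt_le_trans h (leIr _ _); rewrite ltxx.
  + apply: (Along_sub (subl g2 g3)).
    apply: (fan_Along T_tree lts_total UH hA1 hF F0 mA1 ft Fw fw) => n y [sy /=].
    rewrite rt => tyq; have ty := lt_le_trans tyq (leIl _ _); split=> //.
    exact/(Is_meet T_tree ty (ft.1 n)).
  + apply: (Along_sub (subr g2 g3)).
    apply: (comb_Along UH hC1 hF F0 mC1 ri Fw fw) => m n y [sy /= ryq] mn.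
    have rm : (r m <= meet y (r n))%O.
      rewrite lexI (rmono _ _ (ltnW mn)) andbT.
      exact: le_trans (ltW ryq) (leIl _ _).
    apply/esym/eqP; rewrite eq_le rm /= -[X in (_ <= X)%O](qr m n mn) lexI leIr andbT /=.
    have /orP[le|le] := tree_total T_tree (leIl y (r n)) (leIl y (q (phi m))).
      exact: le_trans le (leIr _ _).
    have : (meet y (q (phi m)) <= r m)%O.
      by rewrite -(qr m n mn) lexI leIr (le_trans le (leIr _ _)).
    by move=> /(lt_le_trans ryq); rewrite ltxx.
Qed.

End Level.

Lemma generated_mono l m E : exp_indecomposable l -> exp_indecomposable m -> ole l m ->
  generated l E -> generated m E.
Proof.
move=> hl hm lm; elim=> {E} [|E F _ gE _ gF|A E DA_A _ gE|C E DC_C _ gE].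
- exact: generated_points.
- exact: generated_sqcup.
- by apply: generated_fan => //; exact: (cs_mono sysA hl hm lm).
- by apply: generated_comb => //; exact: (cs_mono sysC hl hm lm).
Qed.

Lemma range_infinite (J : Type) (v : nat -> J) : injective v -> infinite_set (range v).
Proof.
move=> vi fv; apply: infinite_nat; rewrite -(preimage_range v).
by apply: finite_preimage fv => m n _ _; exact: vi.
Qed.

Lemma CB_reindex (J K : Type) (F : set_family J) (G : set_family K)
    (v : nat -> J) (x : nat -> K) b :
  hereditary F -> finitary F -> hereditary G -> finitary G ->
  injective v -> injective x -> (forall e, F e -> e `<=` range v) ->
  (forall e, F e -> G (x @` (v @^-1` e))) -> CB F b set0 -> CB G b set0.
Proof.
move=> hF fF hG fG vi xi Fv FG.
have -> : (set0 : set K) = x @` (v @^-1` set0) by rewrite preimage_set0 image_set0.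
apply: (CB_transfer (m := fun e => x @` (v @^-1` e))) => // e X Fe iX Xe iN.
apply: iX; have := finite_image v (finite_preimage (in2W xi) iN).
apply: sub_finite_set => i Xi; have [ei Fi] := Xe i Xi.
have [n _ vn] : range v i by apply: (Fv _ Fi); left.
exists n => //; split.
  by move=> [m em /xi mn]; apply: ei; rewrite -vn -mn.
exists i; split=> // _ [->|[m em <-]]; first by exists n => //; left.
by exists m => //; right.
Qed.

(** An infinite set contains a fan or a comb, a constant subsequence being excluded by injectivity.
    Its successors, or its branching points, form an infinite chain, and the rank of [A] or [C] on
    that chain is carried over to the points themselves, with pieces of size at most one. *)
Lemma generated_large l a : is_iota a l -> ole oomega a ->
  exists2 E, generated l E & rank_ge N E a.
Proof.
move=> il wa; have [hl _ _] := il.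
have [A DA_A Age] := cs_large sysA il wa; have [C DC_C Cge] := cs_large sysC il wa.
have [cA hA A0 rA] := cs_fam sysA hl DA_A; have [cC hC C0 rC] := cs_fam sysC hl DC_C.
set Q := chains_le N 1; have gQ : generated l Q := generated_points l.
have [hQ fQ Q0] := generated_fam hl gQ.
have gF := generated_fan DA_A gQ; have gG := generated_comb DC_C gQ.
have [hF fF F0] := generated_fam hl gF; have [hG fG G0] := generated_fam hl gG.
have gE := generated_sqcup gF gG; have [hE fE E0] := generated_fam hl gE.
exists (sqcup N (fan_family A Q) (comb_family C Q)) => // M [iM _].
set E := sqcup _ _ _ in hE fE E0 gE *.
have hEM := @fam_restrict_hereditary _ E M hE; have fEM := @fam_restrict_finitary _ E M fE.
have [j [ji jM]] := infinite_inj iM.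
have single (v x : nat -> T) (f : T -> T) (e : set T) i : injective v ->
    (forall n, e (v n) -> f (x n) = v n) ->
    Q ((x @` (v @^-1` e)) `&` [set y | f y = i]).
  move=> vi fx; apply/chains_le1P.
  have [[n vn]|none] := pselect (exists n, v n = i); last first.
    left; apply/seteqP; split=> // y [[n en <-] /=]; rewrite fx// => vn.
    by apply: none; exists n.
  have : (x @` (v @^-1` e)) `&` [set y | f y = i] `<=` [set x n].
    by move=> y [[m em <-] /=]; rewrite fx// -vn => /vi ->.
  by move=> /subset_set1[->|->]; [left|right; exists (x n)].
have fin (v x : nat -> T) e : injective v -> finite_set e -> finite_set (x @` (v @^-1` e)).
  by move=> vi fe; apply: finite_image; apply: finite_preimage fe; exact: in2W.
have [phi [phim phiP]] := tree_subsequence T_tree j.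
have xi : injective (j \o phi).
  move=> m n /ji; have [/phim lt'|/phim lt'|//] := ltngtP m n => e; by rewrite e ltnn in lt'.
case: phiP => [[q jq]|[t [tj tI]]|[r [ri rj jr]]].
- by have /ji e := etrans (jq 0) (esym (jq 1)); have := phim 0 1 isT; rewrite e ltnn.
- pose v n := Is t (j (phi n)).
  have vi : injective v.
    move=> m n; have [mn|nm|//] := ltngtP m n => e.
      by case: (tI _ _ mn); exact: e.
    by case: (tI _ _ nm); exact: esym e.
  apply: (CB_reindex (F := fam_restrict A (range v)) _ _ hEM fEM vi xi).
  + exact: fam_restrict_hereditary.
  + exact: fam_restrict_finitary (on_chains_finitary cA).
  + by move=> e [].
  + move=> e [Ae ev]; split; last by move=> _ [n _ <-]; exact: jM.
    exists ((j \o phi) @` (v @^-1` e)), set0; split=> //; last exact: is_chain_neq.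
      split; first exact/fin/(on_chains_finitary cA).
      exists t; split; first by move=> _ [n _ <-]; exact: tj.
        by apply: hA Ae _ => _ [_ [n en <-] <-].
      by move=> i; exact: single.
    by rewrite setU0.
  apply: Age; split; first exact: range_infinite.
  have -> : range v = Is t @` (range (j \o phi)) by rewrite image_comp.
  by apply: (is_chain_Is T_tree lts_total) => _ [n _ <-]; exact: tj.
- have rinj : injective r.
    by move=> m n; have [/ri lt'|/ri lt'|//] := ltngtP m n => e; move: lt'; rewrite e ltxx.
  apply: (CB_reindex (F := fam_restrict C (range r)) _ _ hEM fEM rinj xi).
  + exact: fam_restrict_hereditary.
  + exact: fam_restrict_finitary (on_chains_finitary cC).
  + by move=> e [].
  + move=> e [Ce er]; split; last by move=> _ [n _ <-]; exact: jM.
    have fe := on_chains_finitary cC Ce.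
    exists set0, ((j \o phi) @` (r @^-1` e)); split=> //; last exact: is_chain_neq.
      split; first exact: fin.
      have [K eK] := finite_nat_bound (finite_preimage (in2W rinj) fe).
      exists (r K); split.
        apply: hC Ce _ => _ [_ [n en <-] <-]; rewrite /= (jr n K) //; exact: eK.
      by move=> i; apply: (single r (j \o phi) (meet^~ (r K))) => // n en; apply: jr; exact: eK.
    by rewrite set0U.
  apply: Cge; split; first exact: range_infinite.
  exact: is_chain_increasing.
Qed.

(* Below [omega] the rank of [tree_family A C] need not be finite, whence the    *)
(* separate treatment of the families of sets of bounded size. *)
Definition tree_system (l : Ord) : set (set_family T) :=
  [set E | [/\ hereditary E, finitary E, E set0 &
    (ole l oomega /\ exists n, forall s, E s -> s #<= `I_n) \/
    (olt oomega l /\ exists2 F, generated l F & E `<=` F)]].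

Lemma tree_system_sub l E F : hereditary F -> finitary F -> F set0 -> F `<=` E ->
  tree_system l E -> tree_system l F.
Proof.
move=> hF fF F0 FE [_ _ _ [[lw [n En]]|[wl [G gG EG]]]]; split=> //; [left|right]; split=> //.
  by exists n => s /FE/En.
by exists G => //; exact: subset_trans EG.
Qed.

Lemma generated_tree_system l E : exp_indecomposable l -> olt oomega l -> generated l E ->
  tree_system l E.
Proof.
move=> hl wl gE; have [hE fE E0] := generated_fam hl gE.
by split=> //; right; split=> //; exists E.
Qed.

Lemma tree_system_chains_le l n : exp_indecomposable l -> tree_system l (chains_le N n).
Proof.
move=> hl; split; [exact: chains_le_hereditary|
  exact: on_chains_finitary (@chains_le_on_chains _ N n)|exact: chains_le_set0|].
have [wl|lw] := olt_total oomega l; last by left; split=> //; exists n => s [].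
right; split=> //; have [E gE nE] := generated_chains_le hl n.
by exists E.
Qed.

Lemma chain_system_tree : chain_system N tree_system.
Proof.
have cN E : finitary E -> family_on_chains N E.
  by move=> fE s /fE fs; split=> //; exact: is_chain_neq.
split.
- move=> l E hl [hE fE E0 DE]; split=> //; first exact: cN.
  case: DE => [[lw [n En]]|[wl [F gF EF]]] El.
    apply: (sub_chains_le_rank hE fE En).
    exact: CB_anti hE fE (oltW (expi_nat hl _)) _ El.
  have [A [C [DA_A DC_C FAC]]] := generated_sub hl gF.
  have [cA hA A0 rA] := cs_fam sysA hl DA_A; have [cC hC C0 rC] := cs_fam sysC hl DC_C.
  have fA := on_chains_finitary cA; have fC := on_chains_finitary cC.
  apply: (tree_family_rank T_tree hA fA A0 rA hC fC C0 rC hl wl).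
  apply: CB_mono hE fE _ _ _ _ El; first exact: tree_family_hereditary.
    by move=> s [].
  exact: subset_trans FAC.
- move=> l m E hl hm lm [hE fE E0 [[lw [n En]]|[wl [F gF EF]]]].
    apply: tree_system_sub (tree_system_chains_le n hm) => // s Es.
    by split; [exact: En|exact: is_chain_neq].
  split=> //; right; split; first exact: olt_ole_trans lm.
  by exists F => //; exact: generated_mono gF.
- by move=> l n hl; exact: tree_system_chains_le.
- move=> l E F hl [hE fE E0 DE] [hF fF F0 DF]; exists (sqcup N E F) => //.
  split; [exact: sqcup_hereditary|exact: sqcup_finitary| |].
    by apply: sqcup_ge => //; exact: cN.
  case: DE => [[lw [m Em]]|[wl [E' gE' EE']]].
    case: DF => [[_ [n Fn]]|[/oltNge/(_ lw)//]].
    left; split=> //; exists (m + n) => _ [s [t [/Em sm /Fn tn -> _]]].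
    exact: card_le_U.
  case: DF => [[/(oltNge wl)//]|[_ [F' gF' FF']]].
  right; split=> //; exists (sqcup N E' F'); first exact: generated_sqcup.
  by move=> _ [s [t [/EE' E's /FF' F't -> c]]]; exists s, t.
- move=> l E H c hl [hE fE E0 [[lw [n En]]|[wl [F gF EF]]]] UH sc cl.
    (* At level omega the small rank of [H] is finite, so by [uniform_size] the members of [H] have
       bounded size. *)
    have [k ck] := olt_ole_trans cl lw.
    exists (chains_le N (k * n)); first exact: tree_system_chains_le.
    move=> s Es _; exists id; split=> // x Hx; split; last exact: is_chain_neq.
    by apply: card_le_bigcup; [exact: (uniform_size UH sc ck)|move=> i; exact: En].
  have [E' gE' mE'] := generated_mult hl UH sc cl gF.
  exists E'; first exact: generated_tree_system.
  by move=> s Es; apply: mE' => n; exact: EF.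
- move=> l a il wa; have [E gE Ege] := generated_large il wa; have [hl al _] := il.
  exists E => //; apply: generated_tree_system => //; exact: ole_olt_trans wa al.
Qed.

End TreeSystem.

Lemma infinite_tree_chain (d : Order.disp_t) (T : bMeetSemilatticeType d)
    (lts : T -> T -> T -> Prop) : is_tree T ->
  (forall t : T, strict_total_order_on (imm_succ t) (lts t)) -> infinite_set [set: T] ->
  (exists C : set T, infinite_chain (fun x y : T => (x < y)%O) C) \/
  (exists C : set T, infinite_chain (lt_a lts) C).
Proof.
move=> T_tree lts_total iT; have [j [ji _]] := infinite_inj iT.
have [phi [phim [[q jq]|[t [tj tI]]|[r [ri _ _]]]]] := tree_subsequence T_tree j.
- by have /ji e := etrans (jq 0) (esym (jq 1)); have := phim 0 1 isT; rewrite e ltnn.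
- right; exists (Is t @` range (j \o phi)); split.
    rewrite image_comp; apply: range_infinite => m n; have [mn|nm|//] := ltngtP m n => e.
      by case: (tI _ _ mn); exact: e.
    by case: (tI _ _ nm); exact: esym e.
  by apply: (is_chain_Is T_tree lts_total) => _ [n _ <-]; exact: tj.
- left; exists (range r); split; last exact: is_chain_increasing.
  apply: range_infinite => m n.
  by have [/ri lt'|/ri lt'|//] := ltngtP m n => e; move: lt'; rewrite e ltxx.
Qed.

Theorem theorem3p1 (d : Order.disp_t) (T : bMeetSemilatticeType d)
    (T_tree : is_tree T) (T_infinite : infinite_set [set: T])
    (lts : T -> T -> T -> Prop)
    (lts_total : forall t : T, strict_total_order_on (imm_succ t) (lts t)) :
  has_basis_on_set T <->
  ((exists C : set T, infinite_chain (fun x y : T => (x < y)%O) C) ->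
     has_basis_on_chains (fun x y : T => (x < y)%O)) /\
  ((exists C : set T, infinite_chain (lt_a lts) C) ->
     has_basis_on_chains (lt_a lts)).
Proof.
split=> [/has_basis_on_setP bT|[bC bA]].
  by split=> exC; exact: basis_on_chains_of_all.
apply/has_basis_on_setP.
have [DA sysA] := system_of_basis_opt bA; have [DC sysC] := system_of_basis_opt bC.
(* Whichever order has an infinite chain provides the basis from which the existence of [iota] and
   of the small ranks of uniform families is taken. *)
have [R bR] : exists R : T -> T -> Prop, has_basis_on_chains R.
  have [/bC b|/bA b] := infinite_tree_chain T_tree lts_total T_infinite;
  by eexists; exact: b.
apply: (basis_of_system (chain_system_tree T_tree lts_total sysA sysC)).
- by exists setT; split=> //; exact: is_chain_neq.
- by move=> a wa ca; exact: (basis_iota bR).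
- by move=> H UH; exact: (basis_uniform bR).
Qed.
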